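(* Let $\varepsilon_1\in\{1,-1\}$ and consider the $D_4^{\pm}$-singularity (bifurcation set of an $\mathcal{R}^+$-versal unfolding of $u^3/3!+\varepsilon_1uv^2/2$, in the normal form of the context) with its parametrizations $b=b_{\varepsilon_1,\varepsilon_2}$, $\varepsilon_2=\pm1$. Assume that the set of ridge points and the set of subparabolic points are curves, in the following concrete sense: for each $\varepsilon_2=\pm1$ and each $i=1,2,3$, $C_i'(\theta)\neq0$ for every $\theta$ with $C_i(\theta)=0$, where ($'=\partial/\partial\theta$) $$C_1=a(\theta,0)\,(2\lambda'E_0+3\lambda E_0')+2\lambda E_0\,a'(\theta,0),$$ $$C_2=-E_1L_0N_0+E_0'M_0N_0+2E_0(L_0N_1-M_0N_0'),\qquad C_3=2E_0N_0'-E_0'N_0 .$$ Then: 1. the number of ridge curves with respect to the unbounded principal curvature emanating from the singular point is at most $18$; 2. the number of ridge curves with respect to the bounded principal curvature emanating from the singular point is at most $18$; 3. there are no subparabolic points with respect to the unbounded principal curvature near the singular point; 4. the number of subparabolic curves with respect to the bounded principal curvature emanating from the singular point is at most $10$.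
   Context: Normal form. All maps are $C^\infty$. The versal unfolding is (after a $P$-$\mathcal{R}^+$-isometry, which changes the bifurcation set only by an isometry of $\mathbb{R}^3$) $$F=\frac{u^3}{3!}+\varepsilon_1\frac{uv^2}{2}+P(x,y,z)u+Q(x,y,z)v+R(x,y,z)\frac{u^2-\varepsilon_1v^2}{2},$$ where $P,Q,R:(\mathbb{R}^3,0)\to(\mathbb{R},0)$ satisfy $P_y(0)=P_z(0)=Q_z(0)=0$ and $P_x(0),Q_y(0),R_z(0)>0$. The bifurcation set is the set of $(x,y,z)$ for which there is $(u,v)$ with $F_u=F_v=0$ and $F_{uu}F_{vv}-F_{uv}^2=0$. Parametrization. Let $\varepsilon_2\in\{1,-1\}$. For $\varepsilon_1=-1$ put $\alpha(\theta)=\frac{\cos^22\theta-\sin^22\theta}{2}+\varepsilon_2\cos2\theta$, $\beta(\theta)=-\cos2\theta\sin2\theta+\varepsilon_2\sin2\theta$, $\theta\in\mathbb{R}/2\pi\mathbb{Z}$. For $\varepsilon_1=1$ put $\alpha(\theta)=\frac{\cosh^22\theta+\sinh^22\theta}{2}+\varepsilon_2\cosh2\theta$, $\beta(\theta)=\cosh2\theta\sinh2\theta-\varepsilon_2\sinh2\theta$, $\theta\in\mathbb{R}$. Let $X(\theta,x,y,z)=P+R^2\alpha(\theta)$, $Y(\theta,x,y,z)=Q+R^2\beta(\theta)$. By the implicit function theorem, for $(x,y,z)$ near $0$ the equations $X=Y=0$ are solved uniquely by $C^\infty$ functions $x=x(\theta,z)$, $y=y(\theta,z)$ defined near $\{z=0\}$,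 and $b_{\varepsilon_1,\varepsilon_2}(\theta,z)=(x(\theta,z),y(\theta,z),z)$. It parametrizes a double cover of the bifurcation set if $\varepsilon_1=-1$; if $\varepsilon_1=1$, $b_{1,1},b_{1,-1}$ together parametrize the bifurcation set except for its intersection curves. The set $\{z=0\}$ is mapped to $0$, the singular point. Normal. With $dX=(X_x,X_y,X_z)$, $dY=(Y_x,Y_y,Y_z)$ evaluated at $(\theta,x(\theta,z),y(\theta,z),z)$ put $\tilde\nu=\sin\theta\,dX+\cos\theta\,dY$ for $(\varepsilon_1,\varepsilon_2)=(-1,1)$; $\cos\theta\,dX-\sin\theta\,dY$ for $(-1,-1)$; $-\cosh\theta\,dY+\sinh\theta\,dX$ for $(1,1)$; $-\sinh\theta\,dY+\cosh\theta\,dX$ for $(1,-1)$; and $\nu=\tilde\nu/|\tilde\nu|$, a unit normal of $b$. Auxiliary functions. $\lambda(\theta)=\sin3\theta,\ \cos3\theta,\ \sinh3\theta,\ \cosh3\theta$ for $(\varepsilon_1,\varepsilon_2)=(-1,1),(-1,-1),(1,1),(1,-1)$ respectively. $\tilde R(\theta,z)$ is defined by $R(x(\theta,z),y(\theta,z),z)=z\tilde R(\theta,z)$, and $a(\theta,z)=4\tilde R^2/(X_xY_y-X_yY_x)$ (evaluated along $x(\theta,z),y(\theta,z)$). Let $E=b_\theta\cdot b_\theta$, $L=-b_\theta\cdot\nu_\theta$, $M=-b_\theta\cdot\nu_z$, $N=-b_z\cdot\nu_z$. The functions $E_0,E_1,L_0,M_0,N_0,N_1$ of $\theta$ are the Taylor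 coefficients at $z=0$ in $E/(z^4\lambda^2a^2)=E_0+zE_1+O(z^2)$, $|\tilde\nu|L/(z^2\lambda a)=L_0+O(z)$, $|\tilde\nu|M/(z^2\lambda a)=M_0+O(z)$, $|\tilde\nu|N=N_0+zN_1+O(z^2)$ (the quotients extend smoothly). Principal curvatures. Near $\{z=0\}$ one principal curvature of $b$, denoted $\kappa_1$ (the unbounded principal curvature), is unbounded near $z=0$, and the other, $\kappa_2$ (the bounded principal curvature), extends $C^\infty$ across the singular set; the principal directions of $\kappa_1,\kappa_2$ are spanned by non-vanishing $C^\infty$ vector fields $V_1,V_2$ (extended across the singular set). A point is a ridge point with respect to $\kappa_i$ if $V_i\kappa_i=0$ there, and a subparabolic point with respect to $\kappa_i$ if $V_j\kappa_i=0$ there, $j\ne i$. A ridge (subparabolic) curve is a curve consisting of ridge (subparabolic) points. A curve emanating from the singular point means a half-branch, in the bifurcation set, starting at the singular point $0$ (a curve in the source through a point of $\{z=0\}$ transverse to $\{z=0\}$ thus contributes its parts in $z>0$ and $z<0$).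
   Formalization: Item 3 is false next to cuspidal edges (e.g. P=x, Q=y+xz, R=z, ε₁=−1: V₂κ₁=0 on a curve θ≈z/2 at θ=0); the formal item 3 excludes subparabolic points only where C|z|<|λ(θ)|, for |θ|≤T and small z≠0, with C depending on T. *)

(* Defs.v *)
From Stdlib Require Import Arith Factorial Reals List.
From Coquelicot Require Import Coquelicot.
Open Scope R_scope.

Inductive pm := Pos | Neg.

Definition sgn (e : pm) : R := match e with Pos => 1 | Neg => -1 end.

Definition d1 (f : R -> R -> R) : R -> R -> R :=
  fun s t => Derive (fun s' => f s' t) s.
Definition d2 (f : R -> R -> R) : R -> R -> R :=
  fun s t => Derive (fun t' => f s t') t.

Definition D1 (f : R -> R -> R -> R) : R -> R -> R -> R :=
  fun x y z => Derive (fun x' => f x' y z) x.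
Definition D2 (f : R -> R -> R -> R) : R -> R -> R -> R :=
  fun x y z => Derive (fun y' => f x y' z) y.
Definition D3 (f : R -> R -> R -> R) : R -> R -> R -> R :=
  fun x y z => Derive (fun z' => f x y z') z.

(* For U open, [Ck2 n U f] says that f is of class C^n on U: all iterated
   partial derivatives of order at most n exist on U, those of order n being
   continuous. *)
Fixpoint Ck2 (n : nat) (U : R -> R -> Prop) (f : R -> R -> R) : Prop :=
  match n with
  | O => forall s t, U s t -> continuity_2d_pt f s t
  | S m =>
      (forall s t, U s t ->
         ex_derive (fun s' => f s' t) s /\ ex_derive (fun t' => f s t') t) /\
      Ck2 m U (d1 f) /\ Ck2 m U (d2 f)
  end.

Definition smooth2 (U : R -> R -> Prop) (f : R -> R -> R) : Prop :=
  forall n, Ck2 n U f.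

Fixpoint Ck3 (n : nat) (W : R -> R -> R -> Prop) (f : R -> R -> R -> R) : Prop :=
  match n with
  | O => forall x y z, W x y z ->
      continuous (fun v : R * R * R => f (fst (fst v)) (snd (fst v)) (snd v))
                 (x, y, z)
  | S m =>
      (forall x y z, W x y z ->
         ex_derive (fun x' => f x' y z) x /\
         ex_derive (fun y' => f x y' z) y /\
         ex_derive (fun z' => f x y z') z) /\
      Ck3 m W (D1 f) /\ Ck3 m W (D2 f) /\ Ck3 m W (D3 f)
  end.

Definition smooth3 (W : R -> R -> R -> Prop) (f : R -> R -> R -> R) : Prop :=
  forall n, Ck3 n W f.

Definition vec := (R * R * R)%type.

Definition vx (v : vec) : R := fst (fst v).
Definition vy (v : vec) : R := snd (fst v).
Definition vz (v : vec) : R := snd v.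

Definition vadd (v w : vec) : vec := (vx v + vx w, vy v + vy w, vz v + vz w).
Definition vscal (c : R) (v : vec) : vec := (c * vx v, c * vy v, c * vz v).
Definition dot (v w : vec) : R := vx v * vx w + vy v * vy w + vz v * vz w.
Definition vnorm (v : vec) : R := sqrt (dot v v).

Definition vd1 (f : R -> R -> vec) (s t : R) : vec :=
  (d1 (fun s t => vx (f s t)) s t,
   d1 (fun s t => vy (f s t)) s t,
   d1 (fun s t => vz (f s t)) s t).
Definition vd2 (f : R -> R -> vec) (s t : R) : vec :=
  (d2 (fun s t => vx (f s t)) s t,
   d2 (fun s t => vy (f s t)) s t,
   d2 (fun s t => vz (f s t)) s t).

(* Representatives on the open set [gW] of the germs P, Q, R at 0. *)
Record germs := Germs {
  gW : R -> R -> R -> Prop;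
  gP : R -> R -> R -> R;
  gQ : R -> R -> R -> R;
  gR : R -> R -> R -> R
}.

Record normal_form (g : germs) : Prop := {
  nf_open : open (fun v : vec => gW g (vx v) (vy v) (vz v));
  nf_origin : gW g 0 0 0;
  nf_smooth : smooth3 (gW g) (gP g) /\ smooth3 (gW g) (gQ g) /\ smooth3 (gW g) (gR g);
  nf_zero : gP g 0 0 0 = 0 /\ gQ g 0 0 0 = 0 /\ gR g 0 0 0 = 0;
  nf_triangular :
    D2 (gP g) 0 0 0 = 0 /\ D3 (gP g) 0 0 0 = 0 /\ D3 (gQ g) 0 0 0 = 0;
  nf_positive :
    0 < D1 (gP g) 0 0 0 /\ 0 < D2 (gQ g) 0 0 0 /\ 0 < D3 (gR g) 0 0 0
}.

Definition unfolding (e1 : pm) (g : germs) (u v x y z : R) : R :=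
  u ^ 3 / INR (fact 3) + sgn e1 * (u * v ^ 2 / 2)
  + gP g x y z * u + gQ g x y z * v
  + gR g x y z * ((u ^ 2 - sgn e1 * v ^ 2) / 2).

Definition bifurcation_set (e1 : pm) (g : germs) (w : vec) : Prop :=
  gW g (vx w) (vy w) (vz w) /\
  exists u v : R,
    let F := fun u v => unfolding e1 g u v (vx w) (vy w) (vz w) in
    d1 F u v = 0 /\ d2 F u v = 0 /\
    d1 (d1 F) u v * d2 (d2 F) u v - d2 (d1 F) u v ^ 2 = 0.

Definition alpha (e1 e2 : pm) (th : R) : R :=
  match e1 with
  | Neg => (cos (2 * th) ^ 2 - sin (2 * th) ^ 2) / 2 + sgn e2 * cos (2 * th)
  | Pos => (cosh (2 * th) ^ 2 + sinh (2 * th) ^ 2) / 2 + sgn e2 * cosh (2 * th)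
  end.

Definition beta (e1 e2 : pm) (th : R) : R :=
  match e1 with
  | Neg => - cos (2 * th) * sin (2 * th) + sgn e2 * sin (2 * th)
  | Pos => cosh (2 * th) * sinh (2 * th) - sgn e2 * sinh (2 * th)
  end.

Definition lam (e1 e2 : pm) (th : R) : R :=
  match e1, e2 with
  | Neg, Pos => sin (3 * th)
  | Neg, Neg => cos (3 * th)
  | Pos, Pos => sinh (3 * th)
  | Pos, Neg => cosh (3 * th)
  end.

Definition Xf (e1 e2 : pm) (g : germs) (th : R) : R -> R -> R -> R :=
  fun x y z => gP g x y z + gR g x y z ^ 2 * alpha e1 e2 th.
Definition Yf (e1 e2 : pm) (g : germs) (th : R) : R -> R -> R -> R :=
  fun x y z => gQ g x y z + gR g x y z ^ 2 * beta e1 e2 th.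

(* The solution (x(theta,z), y(theta,z)) of X = Y = 0, on a neighbourhood [pU]
   of {z = 0}. For [e1 = Neg] the variable theta is a lift to the real line of
   the angle in R/2piZ; periodicity of the solution near {z = 0} follows from
   its local uniqueness. *)
Record param := Param {
  pU : R -> R -> Prop;
  px : R -> R -> R;
  py : R -> R -> R
}.

Record is_param (e1 e2 : pm) (g : germs) (c : param) : Prop := {
  par_open : forall th z, pU c th z -> locally_2d (pU c) th z;
  par_axis : forall th, pU c th 0;
  par_smooth : smooth2 (pU c) (px c) /\ smooth2 (pU c) (py c);
  par_zero : forall th, px c th 0 = 0 /\ py c th 0 = 0;
  par_dom : forall th z, pU c th z -> gW g (px c th z) (py c th z) z;
  par_eq : forall th z, pU c th z ->
    Xf e1 e2 g th (px c th z) (py c th z) z = 0 /\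
    Yf e1 e2 g th (px c th z) (py c th z) z = 0
}.

Definition b (c : param) (th z : R) : vec := (px c th z, py c th z, z).

(* [f] is a function of (theta,x,y,z); its x-, y- and z-derivatives (not the
   theta-derivative) along b. *)
Definition grad_along (f : R -> R -> R -> R -> R) (c : param) (th z : R) : vec :=
  (D1 (f th) (px c th z) (py c th z) z,
   D2 (f th) (px c th z) (py c th z) z,
   D3 (f th) (px c th z) (py c th z) z).

Definition dX (e1 e2 : pm) (g : germs) (c : param) : R -> R -> vec :=
  grad_along (Xf e1 e2 g) c.
Definition dY (e1 e2 : pm) (g : germs) (c : param) : R -> R -> vec :=
  grad_along (Yf e1 e2 g) c.

Definition nut (e1 e2 : pm) (g : germs) (c : param) (th z : R) : vec :=
  let X := dX e1 e2 g c th z in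
  let Y := dY e1 e2 g c th z in
  match e1, e2 with
  | Neg, Pos => vadd (vscal (sin th) X) (vscal (cos th) Y)
  | Neg, Neg => vadd (vscal (cos th) X) (vscal (- sin th) Y)
  | Pos, Pos => vadd (vscal (- cosh th) Y) (vscal (sinh th) X)
  | Pos, Neg => vadd (vscal (- sinh th) Y) (vscal (cosh th) X)
  end.

Definition nu (e1 e2 : pm) (g : germs) (c : param) (th z : R) : vec :=
  vscal (/ vnorm (nut e1 e2 g c th z)) (nut e1 e2 g c th z).

Definition fE (c : param) (th z : R) : R := dot (vd1 (b c) th z) (vd1 (b c) th z).
Definition fF (c : param) (th z : R) : R := dot (vd1 (b c) th z) (vd2 (b c) th z).
Definition fG (c : param) (th z : R) : R := dot (vd2 (b c) th z) (vd2 (b c) th z).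
Definition fL (e1 e2 : pm) (g : germs) (c : param) (th z : R) : R :=
  - dot (vd1 (b c) th z) (vd1 (nu e1 e2 g c) th z).
Definition fM (e1 e2 : pm) (g : germs) (c : param) (th z : R) : R :=
  - dot (vd1 (b c) th z) (vd2 (nu e1 e2 g c) th z).
Definition fN (e1 e2 : pm) (g : germs) (c : param) (th z : R) : R :=
  - dot (vd2 (b c) th z) (vd2 (nu e1 e2 g c) th z).

(* [qR] is R/z along b; [qE], [qL], [qM] are the smooth extensions of
   E/(z^4 lambda^2 a^2), |nut| L/(z^2 lambda a), |nut| M/(z^2 lambda a).
   The defining equations below determine them near {z = 0}, since
   {z <> 0, lambda <> 0} is dense there. *)
Record quotients := Quotients {
  qR : R -> R -> R;
  qE : R -> R -> R;
  qL : R -> R -> R;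
  qM : R -> R -> R
}.

Definition af (e1 e2 : pm) (g : germs) (c : param) (q : quotients) (th z : R) : R :=
  let X := dX e1 e2 g c th z in
  let Y := dY e1 e2 g c th z in
  4 * qR q th z ^ 2 / (vx X * vy Y - vy X * vx Y).

Record is_quotients (e1 e2 : pm) (g : germs) (c : param) (q : quotients) : Prop := {
  quo_smooth : smooth2 (pU c) (qR q) /\ smooth2 (pU c) (qE q) /\
               smooth2 (pU c) (qL q) /\ smooth2 (pU c) (qM q);
  quo_R : forall th z, pU c th z ->
    gR g (px c th z) (py c th z) z = z * qR q th z;
  quo_E : forall th z, pU c th z ->
    fE c th z = z ^ 4 * lam e1 e2 th ^ 2 * af e1 e2 g c q th z ^ 2 * qE q th z;
  quo_L : forall th z, pU c th z ->
    vnorm (nut e1 e2 g c th z) * fL e1 e2 g c th z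
    = z ^ 2 * lam e1 e2 th * af e1 e2 g c q th z * qL q th z;
  quo_M : forall th z, pU c th z ->
    vnorm (nut e1 e2 g c th z) * fM e1 e2 g c th z
    = z ^ 2 * lam e1 e2 th * af e1 e2 g c q th z * qM q th z
}.

Definition E0 (q : quotients) (th : R) : R := qE q th 0.
Definition E1 (q : quotients) (th : R) : R := d2 (qE q) th 0.
Definition L0 (q : quotients) (th : R) : R := qL q th 0.
Definition M0 (q : quotients) (th : R) : R := qM q th 0.

Definition nutN (e1 e2 : pm) (g : germs) (c : param) (th z : R) : R :=
  vnorm (nut e1 e2 g c th z) * fN e1 e2 g c th z.
Definition N0 (e1 e2 : pm) (g : germs) (c : param) (th : R) : R :=
  nutN e1 e2 g c th 0.
Definition N1 (e1 e2 : pm) (g : germs) (c : param) (th : R) : R :=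
  d2 (nutN e1 e2 g c) th 0.

Definition C1 (e1 e2 : pm) (g : germs) (c : param) (q : quotients) (th : R) : R :=
  let a0 := fun s => af e1 e2 g c q s 0 in
  a0 th * (2 * Derive (lam e1 e2) th * E0 q th
           + 3 * lam e1 e2 th * Derive (E0 q) th)
  + 2 * lam e1 e2 th * E0 q th * Derive a0 th.

Definition C2 (e1 e2 : pm) (g : germs) (c : param) (q : quotients) (th : R) : R :=
  - E1 q th * L0 q th * N0 e1 e2 g c th
  + Derive (E0 q) th * M0 q th * N0 e1 e2 g c th
  + 2 * E0 q th * (L0 q th * N1 e1 e2 g c th
                   - M0 q th * Derive (N0 e1 e2 g c) th).

Definition C3 (e1 e2 : pm) (g : germs) (c : param) (q : quotients) (th : R) : R :=
  2 * E0 q th * Derive (N0 e1 e2 g c) th - Derive (E0 q) th * N0 e1 e2 g c th.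

Definition simple_zeros (f : R -> R) : Prop :=
  forall th, f th = 0 -> Derive f th <> 0.

(* Tangent vectors of the source are pairs of (theta,z)-components. *)
Record principal := Principal {
  k1 : R -> R -> R;
  k2 : R -> R -> R;
  V1 : R -> R -> R * R;
  V2 : R -> R -> R * R
}.

(* b is an immersion near {z = 0} exactly at these points. *)
Definition regular (e1 e2 : pm) (c : param) (th z : R) : Prop :=
  pU c th z /\ z <> 0 /\ lam e1 e2 th <> 0.

Definition principal_direction (e1 e2 : pm) (g : germs) (c : param)
    (th z k : R) (V : R * R) : Prop :=
  (fL e1 e2 g c th z - k * fE c th z) * fst V
  + (fM e1 e2 g c th z - k * fF c th z) * snd V = 0 /\
  (fM e1 e2 g c th z - k * fF c th z) * fst V
  + (fN e1 e2 g c th z - k * fG c th z) * snd V = 0.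

Definition smooth_field (U : R -> R -> Prop) (V : R -> R -> R * R) : Prop :=
  smooth2 U (fun th z => fst (V th z)) /\ smooth2 U (fun th z => snd (V th z)).

(* Linear independence of the directions makes [k1], [k2] the two principal
   curvatures counted with multiplicity. [k1] is meaningful at regular points
   only. *)
Record is_principal (e1 e2 : pm) (g : germs) (c : param) (k : principal) : Prop := {
  pri_dir : forall th z, regular e1 e2 c th z ->
    principal_direction e1 e2 g c th z (k1 k th z) (V1 k th z) /\
    principal_direction e1 e2 g c th z (k2 k th z) (V2 k th z);
  pri_indep : forall th z, regular e1 e2 c th z ->
    fst (V1 k th z) * snd (V2 k th z) - snd (V1 k th z) * fst (V2 k th z) <> 0;
  pri_unbounded : forall th0 K d, 0 < d -> exists th z,
    regular e1 e2 c th z /\ Rabs (th - th0) < d /\ Rabs z < d /\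
    K < Rabs (k1 k th z);
  pri_bounded : smooth2 (pU c) (k2 k);
  pri_fields : smooth_field (pU c) (V1 k) /\ smooth_field (pU c) (V2 k);
  pri_nonzero : forall th z, pU c th z ->
    V1 k th z <> (0, 0) /\ V2 k th z <> (0, 0)
}.

Definition dir_deriv (V : R -> R -> R * R) (f : R -> R -> R) (th z : R) : R :=
  fst (V th z) * d1 f th z + snd (V th z) * d2 f th z.

(* The line {z = 0} is mapped to the singular point and is left out. The
   cuspidal edges {lambda = 0} are left out for [k1], which is not defined
   there, but not for [k2], which extends across them. *)
Definition ridge1 (e1 e2 : pm) (c : param) (k : principal) (th z : R) : Prop :=
  regular e1 e2 c th z /\ dir_deriv (V1 k) (k1 k) th z = 0.
Definition ridge2 (c : param) (k : principal) (th z : R) : Prop :=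
  pU c th z /\ z <> 0 /\ dir_deriv (V2 k) (k2 k) th z = 0.
Definition subparabolic1 (e1 e2 : pm) (c : param) (k : principal) (th z : R) : Prop :=
  regular e1 e2 c th z /\ dir_deriv (V2 k) (k1 k) th z = 0.
Definition subparabolic2 (c : param) (k : principal) (th z : R) : Prop :=
  pU c th z /\ z <> 0 /\ dir_deriv (V1 k) (k2 k) th z = 0.

(* [H] is the image (without the end point 0) of a continuous arc of the source
   of b_{e1,e2}, for one of the two e2, which starts on {z = 0}, leaves it at
   once, and consists of points of [S e2] otherwise. *)
Definition half_branch (e1 : pm) (g : germs) (c : pm -> param)
    (S : pm -> R -> R -> Prop) (H : vec -> Prop) : Prop :=
  exists (e2 : pm) (th z : R -> R),
    (forall t, continuous th t) /\ (forall t, continuous z t) /\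
    z 0 = 0 /\
    (forall t, 0 < t <= 1 ->
       z t <> 0 /\ S e2 (th t) (z t) /\
       bifurcation_set e1 g (b (c e2) (th t) (z t))) /\
    (forall v, H v <-> exists t, 0 < t <= 1 /\ v = b (c e2) (th t) (z t)).

Definition same_germ_at_0 (H H' : vec -> Prop) : Prop :=
  exists d, 0 < d /\ forall v, vnorm v < d -> (H v <-> H' v).

(* The half-branches starting at the singular point, for both signs e2 together
   and counted as germs of subsets of R^3, are at most [n] in number; so a
   half-branch covered twice (as for [e1 = Neg]) counts once. *)
Definition at_most_curves (n : nat) (e1 : pm) (g : germs) (c : pm -> param)
    (S : pm -> R -> R -> Prop) : Prop :=
  exists l : list (vec -> Prop),
    (length l <= n)%nat /\
    forall H, half_branch e1 g c S H -> exists H', In H' l /\ same_germ_at_0 H H'.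

(* Every (theta,0) with lambda(theta) <> 0 has a neighbourhood free of points of
   [S], and around a zero of lambda only a wedge |lambda(theta)| <= C |z| about
   the cuspidal edge is left out. The wedge is needed: for k1 = h/(z^2 lambda)
   with h <> 0, V2 k1 vanishes on a curve
   theta = theta_0 + (M0/(2 L0))(theta_0) z + O(z^2)
   through each zero (theta_0,0) of lambda, and for P = x, Q = y + x z, R = z,
   e1 = -1, theta_0 = 0 one has M0/L0 = 1. *)
Definition none_near_singular_point (e1 : pm) (S : pm -> R -> R -> Prop) : Prop :=
  forall (e2 : pm) (T : R), exists C d, 0 < C /\ 0 < d /\
    forall th z, Rabs th <= T -> 0 < Rabs z < d ->
      C * Rabs z < Rabs (lam e1 e2 th) -> ~ S e2 th z.

(* Main.v *)
From Stdlib Require Import Arith Reals List Lra Lia Classical ClassicalEpsilon FunctionalExtensionality.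
From Coquelicot Require Import Coquelicot.
Require Import Defs.
Open Scope R_scope.

(** Near a point [(theta, 0)] everything is governed by the conic
    [A^2 - e1 B^2 = eta] traced by [(A, B) = (fA, fB)], the coefficients of the normal
    [A dX + B dY]. As [A' = - e1 B] and [B' = - A], the functions [alpha], [beta], [lam] are
    forms in [A] and [B], the same ones for both signs [e2] ([alpha_form], [beta_form],
    [lam_form]), and the velocity [b_theta] is [rho = z^2 lam a] times the horizontal
    vector orthogonal to the normal ([velocity]). So the coefficients of the two
    fundamental forms are explicit smooth functions times powers of [rho].

    Dividing the equations of the principal directions by [rho] and extending
    them across the singular set by density, one finds the bounded direction
    transverse to the axis [z = 0] ([bounded_axis]), the unbounded direction tangent to
    it ([orthogonal]), and the unbounded curvature equal to [kh / (z^2 lam)] with [kh]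
    smooth and nonzero on the axis ([k1_kh]). The ridge points of either curvature and
    the subparabolic points of the bounded one are thus zeros of smooth functions
    whose values on the axis are nonvanishing multiples of [C1], [C2], [C3]
    ([phi_ridge1_axis], [phi_ridge2_axis], [phi_subpar2_axis]). By Rolle's theorem,
    a simple zero of a coefficient starts at most one curve, and no curve starts
    elsewhere ([isolated_intro]). The derivative of [kh / (z^2 lam)] along the bounded
    direction is dominated by [- 2 kh / (z^3 lam)] outside a wedge [|lam| <= C |z|],
    whence the absence of subparabolic points of the unbounded curvature.

    For the count, the expansions at the axis show that [C1], [C2], [C3] are, up to
    constant factors, forms in [A] and [B] of degrees 5, 9 and 5 ([C1_form], [C2_form],
    [C3_form]). The degrees stay low because [A alpha + B beta] has degree three instead
    of five. A form of degree [n] has at most [n] zeros on the projective line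
    ([form_root_classes]). Parameters with proportional [(A, B)] give the same curves:
    for [e1 = Neg] this is the double cover together with the coincidence of the two
    parametrizations, for [e1 = Pos] such parameters are equal ([fAB_same_class]). That
    the same points are ridge or subparabolic for both follows from local uniqueness
    of the implicit solution and of the bounded principal curvature
    ([comparable_regular]). Each zero contributes the two sides [z > 0] and [z < 0], so
    there are at most 10, 18 and 10 half-branches ([count_germs]). *)

(** * Smooth functions on open subsets of the plane *)

Definition open2 (U : R -> R -> Prop) : Prop := forall s t, U s t -> locally_2d U s t.

(** Like [Ck2], but with continuity required at every order, so that a function
    of class n+1 is at once of class n; the product rule needs this in its induction. *)
Fixpoint reg (n : nat) (U : R -> R -> Prop) (f : R -> R -> R) : Prop :=
  match n with
  | O => forall s t, U s t -> continuity_2d_pt f s t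
  | S m =>
      (forall s t, U s t -> continuity_2d_pt f s t /\
         ex_derive (fun s' => f s' t) s /\ ex_derive (fun t' => f s t') t) /\
      reg m U (d1 f) /\ reg m U (d2 f)
  end.

Lemma reg_cont n U f : reg n U f -> forall s t, U s t -> continuity_2d_pt f s t.
Proof.
  destruct n; simpl; intros H s t Hst; [now apply H | now apply H].
Qed.

Lemma reg_S n U f : reg (S n) U f -> reg n U f.
Proof.
  revert f; induction n as [|n IH]; intros f H.
  - exact (reg_cont _ _ _ H).
  - destruct H as [H [H1 H2]]; split; [exact H|split; now apply IH].
Qed.

Lemma smooth2_reg U f : smooth2 U f <-> forall n, reg n U f.
Proof.
  split.
  - intros H n.
    enough (E : forall f, smooth2 U f -> reg n U f) by now apply E.
    clear f H; induction n as [|n IH]; intros f H.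
    + exact (H O).
    + split; [|split].
      * intros s t Hst; split; [exact (H O s t Hst)|exact (proj1 (H 1%nat) s t Hst)].
      * apply IH; intros m; exact (proj1 (proj2 (H (S m)))).
      * apply IH; intros m; exact (proj2 (proj2 (H (S m)))).
  - intros H n.
    enough (E : forall f, (forall n, reg n U f) -> Ck2 n U f) by now apply E.
    clear f H; induction n as [|n IH]; intros f H.
    + exact (H O).
    + split; [|split].
      * intros s t Hst; exact (proj2 (proj1 (H 1%nat) s t Hst)).
      * apply IH; intros m; exact (proj1 (proj2 (H (S m)))).
      * apply IH; intros m; exact (proj2 (proj2 (H (S m)))).
Qed.

Lemma smooth2_cont U f s t : smooth2 U f -> U s t -> continuity_2d_pt f s t.
Proof. intros H; exact (H O s t). Qed.

Lemma smooth2_is_d1 U f s t : smooth2 U f -> U s t ->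
  is_derive (fun s' => f s' t) s (d1 f s t).
Proof. intros H Hst; apply Derive_correct; exact (proj1 (proj1 (H 1%nat) s t Hst)). Qed.

Lemma smooth2_is_d2 U f s t : smooth2 U f -> U s t ->
  is_derive (fun t' => f s t') t (d2 f s t).
Proof. intros H Hst; apply Derive_correct; exact (proj2 (proj1 (H 1%nat) s t Hst)). Qed.

Lemma smooth2_d1 U f : smooth2 U f -> smooth2 U (d1 f).
Proof. intros H n; exact (proj1 (proj2 (H (S n)))). Qed.

Lemma smooth2_d2 U f : smooth2 U f -> smooth2 U (d2 f).
Proof. intros H n; exact (proj2 (proj2 (H (S n)))). Qed.

Lemma reg_restrict n (U V : R -> R -> Prop) f :
  (forall s t, V s t -> U s t) -> reg n U f -> reg n V f.
Proof.
  intros HV; revert f; induction n as [|n IH]; intros f H.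
  - intros s t Hst; apply H; auto.
  - destruct H as [H [H1 H2]]; split; [|split]; auto.
Qed.

Lemma smooth2_restrict (U V : R -> R -> Prop) f :
  (forall s t, V s t -> U s t) -> smooth2 U f -> smooth2 V f.
Proof.
  rewrite 2!smooth2_reg; intros HV H n; exact (reg_restrict n U V f HV (H n)).
Qed.

Lemma d1_ext_loc f g s t : locally_2d (fun s t => f s t = g s t) s t -> d1 f s t = d1 g s t.
Proof.
  intros H; apply Derive_ext_loc.
  exact (locally_2d_1d_const_y (fun s t => f s t = g s t) s t H).
Qed.

Lemma d2_ext_loc f g s t : locally_2d (fun s t => f s t = g s t) s t -> d2 f s t = d2 g s t.
Proof.
  intros H; apply Derive_ext_loc.
  exact (locally_2d_1d_const_x (fun s t => f s t = g s t) s t H).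
Qed.

Lemma locally_2d_mono (P Q : R -> R -> Prop) s t :
  (forall u v, P u v -> Q u v) -> locally_2d P s t -> locally_2d Q s t.
Proof. intros H [d Hd]; exists d; auto. Qed.

Lemma reg_ext n U f g : open2 U -> (forall s t, U s t -> f s t = g s t) ->
  reg n U f -> reg n U g.
Proof.
  intros HU; revert f g; induction n as [|n IH]; intros f g E H.
  - intros s t Hst; apply continuity_2d_pt_ext_loc with (2 := H s t Hst).
    apply locally_2d_mono with U; auto.
  - assert (L : forall s t, U s t -> locally_2d (fun s t => f s t = g s t) s t).
    { intros s t Hst; apply locally_2d_mono with U; auto. }
    destruct H as [H [H1 H2]]; split; [|split].
    + intros s t Hst; destruct (H s t Hst) as [Hc [Hd1 Hd2]]; split; [|split].
      * exact (continuity_2d_pt_ext_loc _ _ _ _ (L s t Hst) Hc).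
      * apply ex_derive_ext_loc with (2 := Hd1).
        exact (locally_2d_1d_const_y (fun s t => f s t = g s t) s t (L s t Hst)).
      * apply ex_derive_ext_loc with (2 := Hd2).
        exact (locally_2d_1d_const_x (fun s t => f s t = g s t) s t (L s t Hst)).
    + apply IH with (2 := H1); intros s t Hst; now apply d1_ext_loc, L.
    + apply IH with (2 := H2); intros s t Hst; now apply d2_ext_loc, L.
Qed.

Lemma smooth2_ext U f g : open2 U -> (forall s t, U s t -> f s t = g s t) ->
  smooth2 U f -> smooth2 U g.
Proof.
  rewrite 2!smooth2_reg; intros HU E H n; exact (reg_ext n U f g HU E (H n)).
Qed.

Lemma reg_const n U k : reg n U (fun _ _ => k).
Proof.
  revert k; induction n as [|n IH]; intros k.
  - intros s t _; apply continuity_2d_pt_const.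
  - split; [|split].
    + intros s t _; split; [apply continuity_2d_pt_const|split; apply ex_derive_const].
    + assert (E : d1 (fun _ _ => k) = (fun _ _ => 0)).
      { unfold d1; apply functional_extensionality; intros s.
        apply functional_extensionality; intros t; apply Derive_const. }
      rewrite E; apply IH.
    + assert (E : d2 (fun _ _ => k) = (fun _ _ => 0)).
      { unfold d2; apply functional_extensionality; intros s.
        apply functional_extensionality; intros t; apply Derive_const. }
      rewrite E; apply IH.
Qed.

Lemma smooth2_const U k : smooth2 U (fun _ _ => k).
Proof. apply smooth2_reg; intros n; apply reg_const. Qed.

Section Closure.
Variables (U : R -> R -> Prop) (HU : open2 U).

Lemma reg_plus n f g : reg n U f -> reg n U g -> reg n U (fun s t => f s t + g s t).
Proof.
  revert f g; induction n as [|n IH]; intros f g Hf Hg.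
  - intros s t Hst; apply continuity_2d_pt_plus; auto.
  - destruct Hf as [Hf [Hf1 Hf2]], Hg as [Hg [Hg1 Hg2]]; split; [|split].
    + intros s t Hst; destruct (Hf s t Hst) as [? [? ?]], (Hg s t Hst) as [? [? ?]].
      split; [now apply continuity_2d_pt_plus|].
      split; apply (ex_derive_plus (V := R_NormedModule)); auto.
    + apply reg_ext with (3 := IH _ _ Hf1 Hg1); [exact HU|].
      intros s t Hst; symmetry; unfold d1.
      apply (Derive_plus (fun u => f u t) (fun u => g u t)); [exact (proj1 (proj2 (Hf s t Hst)))|exact (proj1 (proj2 (Hg s t Hst)))].
    + apply reg_ext with (3 := IH _ _ Hf2 Hg2); [exact HU|].
      intros s t Hst; symmetry; unfold d2.
      apply (Derive_plus (fun u => f s u) (fun u => g s u)); [exact (proj2 (proj2 (Hf s t Hst)))|exact (proj2 (proj2 (Hg s t Hst)))].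
Qed.

Lemma reg_mult n f g : reg n U f -> reg n U g -> reg n U (fun s t => f s t * g s t).
Proof.
  revert f g; induction n as [|n IH]; intros f g Hf Hg.
  - intros s t Hst; apply continuity_2d_pt_mult; auto.
  - pose proof (reg_S _ _ _ Hf) as Sf; pose proof (reg_S _ _ _ Hg) as Sg.
    destruct Hf as [Hf [Hf1 Hf2]], Hg as [Hg [Hg1 Hg2]]; split; [|split].
    + intros s t Hst; destruct (Hf s t Hst) as [? [? ?]], (Hg s t Hst) as [? [? ?]].
      split; [now apply continuity_2d_pt_mult|].
      split; apply ex_derive_mult; auto.
    + apply reg_ext with (3 := reg_plus n _ _ (IH _ _ Hf1 Sg) (IH _ _ Sf Hg1)); [exact HU|].
      intros s t Hst; symmetry; unfold d1.
      apply (Derive_mult (fun u => f u t) (fun u => g u t)); [exact (proj1 (proj2 (Hf s t Hst)))|exact (proj1 (proj2 (Hg s t Hst)))].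
    + apply reg_ext with (3 := reg_plus n _ _ (IH _ _ Hf2 Sg) (IH _ _ Sf Hg2)); [exact HU|].
      intros s t Hst; symmetry; unfold d2.
      apply (Derive_mult (fun u => f s u) (fun u => g s u)); [exact (proj2 (proj2 (Hf s t Hst)))|exact (proj2 (proj2 (Hg s t Hst)))].
Qed.

(** Composition with a function of one variable whose derivative can be written
    in terms of the function and its argument. *)
Lemma reg_comp (phi dphi : R -> R) n f :
  (forall s t, U s t -> is_derive phi (f s t) (dphi (f s t))) ->
  (forall n, reg n U f -> reg n U (fun s t => phi (f s t)) -> reg n U (fun s t => dphi (f s t))) ->
  reg n U f -> reg n U (fun s t => phi (f s t)).
Proof.
  intros Hphi Hd.
  assert (Hc : forall s t, U s t -> continuity_2d_pt f s t ->
            continuity_2d_pt (fun s t => phi (f s t)) s t).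
  { intros s t Hst; apply continuity_1d_2d_pt_comp, continuity_pt_filterlim.
    apply (@ex_derive_continuous R_AbsRing R_NormedModule); eexists; now apply Hphi. }
  induction n as [|n IH]; intros Hf.
  - intros s t Hst; apply Hc; auto.
  - pose proof (reg_S _ _ _ Hf) as Hfn; pose proof (Hd n Hfn (IH Hfn)) as Si.
    destruct Hf as [Hf [Hf1 Hf2]].
    assert (D1 : forall s t, U s t -> is_derive (fun s' => phi (f s' t)) s (d1 f s t * dphi (f s t))).
    { intros s t Hst; apply (is_derive_comp phi (fun s' => f s' t)); [now apply Hphi|].
      exact (Derive_correct _ _ (proj1 (proj2 (Hf s t Hst)))). }
    assert (D2 : forall s t, U s t -> is_derive (fun t' => phi (f s t')) t (d2 f s t * dphi (f s t))).
    { intros s t Hst; apply (is_derive_comp phi (fun t' => f s t')); [now apply Hphi|].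
      exact (Derive_correct _ _ (proj2 (proj2 (Hf s t Hst)))). }
    split; [|split].
    + intros s t Hst; split; [apply Hc; [auto|exact (proj1 (Hf s t Hst))]|].
      split; [eexists; apply D1|eexists; apply D2]; auto.
    + apply reg_ext with (fun s t => d1 f s t * dphi (f s t)); [exact HU| |now apply reg_mult].
      intros s t Hst; symmetry; apply is_derive_unique, D1; auto.
    + apply reg_ext with (fun s t => d2 f s t * dphi (f s t)); [exact HU| |now apply reg_mult].
      intros s t Hst; symmetry; apply is_derive_unique, D2; auto.
Qed.

Lemma reg_inv n f : (forall s t, U s t -> f s t <> 0) -> reg n U f ->
  reg n U (fun s t => / f s t).
Proof.
  intros Hnz; apply (reg_comp Rinv (fun x => -1 * (/ x * / x))).
  - intros s t Hst; replace (_ * _) with (- (1) / f s t ^ 2) by (field; auto).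
    apply (is_derive_inv (fun x => x)); [apply (is_derive_id (f s t))|auto].
  - intros m _ H; apply reg_mult; [apply reg_const|now apply reg_mult].
Qed.

Lemma reg_sqrt n f : (forall s t, U s t -> 0 < f s t) -> reg n U f ->
  reg n U (fun s t => sqrt (f s t)).
Proof.
  intros Hp; assert (Hs : forall s t, U s t -> sqrt (f s t) <> 0).
  { intros s t Hst; apply Rgt_not_eq, sqrt_lt_R0; auto. }
  apply (reg_comp sqrt (fun x => / 2 * / sqrt x)).
  - intros s t Hst; replace (_ * _) with (1 / (2 * sqrt (f s t))) by (field; auto).
    apply (is_derive_sqrt (fun x => x)); [apply (is_derive_id (f s t))|auto].
  - intros m _ H; apply reg_mult; [apply reg_const|now apply reg_inv].
Qed.

Lemma smooth2_plus f g : smooth2 U f -> smooth2 U g -> smooth2 U (fun s t => f s t + g s t).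
Proof. rewrite 3!smooth2_reg; intros Hf Hg n; now apply reg_plus. Qed.

Lemma smooth2_mult f g : smooth2 U f -> smooth2 U g -> smooth2 U (fun s t => f s t * g s t).
Proof. rewrite 3!smooth2_reg; intros Hf Hg n; now apply reg_mult. Qed.

Lemma smooth2_opp f : smooth2 U f -> smooth2 U (fun s t => - f s t).
Proof.
  intros Hf; apply smooth2_ext with (fun s t => (-1) * f s t); [exact HU|intros; ring|].
  apply smooth2_mult; [apply smooth2_const|exact Hf].
Qed.

Lemma smooth2_minus f g : smooth2 U f -> smooth2 U g -> smooth2 U (fun s t => f s t - g s t).
Proof. intros Hf Hg; apply smooth2_plus; [exact Hf|now apply smooth2_opp]. Qed.

Lemma smooth2_pow f n : smooth2 U f -> smooth2 U (fun s t => f s t ^ n).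
Proof.
  intros Hf; induction n as [|n IH]; simpl; [apply smooth2_const|now apply smooth2_mult].
Qed.

Lemma smooth2_inv f : (forall s t, U s t -> f s t <> 0) -> smooth2 U f ->
  smooth2 U (fun s t => / f s t).
Proof. rewrite 2!smooth2_reg; intros H Hf n; now apply reg_inv. Qed.

Lemma smooth2_div f g : (forall s t, U s t -> g s t <> 0) -> smooth2 U f -> smooth2 U g ->
  smooth2 U (fun s t => f s t / g s t).
Proof. intros H Hf Hg; apply smooth2_mult; [exact Hf|now apply smooth2_inv]. Qed.

Lemma smooth2_sqrt f : (forall s t, U s t -> 0 < f s t) -> smooth2 U f ->
  smooth2 U (fun s t => sqrt (f s t)).
Proof. rewrite 2!smooth2_reg; intros H Hf n; now apply reg_sqrt. Qed.

Lemma smooth2_snd : smooth2 U (fun _ t => t).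
Proof.
  apply smooth2_reg; intros [|n].
  - intros s t _; apply continuity_2d_pt_id2.
  - split; [|split].
    + intros s t _; split; [apply continuity_2d_pt_id2|].
      split; [apply ex_derive_const|apply ex_derive_id].
    + apply reg_ext with (fun _ _ => 0); [exact HU| |apply reg_const].
      intros s t _; symmetry; unfold d1; apply Derive_const.
    + apply reg_ext with (fun _ _ => 1); [exact HU| |apply reg_const].
      intros s t _; symmetry; unfold d2; apply Derive_id.
Qed.

End Closure.

Lemma open2_neq0 U f : open2 U -> (forall s t, U s t -> continuity_2d_pt f s t) ->
  open2 (fun s t => U s t /\ f s t <> 0).
Proof.
  intros HU Hf s t [H1 H2]; apply locally_2d_and; [now apply HU|].
  apply continuity_2d_pt_neq_0; auto.
Qed.

(** * Functions of three variables along a surface *)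

Definition open3 (W : R -> R -> R -> Prop) : Prop :=
  open (fun v : vec => W (vx v) (vy v) (vz v)).

Lemma open3_box W x y z : open3 W -> W x y z -> exists d, 0 < d /\
  forall x' y' z', Rabs (x' - x) < d -> Rabs (y' - y) < d -> Rabs (z' - z) < d -> W x' y' z'.
Proof.
  intros HW H; destruct (HW (x, y, z) H) as [d Hd].
  exists d; split; [apply cond_pos|]; intros x' y' z' Hx Hy Hz.
  apply (Hd (x', y', z')); repeat split; assumption.
Qed.

Lemma cont3_box (f : R -> R -> R -> R) x y z :
  continuous (fun v : R * R * R => f (fst (fst v)) (snd (fst v)) (snd v)) (x, y, z) ->
  forall eps, 0 < eps -> exists d, 0 < d /\
  forall x' y' z', Rabs (x' - x) < d -> Rabs (y' - y) < d -> Rabs (z' - z) < d ->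
    Rabs (f x' y' z' - f x y z) < eps.
Proof.
  intros H eps Heps.
  destruct (proj1 (filterlim_locally _ _) H (mkposreal eps Heps)) as [d Hd].
  exists d; split; [apply cond_pos|]; intros x' y' z' Hx Hy Hz.
  apply (Hd (x', y', z')); repeat split; assumption.
Qed.

Lemma smooth3_D1 W f : smooth3 W f -> smooth3 W (D1 f).
Proof. intros H n; exact (proj1 (proj2 (H (S n)))). Qed.
Lemma smooth3_D2 W f : smooth3 W f -> smooth3 W (D2 f).
Proof. intros H n; exact (proj1 (proj2 (proj2 (H (S n))))). Qed.
Lemma smooth3_D3 W f : smooth3 W f -> smooth3 W (D3 f).
Proof. intros H n; exact (proj2 (proj2 (proj2 (H (S n))))). Qed.

Ltac below_min := eauto 6 using Rle_trans, Rmin_l, Rmin_r.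

Lemma mvt_seg (f df : R -> R) a b :
  (forall x, Rmin a b <= x <= Rmax a b -> is_derive f x (df x)) ->
  exists c, Rmin a b <= c <= Rmax a b /\ f b - f a = df c * (b - a).
Proof.
  intros H; apply (MVT_gen f a b df).
  - intros x Hx; apply H; lra.
  - intros x Hx; apply continuity_pt_filterlim, (@ex_derive_continuous R_AbsRing R_NormedModule).
    exists (df x); apply H, Hx.
Qed.

(** The increment is split into three increments along coordinate axes and the
    mean value theorem is applied to each of them. *)
Lemma increment3 W f x y z : open3 W -> smooth3 W f -> W x y z ->
  forall eps, 0 < eps -> exists d, 0 < d /\
  forall x' y' z' x'' y'' z'',
    Rabs (x' - x) < d -> Rabs (y' - y) < d -> Rabs (z' - z) < d ->
    Rabs (x'' - x) < d -> Rabs (y'' - y) < d -> Rabs (z'' - z) < d ->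
    exists p1 p2 p3, f x'' y'' z'' - f x' y' z'
                     = p1 * (x'' - x') + p2 * (y'' - y') + p3 * (z'' - z') /\
      Rabs (p1 - D1 f x y z) < eps /\ Rabs (p2 - D2 f x y z) < eps /\
      Rabs (p3 - D3 f x y z) < eps.
Proof.
  intros HW Hf H eps Heps.
  destruct (open3_box W x y z HW H) as [d0 [Hd0 B0]].
  destruct (cont3_box (D1 f) x y z (smooth3_D1 _ _ Hf O x y z H) eps Heps) as [da [Hda B1]].
  destruct (cont3_box (D2 f) x y z (smooth3_D2 _ _ Hf O x y z H) eps Heps) as [db [Hdb B2]].
  destruct (cont3_box (D3 f) x y z (smooth3_D3 _ _ Hf O x y z H) eps Heps) as [dc [Hdc B3]].
  set (d := Rmin (Rmin d0 da) (Rmin db dc)).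
  assert (Hd : 0 < d) by (unfold d; repeat apply Rmin_pos; assumption).
  assert (M : d <= d0 /\ d <= da /\ d <= db /\ d <= dc).
  { unfold d; repeat split; below_min. }
  assert (In : forall a u v w, Rabs (u - a) < d -> Rabs (v - a) < d ->
            Rmin u v <= w <= Rmax u v -> Rabs (w - a) < d).
  { intros a u v w Hu Hv Hw; apply Rabs_def2 in Hu; apply Rabs_def2 in Hv.
    unfold Rmin, Rmax in Hw; destruct (Rle_dec u v); apply Rabs_def1; lra. }
  exists d; split; [exact Hd|]; intros x' y' z' x'' y'' z'' Hx' Hy' Hz' Hx Hy Hz.
  assert (F : forall u v w, W u v w -> is_derive (fun u' => f u' v w) u (D1 f u v w) /\
            is_derive (fun v' => f u v' w) v (D2 f u v w) /\
            is_derive (fun w' => f u v w') w (D3 f u v w)).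
  { intros u v w Hu; destruct (proj1 (Hf 1%nat) u v w Hu) as [X1 [X2 X3]].
    split; [exact (Derive_correct _ _ X1)|split; [exact (Derive_correct _ _ X2)|exact (Derive_correct _ _ X3)]]. }
  destruct (mvt_seg (fun u => f u y'' z'') (fun u => D1 f u y'' z'') x' x'') as [c1 [C1 E1]].
  { intros u Hu; pose proof (In x x' x'' u Hx' Hx Hu); refine (proj1 (F _ _ _ (B0 _ _ _ _ _ _))); lra. }
  destruct (mvt_seg (fun u => f x' u z'') (fun u => D2 f x' u z'') y' y'') as [c2 [C2 E2]].
  { intros u Hu; pose proof (In y y' y'' u Hy' Hy Hu); refine (proj1 (proj2 (F _ _ _ (B0 _ _ _ _ _ _)))); lra. }
  destruct (mvt_seg (fun u => f x' y' u) (fun u => D3 f x' y' u) z' z'') as [c3 [C3 E3]].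
  { intros u Hu; pose proof (In z z' z'' u Hz' Hz Hu); refine (proj2 (proj2 (F _ _ _ (B0 _ _ _ _ _ _)))); lra. }
  exists (D1 f c1 y'' z''), (D2 f x' c2 z''), (D3 f x' y' c3).
  pose proof (In x x' x'' c1 Hx' Hx C1); pose proof (In y y' y'' c2 Hy' Hy C2).
  pose proof (In z z' z'' c3 Hz' Hz C3).
  split; [lra|split; [apply B1; lra|split; [apply B2; lra|apply B3; lra]]].
Qed.

Lemma mult_close l d eps : 0 < eps -> exists r, 0 < r /\
  forall a b, Rabs (a - l) < r -> Rabs (b - d) < r -> Rabs (a * b - l * d) < eps.
Proof.
  intros He.
  destruct (continuity_2d_pt_mult (fun u _ => u) (fun _ v => v) l d
    (continuity_2d_pt_id1 l d) (continuity_2d_pt_id2 l d) (mkposreal eps He)) as [r Hr].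
  exists r; split; [apply cond_pos|exact Hr].
Qed.

(** Chain rule for functions with continuous partial derivatives; the increment
    lemma plays the part of total differentiability. *)
Lemma chain3 W f (x y z : R -> R) t dx dy dz : open3 W -> smooth3 W f ->
  W (x t) (y t) (z t) -> is_derive x t dx -> is_derive y t dy -> is_derive z t dz ->
  is_derive (fun s => f (x s) (y s) (z s)) t
    (D1 f (x t) (y t) (z t) * dx + D2 f (x t) (y t) (z t) * dy + D3 f (x t) (y t) (z t) * dz).
Proof.
  intros HW Hf H Hx Hy Hz.
  set (l1 := D1 f (x t) (y t) (z t)); set (l2 := D2 f (x t) (y t) (z t));
  set (l3 := D3 f (x t) (y t) (z t)).
  assert (Cx := proj1 (continuity_pt_locally _ _)
    (derivable_continuous_pt _ _ (ex_derive_Reals_0 x t (ex_intro _ dx Hx)))).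
  assert (Cy := proj1 (continuity_pt_locally _ _)
    (derivable_continuous_pt _ _ (ex_derive_Reals_0 y t (ex_intro _ dy Hy)))).
  assert (Cz := proj1 (continuity_pt_locally _ _)
    (derivable_continuous_pt _ _ (ex_derive_Reals_0 z t (ex_intro _ dz Hz)))).
  apply is_derive_Reals in Hx; apply is_derive_Reals in Hy; apply is_derive_Reals in Hz.
  apply is_derive_Reals; intros eps Heps.
  assert (He3 : 0 < eps / 3) by lra.
  destruct (mult_close l1 dx _ He3) as [r1 [R1 M1]].
  destruct (mult_close l2 dy _ He3) as [r2 [R2 M2]].
  destruct (mult_close l3 dz _ He3) as [r3 [R3 M3]].
  set (r := Rmin r1 (Rmin r2 r3)).
  assert (Hr : 0 < r) by (unfold r; repeat apply Rmin_pos; assumption).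
  assert (Mr : r <= r1 /\ r <= r2 /\ r <= r3).
  { unfold r; repeat split; below_min. }
  destruct (increment3 W f _ _ _ HW Hf H r Hr) as [d [Hd I]].
  destruct (Cx (mkposreal d Hd)) as [ex Ex]; destruct (Cy (mkposreal d Hd)) as [ey Ey];
  destruct (Cz (mkposreal d Hd)) as [ez Ez]; simpl in Ex, Ey, Ez.
  destruct (Hx r1 R1) as [gx Gx]; destruct (Hy r2 R2) as [gy Gy]; destruct (Hz r3 R3) as [gz Gz].
  assert (Hp : 0 < Rmin (Rmin ex (Rmin ey ez)) (Rmin gx (Rmin gy gz)))
    by (repeat apply Rmin_pos; apply cond_pos).
  exists (mkposreal _ Hp); intros h Hh0 Hh; simpl in Hh.
  apply Rmin_Rgt in Hh; destruct Hh as [Ha Hb].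
  apply Rmin_Rgt in Ha; destruct Ha as [Ha1 Ha2]; apply Rmin_Rgt in Ha2; destruct Ha2 as [Ha2 Ha3].
  apply Rmin_Rgt in Hb; destruct Hb as [Hb1 Hb2]; apply Rmin_Rgt in Hb2; destruct Hb2 as [Hb2 Hb3].
  assert (Eh : (t + h) - t = h) by ring.
  assert (Z : forall u, Rabs (u - u) < d) by (intros u; replace (u - u) with 0 by ring; rewrite Rabs_R0; exact Hd).
  destruct (I (x t) (y t) (z t) (x (t + h)) (y (t + h)) (z (t + h))) as [p1 [p2 [p3 [E [P1 [P2 P3]]]]]];
    try apply Z.
  - apply Ex; unfold ball; simpl; unfold AbsRing_ball, abs, minus, plus, opp; simpl.
    replace (t + h + - t) with h by ring; lra.
  - apply Ey; unfold ball; simpl; unfold AbsRing_ball, abs, minus, plus, opp; simpl.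
    replace (t + h + - t) with h by ring; lra.
  - apply Ez; unfold ball; simpl; unfold AbsRing_ball, abs, minus, plus, opp; simpl.
    replace (t + h + - t) with h by ring; lra.
  - specialize (Gx h Hh0 ltac:(lra)); specialize (Gy h Hh0 ltac:(lra)); specialize (Gz h Hh0 ltac:(lra)).
    rewrite E.
    set (ax := (x (t + h) - x t) / h) in *; set (ay := (y (t + h) - y t) / h) in *;
    set (az := (z (t + h) - z t) / h) in *.
    replace ((p1 * (x (t + h) - x t) + p2 * (y (t + h) - y t) + p3 * (z (t + h) - z t)) / h
             - (l1 * dx + l2 * dy + l3 * dz))
      with ((p1 * ax - l1 * dx) + (p2 * ay - l2 * dy) + (p3 * az - l3 * dz))
      by (unfold ax, ay, az; field; exact Hh0).
    assert (Q1 := M1 p1 ax ltac:(fold l1 in P1; lra) Gx).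
    assert (Q2 := M2 p2 ay ltac:(fold l2 in P2; lra) Gy).
    assert (Q3 := M3 p3 az ltac:(fold l3 in P3; lra) Gz).
    apply Rabs_def2 in Q1; apply Rabs_def2 in Q2; apply Rabs_def2 in Q3; apply Rabs_def1; lra.
Qed.

Section Along.
Variables (U : R -> R -> Prop) (W : R -> R -> R -> Prop) (px py : R -> R -> R).
Hypotheses (HU : open2 U) (HW : open3 W) (Hpx : smooth2 U px) (Hpy : smooth2 U py)
  (Hdom : forall s t, U s t -> W (px s t) (py s t) t).

Lemma is_d1_along f s t : smooth3 W f -> U s t ->
  is_derive (fun s' => f (px s' t) (py s' t) t) s
    (D1 f (px s t) (py s t) t * d1 px s t + D2 f (px s t) (py s t) t * d1 py s t).
Proof.
  intros Hf Hst.
  pose proof (chain3 W f (fun s' => px s' t) (fun s' => py s' t) (fun _ => t) s _ _ _ HW Hf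
    (Hdom s t Hst) (smooth2_is_d1 U px s t Hpx Hst) (smooth2_is_d1 U py s t Hpy Hst)
    (is_derive_const t s)) as H.
  replace (_ + _) with (D1 f (px s t) (py s t) t * d1 px s t
    + D2 f (px s t) (py s t) t * d1 py s t + D3 f (px s t) (py s t) t * 0) by ring.
  exact H.
Qed.

Lemma is_d2_along f s t : smooth3 W f -> U s t ->
  is_derive (fun t' => f (px s t') (py s t') t') t
    (D1 f (px s t) (py s t) t * d2 px s t + D2 f (px s t) (py s t) t * d2 py s t
     + D3 f (px s t) (py s t) t).
Proof.
  intros Hf Hst.
  pose proof (chain3 W f (fun t' => px s t') (fun t' => py s t') (fun t' => t') t _ _ _ HW Hf
    (Hdom s t Hst) (smooth2_is_d2 U px s t Hpx Hst) (smooth2_is_d2 U py s t Hpy Hst)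
    (is_derive_id t)) as H.
  replace (D3 f (px s t) (py s t) t) with (D3 f (px s t) (py s t) t * 1) by ring.
  exact H.
Qed.

Lemma cont_along f s t : smooth3 W f -> U s t ->
  continuity_2d_pt (fun s t => f (px s t) (py s t) t) s t.
Proof.
  intros Hf Hst eps.
  destruct (cont3_box f _ _ _ (Hf O _ _ _ (Hdom s t Hst)) eps (cond_pos eps)) as [d [Hd B]].
  apply locally_2d_mono with (2 := locally_2d_and _ _ _ _
    (smooth2_cont U px s t Hpx Hst (mkposreal d Hd))
    (locally_2d_and _ _ _ _ (smooth2_cont U py s t Hpy Hst (mkposreal d Hd))
      (continuity_2d_pt_id2 s t (mkposreal d Hd)))).
  intros u v [H1 [H2 H3]]; now apply B.
Qed.

Lemma smooth2_along f : smooth3 W f -> smooth2 U (fun s t => f (px s t) (py s t) t).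
Proof.
  intros Hf; apply smooth2_reg; intros n; revert f Hf; induction n as [|n IH]; intros f Hf.
  - intros s t Hst; now apply cont_along.
  - assert (Rx := proj1 (smooth2_reg _ _) (smooth2_d1 _ _ Hpx) n).
    assert (Ry := proj1 (smooth2_reg _ _) (smooth2_d1 _ _ Hpy) n).
    assert (Sx := proj1 (smooth2_reg _ _) (smooth2_d2 _ _ Hpx) n).
    assert (Sy := proj1 (smooth2_reg _ _) (smooth2_d2 _ _ Hpy) n).
    pose proof (IH _ (smooth3_D1 _ _ Hf)); pose proof (IH _ (smooth3_D2 _ _ Hf));
    pose proof (IH _ (smooth3_D3 _ _ Hf)).
    split; [|split].
    + intros s t Hst; split; [now apply cont_along|].
      split; eexists; [now apply is_d1_along|now apply is_d2_along].
    + apply reg_ext with (fun s t => D1 f (px s t) (py s t) t * d1 px s t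
                                   + D2 f (px s t) (py s t) t * d1 py s t); [exact HU| |].
      * intros s t Hst; symmetry; apply is_derive_unique; now apply is_d1_along.
      * apply reg_plus; [exact HU| |]; apply reg_mult; assumption.
    + apply reg_ext with (fun s t => D1 f (px s t) (py s t) t * d2 px s t
           + D2 f (px s t) (py s t) t * d2 py s t + D3 f (px s t) (py s t) t); [exact HU| |].
      * intros s t Hst; symmetry; apply is_derive_unique; now apply is_d2_along.
      * apply reg_plus; [exact HU| |assumption].
        apply reg_plus; [exact HU| |]; apply reg_mult; assumption.
Qed.
End Along.

(** * Binary forms *)

(** Homogeneous polynomials of degree [n] in two variables, generated so that
    closure under products is an induction; [form_split] reads off the coefficient of
    the pure power of the second variable. *)
Inductive form : nat -> (R -> R -> R) -> Prop :=
| form_const k : form 0 (fun _ _ => k)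
| form_fst n f : form n f -> form (S n) (fun a b => a * f a b)
| form_snd n f : form n f -> form (S n) (fun a b => b * f a b)
| form_plus n f g : form n f -> form n g -> form n (fun a b => f a b + g a b)
| form_ext n f g : (forall a b, f a b = g a b) -> form n f -> form n g.

Lemma form_scal n f k : form n f -> form n (fun a b => k * f a b).
Proof.
  induction 1 as [k'|n f H IH|n f H IH|n f g H IH H' IH'|n f g E H IH].
  - apply (form_const (k * k')).
  - apply form_ext with (2 := form_fst _ _ IH); intros; ring.
  - apply form_ext with (2 := form_snd _ _ IH); intros; ring.
  - apply form_ext with (2 := form_plus _ _ _ IH IH'); intros; ring.
  - apply form_ext with (2 := IH); intros; now rewrite E.
Qed.

Lemma form_mult n m f g : form n f -> form m g -> form (n + m) (fun a b => f a b * g a b).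
Proof.
  intros Hf Hg; induction Hf as [k|n f H IH|n f H IH|n f f' H IH H' IH'|n f f' E H IH]; simpl.
  - now apply form_scal.
  - apply form_ext with (2 := form_fst _ _ IH); intros; ring.
  - apply form_ext with (2 := form_snd _ _ IH); intros; ring.
  - apply form_ext with (2 := form_plus _ _ _ IH IH'); intros; ring.
  - apply form_ext with (2 := IH); intros; now rewrite E.
Qed.

Lemma form_opp n f : form n f -> form n (fun a b => - f a b).
Proof. intros H; apply form_ext with (2 := form_scal _ _ (-1) H); intros; ring. Qed.

Lemma form_minus n f g : form n f -> form n g -> form n (fun a b => f a b - g a b).
Proof. intros Hf Hg; exact (form_plus _ _ _ Hf (form_opp _ _ Hg)). Qed.

Lemma form_a : form 1 (fun a _ => a).
Proof. apply form_ext with (2 := form_fst _ _ (form_const 1)); intros; ring. Qed.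

Lemma form_b : form 1 (fun _ b => b).
Proof. apply form_ext with (2 := form_snd _ _ (form_const 1)); intros; ring. Qed.

Lemma form_pow n f k : form n f -> form (k * n) (fun a b => f a b ^ k).
Proof.
  intros H; induction k as [|k IH]; simpl; [apply form_const|now apply form_mult].
Qed.

Lemma form_split n f : form n f ->
  exists k g, (forall a b, f a b = a * g a b + k * b ^ n) /\
    match n with O => forall a b, g a b = 0 | S m => form m g end.
Proof.
  induction 1 as [k|n f H IH|n f H IH|n f f' H IH H' IH'|n f f' E H IH].
  - exists k, (fun _ _ => 0); split; [intros; simpl; ring|auto].
  - exists 0, f; split; [intros; ring|exact H].
  - destruct IH as [k [g [E G]]]; exists k, (fun a b => b * g a b); split.
    + intros a b; rewrite E; simpl; ring.
    + destruct n as [|n].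
      * apply form_ext with (2 := form_const 0); intros; rewrite G; ring.
      * now apply form_snd.
  - destruct IH as [k [g [E G]]], IH' as [k' [g' [E' G']]].
    exists (k + k'), (fun a b => g a b + g' a b); split.
    + intros a b; rewrite E, E'; ring.
    + destruct n as [|n]; [intros; rewrite G, G'; ring|now apply form_plus].
  - destruct IH as [k [g [E' G]]]; exists k, g; split; [|exact G].
    intros a b; now rewrite <- E.
Qed.

(** Division by the linear form of a root, by induction on the degree: write
    [f = a * g + k * b ^ (n + 1)] and subtract from [g] the multiple of [b ^ n] that
    makes it vanish at the root. If [b0 = 0], then [g] itself vanishes there. *)
Lemma form_root n f a0 b0 : form (S n) f -> (a0 <> 0 \/ b0 <> 0) -> f a0 b0 = 0 ->
  exists g, form n g /\ forall a b, f a b = (a * b0 - b * a0) * g a b.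
Proof.
  revert f; induction n as [|n IH]; intros f Hf Hnz H0;
    destruct (form_split _ _ Hf) as [k [g [E G]]]; rewrite E in H0.
  - destruct (form_split _ _ G) as [l [g' [E' G']]].
    assert (Eg : forall a b, g a b = l) by (intros; rewrite E', G'; simpl; ring).
    rewrite Eg in H0; simpl in H0.
    destruct (Req_dec b0 0) as [Hb|Hb].
    + assert (Ha : a0 <> 0) by tauto.
      exists (fun _ _ => - k / a0); split; [apply form_const|]; intros a b.
      assert (l = 0) by (apply Rmult_eq_reg_l with a0; [rewrite Hb in H0; lra|exact Ha]).
      rewrite E, Eg, Hb; simpl; subst l; field; exact Ha.
    + exists (fun _ _ => l / b0); split; [apply form_const|]; intros a b.
      rewrite E, Eg; simpl; replace k with (- (a0 * l) / b0); [field; exact Hb|].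
      apply Rmult_eq_reg_r with b0; [|exact Hb]; field_simplify; lra.
  - destruct (Req_dec b0 0) as [Hb|Hb].
    + assert (Ha : a0 <> 0) by tauto.
      assert (Hg : g a0 b0 = 0).
      { apply Rmult_eq_reg_l with a0; [|exact Ha].
        rewrite Hb in H0 |- *; simpl in H0; lra. }
      destruct (IH g G Hnz Hg) as [g' [G' E']].
      exists (fun a b => a * g' a b - k / a0 * b ^ S n); split.
      * apply form_minus; [now apply form_fst|]; apply form_scal.
        pose proof (form_pow 1 _ (S n) form_b) as X; now rewrite Nat.mul_1_r in X.
      * intros a b; rewrite E, E', Hb; simpl; field; exact Ha.
    + set (r := g a0 b0 / b0 ^ S n).
      assert (Hbn : b0 ^ S n <> 0) by now apply pow_nonzero.
      assert (FB : form (S n) (fun _ b => b ^ S n)).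
      { pose proof (form_pow 1 _ (S n) form_b) as X; now rewrite Nat.mul_1_r in X. }
      destruct (IH (fun a b => g a b - r * b ^ S n)) as [g' [G' E']].
      * apply form_minus; [exact G|now apply form_scal].
      * exact Hnz.
      * unfold r; field; exact Hbn.
      * exists (fun a b => a * g' a b + r / b0 * b ^ S n); split.
        -- apply form_plus; [now apply form_fst|now apply form_scal].
        -- intros a b; rewrite E.
           replace (g a b) with ((a * b0 - b * a0) * g' a b + r * b ^ S n)
             by (rewrite <- E'; ring).
           assert (Hk : k = - (a0 * r) / b0).
           { apply Rmult_eq_reg_r with (b0 ^ S n * b0); [|now apply Rmult_integral_contrapositive].
             replace (k * (b0 ^ S n * b0)) with (k * b0 ^ S (S n)) by (simpl; ring).
             replace (- (a0 * r) / b0 * (b0 ^ S n * b0)) with (- (a0 * g a0 b0))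
               by (unfold r; field; split; assumption).
             lra. }
           rewrite Hk; simpl; field; exact Hb.
Qed.

(** The list holds one representative of each projective zero; it is built by
    dividing out one zero after another. *)
Lemma form_root_classes n f : form n f -> ~ (forall a b, f a b = 0) ->
  exists l : list (R * R), (length l <= n)%nat /\
    (forall p, In p l -> fst p <> 0 \/ snd p <> 0) /\
    forall a b, (a <> 0 \/ b <> 0) -> f a b = 0 ->
      exists p, In p l /\ a * snd p - b * fst p = 0.
Proof.
  revert f; induction n as [|n IH]; intros f Hf Hnz.
  - exists nil; split; [auto|split; [intros p []|]].
    intros a b _ H; exfalso; apply Hnz.
    destruct (form_split _ _ Hf) as [k [g [E G]]].
    intros a' b'; rewrite E, G; rewrite E, G in H; simpl in *; lra.
  - destruct (classic (exists a0 b0, (a0 <> 0 \/ b0 <> 0) /\ f a0 b0 = 0)) as [[a0 [b0 [H0 E0]]]|Hno].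
    + destruct (form_root n f a0 b0 Hf H0 E0) as [g [G E]].
      destruct (IH g G) as [l [L1 [L2 L3]]].
      { intros Hg; apply Hnz; intros a b; rewrite E, Hg; ring. }
      exists ((a0, b0) :: l); split; [simpl; lia|split].
      * intros p [<-|Hp]; [exact H0|now apply L2].
      * intros a b Hab Hz; rewrite E in Hz.
        destruct (Rmult_integral _ _ Hz) as [Hc|Hg].
        -- exists (a0, b0); split; [now left|exact Hc].
        -- destruct (L3 a b Hab Hg) as [p [Hp Hp']]; exists p; split; [now right|exact Hp'].
    + exists nil; split; [simpl; lia|split; [intros p []|]].
      intros a b Hab Hz; exfalso; apply Hno; now exists a, b.
Qed.

(** * The conic of normal directions *)

(** The normal vector of the surface is [A dX + B dY] in all four cases. The pair
    [(A, B)] runs through the conic [A^2 - e1 B^2 = eta], with [A' = - e1 B] and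
    [B' = - A]: the unit circle for [e1 = Neg], one branch of each of two conjugate
    hyperbolas for [e1 = Pos]. All functions of the angle become polynomials in [A] and
    [B] whose coefficients are the same for both signs [e2]. *)
Definition fA (e1 e2 : pm) (th : R) : R :=
  match e1, e2 with
  | Neg, Pos => sin th
  | Neg, Neg => cos th
  | Pos, Pos => sinh th
  | Pos, Neg => cosh th
  end.

Definition fB (e1 e2 : pm) (th : R) : R :=
  match e1, e2 with
  | Neg, Pos => cos th
  | Neg, Neg => - sin th
  | Pos, Pos => - cosh th
  | Pos, Neg => - sinh th
  end.

Definition eta (e1 e2 : pm) : R :=
  match e1, e2 with Pos, Pos => -1 | _, _ => 1 end.

Definition tau (e1 e2 : pm) : R :=
  match e1, e2 with Neg, Pos => -1 | _, _ => 1 end.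

Lemma cosh_sq t : cosh t ^ 2 = 1 + sinh t ^ 2.
Proof.
  unfold cosh, sinh; assert (E : exp t * exp (- t) = 1) by (rewrite <- exp_plus, Rplus_opp_r; apply exp_0).
  nra.
Qed.

Lemma cosh_plus x y : cosh (x + y) = cosh x * cosh y + sinh x * sinh y.
Proof. unfold cosh, sinh; rewrite Ropp_plus_distr, 2!exp_plus; field. Qed.

Lemma sinh_plus x y : sinh (x + y) = sinh x * cosh y + cosh x * sinh y.
Proof. unfold cosh, sinh; rewrite Ropp_plus_distr, 2!exp_plus; field. Qed.

Lemma sin_sq t : sin t ^ 2 = 1 - cos t ^ 2.
Proof. pose proof (sin2_cos2 t) as H; unfold Rsqr in H; nra. Qed.

Lemma fA_conic e1 e2 th : fA e1 e2 th ^ 2 - sgn e1 * fB e1 e2 th ^ 2 = eta e1 e2.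
Proof.
  pose proof (cosh_sq th); pose proof (sin_sq th).
  destruct e1, e2; unfold fA, fB, eta, sgn; nra.
Qed.

Lemma eta_sq e1 e2 : eta e1 e2 * eta e1 e2 = 1.
Proof. destruct e1, e2; unfold eta; ring. Qed.
Lemma tau_sq e1 e2 : tau e1 e2 * tau e1 e2 = 1.
Proof. destruct e1, e2; unfold tau; ring. Qed.
Lemma sgn_sq e : sgn e * sgn e = 1.
Proof. destruct e; unfold sgn; ring. Qed.

Lemma fAB_nonzero e1 e2 th : fA e1 e2 th <> 0 \/ fB e1 e2 th <> 0.
Proof.
  destruct (Req_dec (fA e1 e2 th) 0) as [Ha|Ha]; [right|now left].
  intros Hb; pose proof (fA_conic e1 e2 th) as H; pose proof (eta_sq e1 e2).
  rewrite Ha, Hb in H; nra.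
Qed.

Lemma is_derive_sinh t : is_derive sinh t (cosh t).
Proof. apply is_derive_Reals, derivable_pt_lim_sinh. Qed.
Lemma is_derive_cosh t : is_derive cosh t (sinh t).
Proof. apply is_derive_Reals, derivable_pt_lim_cosh. Qed.

Lemma is_derive_fA e1 e2 th : is_derive (fA e1 e2) th (- sgn e1 * fB e1 e2 th).
Proof.
  destruct e1, e2; unfold fA, fB, sgn.
  - replace (_ * _) with (cosh th) by ring; apply is_derive_sinh.
  - replace (_ * _) with (sinh th) by ring; apply is_derive_cosh.
  - replace (_ * _) with (cos th) by ring; apply is_derive_sin.
  - replace (_ * _) with (- sin th) by ring; apply is_derive_cos.
Qed.

Lemma is_derive_fB e1 e2 th : is_derive (fB e1 e2) th (- fA e1 e2 th).
Proof.
  destruct e1, e2; unfold fA, fB.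
  - apply (is_derive_opp cosh), is_derive_cosh.
  - apply (is_derive_opp sinh), is_derive_sinh.
  - apply is_derive_cos.
  - apply (is_derive_opp sin), is_derive_sin.
Qed.

(** [alpha], [beta] and, up to the sign [tau], [lam] as forms in [A] and [B]: of
    degrees four, four and three. *)
Definition alphaf (e1 : pm) (a b : R) : R :=
  - / 2 * a ^ 4 + 3 * sgn e1 * a ^ 2 * b ^ 2 + 3 / 2 * b ^ 4.
Definition betaf (e1 : pm) (a b : R) : R := - (4 * sgn e1) * a ^ 3 * b.
Definition lamf (e1 : pm) (a b : R) : R := a * (a ^ 2 + 3 * sgn e1 * b ^ 2).

Lemma cosh_2 t : cosh (2 * t) = cosh t * cosh t + sinh t * sinh t.
Proof. replace (2 * t) with (t + t) by ring; apply cosh_plus. Qed.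
Lemma sinh_2 t : sinh (2 * t) = 2 * sinh t * cosh t.
Proof. replace (2 * t) with (t + t) by ring; rewrite sinh_plus; ring. Qed.


Lemma alpha_form e1 e2 th : alpha e1 e2 th = alphaf e1 (fA e1 e2 th) (fB e1 e2 th).
Proof.
  pose proof (cosh_sq th) as Hh; pose proof (sin_sq th) as Ht.
  destruct e1, e2; unfold alpha, alphaf, fA, fB, sgn; rewrite ?cosh_2, ?sinh_2, ?cos_2a, ?sin_2a;
    field [Hh Ht].
Qed.

Lemma beta_form e1 e2 th : beta e1 e2 th = betaf e1 (fA e1 e2 th) (fB e1 e2 th).
Proof.
  pose proof (cosh_sq th) as Hh; pose proof (sin_sq th) as Ht.
  destruct e1, e2; unfold beta, betaf, fA, fB, sgn; rewrite ?cosh_2, ?sinh_2, ?cos_2a, ?sin_2a;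
    ring [Hh Ht].
Qed.

Lemma lam_form e1 e2 th : lam e1 e2 th = tau e1 e2 * lamf e1 (fA e1 e2 th) (fB e1 e2 th).
Proof.
  pose proof (cosh_sq th) as Hh; pose proof (sin_sq th) as Ht.
  destruct e1, e2; unfold lam, lamf, tau, fA, fB, sgn; replace (3 * th) with (th + 2 * th) by ring;
    rewrite ?cosh_plus, ?sinh_plus, ?cosh_2, ?sinh_2, ?cos_plus, ?sin_plus, ?cos_2a, ?sin_2a;
    ring [Hh Ht].
Qed.

Definition dlam (e1 e2 : pm) (th : R) : R :=
  - (3 * tau e1 e2) * fB e1 e2 th * (3 * sgn e1 * fA e1 e2 th ^ 2 + fB e1 e2 th ^ 2).

Lemma is_derive_lam e1 e2 th : is_derive (lam e1 e2) th (dlam e1 e2 th).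
Proof.
  apply is_derive_ext with (fun s => tau e1 e2 * lamf e1 (fA e1 e2 s) (fB e1 e2 s)).
  { intros s; symmetry; apply lam_form. }
  unfold lamf, dlam; auto_derive.
  - assert (Ea : ex_derive (fA e1 e2) th) by (eexists; apply is_derive_fA).
    assert (Eb : ex_derive (fB e1 e2) th) by (eexists; apply is_derive_fB).
    repeat split; assumption.
  - change (Derive (fun x => fA e1 e2 x) th) with (Derive (fA e1 e2) th).
    change (Derive (fun x => fB e1 e2 x) th) with (Derive (fB e1 e2) th).
    rewrite (is_derive_unique _ _ _ (is_derive_fA e1 e2 th)), (is_derive_unique _ _ _ (is_derive_fB e1 e2 th)).
    pose proof (sgn_sq e1) as H; ring [H].
Qed.

Lemma lam_simple_zero e1 e2 th : lam e1 e2 th = 0 -> dlam e1 e2 th <> 0.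
Proof.
  rewrite lam_form; unfold lamf, dlam.
  assert (T : tau e1 e2 <> 0) by (destruct e1, e2; unfold tau; lra).
  intros H H'; apply Rmult_integral in H; destruct H as [H|H]; [tauto|].
  pose proof (fAB_nonzero e1 e2 th) as N.
  set (a := fA e1 e2 th) in *; set (b := fB e1 e2 th) in *.
  assert (K : b * (3 * sgn e1 * a ^ 2 + b ^ 2) = 0).
  { apply Rmult_eq_reg_l with (- (3 * tau e1 e2)); [lra|intros Z; apply T; lra]. }
  apply Rmult_integral in H; apply Rmult_integral in K.
  assert (Hb : b = 0).
  { destruct K as [K|K]; [exact K|]; destruct H as [H|H]; [rewrite H in K; nra|].
    destruct e1; unfold sgn in *; nra. }
  rewrite Hb in *; destruct N as [N|N]; [|lra].
  apply N; destruct H as [H|H]; [exact H|nra].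
Qed.

Lemma nut_form e1 e2 g c th z :
  nut e1 e2 g c th z = vadd (vscal (fA e1 e2 th) (dX e1 e2 g c th z))
                            (vscal (fB e1 e2 th) (dY e1 e2 g c th z)).
Proof.
  destruct e1, e2; unfold nut, fA, fB; try reflexivity;
  unfold vadd, vscal, vx, vy, vz; simpl; repeat (f_equal; try ring).
Qed.

(** The unit circle is a double cover of the projective line, by the antipodal
    map, while the two half-hyperbolas embed into it with disjoint images. *)
Lemma fAB_same_class e1 e2 e2' th0 th0' :
  fA e1 e2 th0 * fB e1 e2' th0' - fB e1 e2 th0 * fA e1 e2' th0' = 0 ->
  exists sg, sg * sg = 1 /\ forall th,
    fA e1 e2' (th + (th0' - th0)) = sg * fA e1 e2 th /\
    fB e1 e2' (th + (th0' - th0)) = sg * fB e1 e2 th.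
Proof.
  intros H; destruct e1.
  - assert (E : e2 = e2' /\ th0 = th0').
    { assert (Cp : forall t, 0 < cosh t).
      { intros t; unfold cosh; pose proof (exp_pos t); pose proof (exp_pos (- t)); lra. }
      assert (Cm : forall x y, cosh x * cosh y - sinh x * sinh y = cosh (x + - y)).
      { intros x y; unfold cosh, sinh; rewrite Ropp_plus_distr, Ropp_involutive, 2!exp_plus; field. }
      assert (Sm : forall x y, sinh x * cosh y - cosh x * sinh y = sinh (x + - y)).
      { intros x y; unfold cosh, sinh; rewrite Ropp_plus_distr, Ropp_involutive, 2!exp_plus; field. }
      assert (Z : forall x y, sinh (x + - y) = 0 -> x = y).
      { intros x y Hs; destruct (Rtotal_order (x + - y) 0) as [L|[L|L]]; [|lra|];
        [pose proof (sinh_lt _ _ L)|pose proof (sinh_lt _ _ L)]; rewrite sinh_0 in *; lra. }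
      destruct e2, e2'; unfold fA, fB in H; split; try reflexivity.
      - apply Z; rewrite <- Sm; lra.
      - exfalso; pose proof (Cp (th0 + - th0')) as X; rewrite <- Cm in X; lra.
      - exfalso; pose proof (Cp (th0 + - th0')) as X; rewrite <- Cm in X; lra.
      - exfalso; pose proof (Cp (th0 + - th0')) as X; rewrite <- Cm in X; lra.
      - exfalso; pose proof (Cp (th0 + - th0')) as X; rewrite <- Cm in X; lra.
      - apply Z; rewrite <- Sm; lra. }
    destruct E as [<- <-]; exists 1; split; [ring|]; intros th.
    replace (th + (th0 - th0)) with th by ring; split; ring.
  - assert (HS' : forall th h,
      fA Neg e2' (th + h) = fA Neg e2' th * cos h + fB Neg e2' th * sin h /\
      fB Neg e2' (th + h) = fB Neg e2' th * cos h - fA Neg e2' th * sin h).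
    { intros th h; destruct e2'; unfold fA, fB; rewrite ?cos_plus, ?sin_plus; split; ring. }
    assert (HS0 : forall th h,
      fA Neg e2 (th + h) = fA Neg e2 th * cos h + fB Neg e2 th * sin h /\
      fB Neg e2 (th + h) = fB Neg e2 th * cos h - fA Neg e2 th * sin h).
    { intros th h; destruct e2; unfold fA, fB; rewrite ?cos_plus, ?sin_plus; split; ring. }
    pose proof (fA_conic Neg e2 th0) as N; pose proof (fA_conic Neg e2' th0') as N'.
    unfold sgn, eta in N, N'.
    set (a := fA Neg e2 th0) in *; set (b := fB Neg e2 th0) in *.
    set (a' := fA Neg e2' th0') in *; set (b' := fB Neg e2' th0') in *.
    set (sg := a * a' + b * b').
    assert (E1 : a' = sg * a).
    { unfold sg; replace (_ * a) with (a' * (a ^ 2 - -1 * b ^ 2) + b * (a * b' - b * a')) by ring.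
      rewrite N, H; ring. }
    assert (E2 : b' = sg * b).
    { unfold sg; replace (_ * b) with (b' * (a ^ 2 - -1 * b ^ 2) - a * (a * b' - b * a')) by ring.
      rewrite N, H; ring. }
    exists sg; split.
    + assert (sg ^ 2 * (a ^ 2 - -1 * b ^ 2) = 1) by (rewrite <- N', E1, E2; ring).
      rewrite N in *; lra.
    + intros th; replace (th + (th0' - th0)) with (th0' + (th - th0)) by ring.
      destruct (HS' th0' (th - th0)) as [X1 X2].
      destruct (HS0 th0 (th - th0)) as [Y1 Y2].
      replace (th0 + (th - th0)) with th in Y1, Y2 by ring.
      fold a' b' in X1, X2; fold a b in Y1, Y2.
      rewrite X1, X2, Y1, Y2, E1, E2; split; ring.
Qed.

Ltac smooth2_tac :=
  repeat first
    [ assumption | apply smooth2_const | apply smooth2_plus | apply smooth2_minus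
    | apply smooth2_opp | apply smooth2_mult | apply smooth2_pow
    | apply smooth2_d1 | apply smooth2_d2 | apply smooth2_snd ].

(** * Differentiation rules and density *)

Section DerivativeRules.
Variables (U : R -> R -> Prop) (HU : open2 U).

Lemma d1_eq_on f g s t : (forall s t, U s t -> f s t = g s t) -> U s t -> d1 f s t = d1 g s t.
Proof. intros E H; apply d1_ext_loc, locally_2d_mono with U; auto. Qed.

Lemma d2_eq_on f g s t : (forall s t, U s t -> f s t = g s t) -> U s t -> d2 f s t = d2 g s t.
Proof. intros E H; apply d2_ext_loc, locally_2d_mono with U; auto. Qed.

Lemma d2_plus f g s t : smooth2 U f -> smooth2 U g -> U s t ->
  d2 (fun s t => f s t + g s t) s t = d2 f s t + d2 g s t.
Proof.
  intros Hf Hg H; apply is_derive_unique.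
  apply (is_derive_plus (fun u => f s u) (fun u => g s u)); now apply smooth2_is_d2 with U.
Qed.

Lemma is_derive_Rmult (f g : R -> R) x df dg : is_derive f x df -> is_derive g x dg ->
  is_derive (fun u => f u * g u) x (df * g x + f x * dg).
Proof. intros Hf Hg; apply (is_derive_mult f g x df dg Hf Hg); intros; apply Rmult_comm. Qed.

Lemma d1_mult f g s t : smooth2 U f -> smooth2 U g -> U s t ->
  d1 (fun s t => f s t * g s t) s t = d1 f s t * g s t + f s t * d1 g s t.
Proof.
  intros Hf Hg H; apply is_derive_unique.
  apply (is_derive_Rmult (fun u => f u t) (fun u => g u t)); now apply smooth2_is_d1 with U.
Qed.

Lemma d2_mult f g s t : smooth2 U f -> smooth2 U g -> U s t ->
  d2 (fun s t => f s t * g s t) s t = d2 f s t * g s t + f s t * d2 g s t.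
Proof.
  intros Hf Hg H; apply is_derive_unique.
  apply (is_derive_Rmult (fun u => f s u) (fun u => g s u)); now apply smooth2_is_d2 with U.
Qed.

Lemma d2_opp f s t : smooth2 U f -> U s t -> d2 (fun s t => - f s t) s t = - d2 f s t.
Proof.
  intros Hf H; apply is_derive_unique.
  apply (is_derive_opp (fun u => f s u)); now apply smooth2_is_d2 with U.
Qed.

Lemma d2_fst (f : R -> R) s t : d2 (fun s _ => f s) s t = 0.
Proof. unfold d2; apply Derive_const. Qed.

Lemma d1_snd (f : R -> R) s t : d1 (fun _ t => f t) s t = 0.
Proof. unfold d1; apply Derive_const. Qed.

(** [A] and [B] are treated together because each is the derivative of the other. *)
Lemma smooth2_fAB e1 e2 :
  smooth2 U (fun s _ => fA e1 e2 s) /\ smooth2 U (fun s _ => fB e1 e2 s).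
Proof.
  rewrite 2!smooth2_reg.
  assert (C : forall f, (forall s, ex_derive f s) -> forall s t : R, continuity_2d_pt (fun s _ => f s) s t).
  { intros f Hf s t; apply (continuity_1d_2d_pt_comp f (fun s _ => s)).
    - apply continuity_pt_filterlim, (@ex_derive_continuous R_AbsRing R_NormedModule), Hf.
    - apply continuity_2d_pt_id1. }
  assert (Ea : forall s, ex_derive (fA e1 e2) s) by (intros s; eexists; apply is_derive_fA).
  assert (Eb : forall s, ex_derive (fB e1 e2) s) by (intros s; eexists; apply is_derive_fB).
  enough (E : forall n, reg n U (fun s _ => fA e1 e2 s) /\ reg n U (fun s _ => fB e1 e2 s))
    by (split; intros n; apply E).
  induction n as [|n [IHa IHb]].
  - split; intros s t _; now apply C.
  - split; (split; [intros s t _; split; [now apply C|split; [now auto|apply ex_derive_const]]|split]).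
    + apply reg_ext with (fun s _ => - sgn e1 * fB e1 e2 s); [exact HU| |].
      * intros s t _; symmetry; apply is_derive_unique, is_derive_fA.
      * apply reg_mult; [exact HU|apply reg_const|exact IHb].
    + apply reg_ext with (fun _ _ => 0); [exact HU| |apply reg_const].
      intros s t _; symmetry; apply d2_fst.
    + apply reg_ext with (fun s _ => -1 * fA e1 e2 s); [exact HU| |].
      * intros s t _; symmetry; apply is_derive_unique.
        replace (_ * _) with (- fA e1 e2 s) by ring; apply is_derive_fB.
      * apply reg_mult; [exact HU|apply reg_const|exact IHa].
    + apply reg_ext with (fun _ _ => 0); [exact HU| |apply reg_const].
      intros s t _; symmetry; apply d2_fst.
Qed.

Lemma smooth2_alpha e1 e2 : smooth2 U (fun s _ => alpha e1 e2 s).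
Proof.
  destruct (smooth2_fAB e1 e2).
  apply smooth2_ext with (fun s (_ : R) => alphaf e1 (fA e1 e2 s) (fB e1 e2 s)); [exact HU| |].
  - intros; symmetry; apply alpha_form.
  - unfold alphaf; smooth2_tac.
Qed.

Lemma smooth2_beta e1 e2 : smooth2 U (fun s _ => beta e1 e2 s).
Proof.
  destruct (smooth2_fAB e1 e2).
  apply smooth2_ext with (fun s (_ : R) => betaf e1 (fA e1 e2 s) (fB e1 e2 s)); [exact HU| |].
  - intros; symmetry; apply beta_form.
  - unfold betaf; smooth2_tac.
Qed.

Lemma smooth2_lam e1 e2 : smooth2 U (fun s _ => lam e1 e2 s).
Proof.
  destruct (smooth2_fAB e1 e2).
  apply smooth2_ext with (fun s (_ : R) => tau e1 e2 * lamf e1 (fA e1 e2 s) (fB e1 e2 s)); [exact HU| |].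
  - intros; symmetry; apply lam_form.
  - unfold lamf; smooth2_tac.
Qed.

End DerivativeRules.

Lemma is_derive_alpha e1 e2 th : is_derive (alpha e1 e2) th
  (- (4 * sgn e1 * tau e1 e2) * lam e1 e2 th * fB e1 e2 th).
Proof.
  apply is_derive_ext with (fun s => alphaf e1 (fA e1 e2 s) (fB e1 e2 s)).
  { intros s; symmetry; apply alpha_form. }
  rewrite lam_form; unfold lamf, alphaf; auto_derive.
  - assert (Ea : ex_derive (fA e1 e2) th) by (eexists; apply is_derive_fA).
    assert (Eb : ex_derive (fB e1 e2) th) by (eexists; apply is_derive_fB).
    repeat split; assumption.
  - change (Derive (fun x => fA e1 e2 x) th) with (Derive (fA e1 e2) th).
    change (Derive (fun x => fB e1 e2 x) th) with (Derive (fB e1 e2) th).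
    rewrite (is_derive_unique _ _ _ (is_derive_fA e1 e2 th)), (is_derive_unique _ _ _ (is_derive_fB e1 e2 th)).
    pose proof (sgn_sq e1) as H; pose proof (tau_sq e1 e2) as H'; field [H H'].
Qed.

Lemma is_derive_beta e1 e2 th : is_derive (beta e1 e2) th
  (4 * sgn e1 * tau e1 e2 * lam e1 e2 th * fA e1 e2 th).
Proof.
  apply is_derive_ext with (fun s => betaf e1 (fA e1 e2 s) (fB e1 e2 s)).
  { intros s; symmetry; apply beta_form. }
  rewrite lam_form; unfold lamf, betaf; auto_derive.
  - assert (Ea : ex_derive (fA e1 e2) th) by (eexists; apply is_derive_fA).
    assert (Eb : ex_derive (fB e1 e2) th) by (eexists; apply is_derive_fB).
    repeat split; assumption.
  - change (Derive (fun x => fA e1 e2 x) th) with (Derive (fA e1 e2) th).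
    change (Derive (fun x => fB e1 e2 x) th) with (Derive (fB e1 e2) th).
    rewrite (is_derive_unique _ _ _ (is_derive_fA e1 e2 th)), (is_derive_unique _ _ _ (is_derive_fB e1 e2 th)).
    pose proof (sgn_sq e1) as H; pose proof (tau_sq e1 e2) as H'; ring [H H'].
Qed.

(** All zeros of [lam] are simple, hence isolated. *)
Lemma lam_dense e1 e2 th d : 0 < d -> exists th', Rabs (th' - th) < d /\ lam e1 e2 th' <> 0.
Proof.
  intros Hd; apply NNPP; intros H.
  assert (Z : forall s, Rabs (s - th) < d -> lam e1 e2 s = 0).
  { intros s Hs; apply NNPP; intros Hn; apply H; now exists s. }
  assert (Z0 : lam e1 e2 th = 0) by (apply Z; rewrite Rminus_eq_0, Rabs_R0; exact Hd).
  apply (lam_simple_zero e1 e2 th Z0).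
  rewrite <- (is_derive_unique _ _ _ (is_derive_lam e1 e2 th)).
  rewrite (Derive_ext_loc _ (fun _ => 0)); [apply Derive_const|].
  exists (mkposreal d Hd); intros s Hs; apply Z, Hs.
Qed.

(** Identities are proved where [b] is an immersion and extended to the singular
    set by continuity. *)
Lemma dense_eq e1 e2 (V : R -> R -> Prop) f s t : open2 V ->
  (forall s t, V s t -> continuity_2d_pt f s t) ->
  (forall s t, V s t -> t <> 0 -> lam e1 e2 s <> 0 -> f s t = 0) ->
  V s t -> f s t = 0.
Proof.
  intros HV Hf H Hst; apply NNPP; intros Hn.
  destruct (open2_neq0 V f HV Hf s t (conj Hst Hn)) as [d Hd].
  destruct (lam_dense e1 e2 s d (cond_pos d)) as [s' [Hs' Hl]].
  set (t' := if Req_EM_T t 0 then d / 2 else t).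
  assert (Ht' : t' <> 0 /\ Rabs (t' - t) < d).
  { pose proof (cond_pos d); unfold t'; destruct (Req_EM_T t 0) as [->|Ht]; split.
    - lra.
    - rewrite Rminus_0_r, Rabs_pos_eq; lra.
    - exact Ht.
    - rewrite Rminus_eq_0, Rabs_R0; lra. }
  destruct Ht' as [Ht1 Ht2].
  destruct (Hd s' t' Hs' Ht2) as [K1 K2]; now apply K2, H.
Qed.

(* Proves [E = 0] at a point of the open set [V] by proving it where the
   surface is immersed; the expression [E] is abstracted over the point. *)
Ltac by_density e1 e2 V s t HV H :=
  match goal with |- ?l = 0 =>
    let f := eval pattern s, t in l in
    match f with ?F _ _ => apply (dense_eq e1 e2 V F s t HV); [| |exact H] end
  end; clear s t H; intros s t H; cbv beta.

(** * The normal vector and the fundamental forms *)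

Definition along (c : param) (f : R -> R -> R -> R) (th z : R) : R := f (px c th z) (py c th z) z.

(** One component of [dX] or [dY]: [D] is one of the three partial derivatives,
    [f] is [P] or [Q], and [w] is [alpha] or [beta]. *)
Definition dcomp (g : germs) (c : param) (D : (R -> R -> R -> R) -> R -> R -> R -> R)
    (f : R -> R -> R -> R) (w : R -> R) (th z : R) : R :=
  along c (D f) th z + 2 * (along c (gR g) th z * along c (D (gR g)) th z * w th).

Definition ncomp (e1 e2 : pm) (g : germs) (c : param)
    (D : (R -> R -> R -> R) -> R -> R -> R -> R) (th z : R) : R :=
  fA e1 e2 th * dcomp g c D (gP g) (alpha e1 e2) th z
  + fB e1 e2 th * dcomp g c D (gQ g) (beta e1 e2) th z.

Definition jac (e1 e2 : pm) (g : germs) (c : param) (th z : R) : R :=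
  dcomp g c D1 (gP g) (alpha e1 e2) th z * dcomp g c D2 (gQ g) (beta e1 e2) th z
  - dcomp g c D2 (gP g) (alpha e1 e2) th z * dcomp g c D1 (gQ g) (beta e1 e2) th z.

(** The letters E, F, G, L, M, N denote the coefficients of the fundamental forms
    after division by powers of [rho], which carries all their zeros, and, for the
    last three, multiplication by the length of the normal. They are smooth
    across the singular set and free of square roots. *)
Definition wE (e1 e2 : pm) (g : germs) (c : param) (th z : R) : R :=
  ncomp e1 e2 g c D1 th z ^ 2 + ncomp e1 e2 g c D2 th z ^ 2.

Definition sg0 (e1 e2 : pm) : R := sgn e1 * tau e1 e2.

Definition wF (e1 e2 : pm) (g : germs) (c : param) (th z : R) : R :=
  sg0 e1 e2 * (ncomp e1 e2 g c D2 th z * d2 (px c) th z - ncomp e1 e2 g c D1 th z * d2 (py c) th z).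
Definition wL (e1 e2 : pm) (g : germs) (c : param) (th z : R) : R :=
  - (sg0 e1 e2 * (ncomp e1 e2 g c D2 th z * d1 (ncomp e1 e2 g c D1) th z
                  - ncomp e1 e2 g c D1 th z * d1 (ncomp e1 e2 g c D2) th z)).
Definition wM (e1 e2 : pm) (g : germs) (c : param) (th z : R) : R :=
  - (sg0 e1 e2 * (ncomp e1 e2 g c D2 th z * d2 (ncomp e1 e2 g c D1) th z
                  - ncomp e1 e2 g c D1 th z * d2 (ncomp e1 e2 g c D2) th z)).
Definition wN (e1 e2 : pm) (g : germs) (c : param) (th z : R) : R :=
  - (d2 (px c) th z * d2 (ncomp e1 e2 g c D1) th z
     + d2 (py c) th z * d2 (ncomp e1 e2 g c D2) th z + d2 (ncomp e1 e2 g c D3) th z).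
Definition wG (c : param) (th z : R) : R := d2 (px c) th z ^ 2 + d2 (py c) th z ^ 2 + 1.
Definition nlen (e1 e2 : pm) (g : germs) (c : param) (th z : R) : R :=
  sqrt (wE e1 e2 g c th z + ncomp e1 e2 g c D3 th z ^ 2).
Definition wa (e1 e2 : pm) (g : germs) (c : param) (q : quotients) (th z : R) : R :=
  4 * qR q th z ^ 2 / jac e1 e2 g c th z.
Definition rho (e1 e2 : pm) (g : germs) (c : param) (q : quotients) (th z : R) : R :=
  z ^ 2 * lam e1 e2 th * wa e1 e2 g c q th z.

Section Surface.
Variables (e1 e2 : pm) (g : germs) (c : param) (q : quotients).
Hypotheses (Hg : normal_form g) (Hc : is_param e1 e2 g c) (Hq : is_quotients e1 e2 g c q).

Notation U := (pU c).
Notation W := (gW g).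
Notation A := (fA e1 e2).
Notation B := (fB e1 e2).
Notation n1 := (ncomp e1 e2 g c D1).
Notation n2 := (ncomp e1 e2 g c D2).
Notation n3 := (ncomp e1 e2 g c D3).
Notation s0 := (sg0 e1 e2).
Notation X1 := (dcomp g c D1 (gP g) (alpha e1 e2)).
Notation X2 := (dcomp g c D2 (gP g) (alpha e1 e2)).
Notation X3 := (dcomp g c D3 (gP g) (alpha e1 e2)).
Notation Y1 := (dcomp g c D1 (gQ g) (beta e1 e2)).
Notation Y2 := (dcomp g c D2 (gQ g) (beta e1 e2)).
Notation Y3 := (dcomp g c D3 (gQ g) (beta e1 e2)).
Notation m_ := (nlen e1 e2 g c).
Notation r_ := (rho e1 e2 g c q).
Notation nu_ := (nu e1 e2 g c).

Lemma openU : open2 U.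
Proof. exact (par_open _ _ _ _ Hc). Qed.

Lemma openW : open3 W.
Proof. exact (nf_open _ Hg). Qed.

Let HU := openU.
Let HW := openW.

Lemma smooth_px : smooth2 U (px c). Proof. apply (par_smooth _ _ _ _ Hc). Qed.
Lemma smooth_py : smooth2 U (py c). Proof. apply (par_smooth _ _ _ _ Hc). Qed.
Let Hx := smooth_px.
Let Hy := smooth_py.
Let Hdom := par_dom _ _ _ _ Hc.

Lemma smooth_P : smooth3 W (gP g). Proof. apply (nf_smooth _ Hg). Qed.
Lemma smooth_Q : smooth3 W (gQ g). Proof. apply (nf_smooth _ Hg). Qed.
Lemma smooth_R : smooth3 W (gR g). Proof. apply (nf_smooth _ Hg). Qed.

Lemma smooth_along f : smooth3 W f -> smooth2 U (along c f).
Proof. intros Hf; exact (smooth2_along U W (px c) (py c) HU HW Hx Hy Hdom f Hf). Qed.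

Definition partial_op (D : (R -> R -> R -> R) -> R -> R -> R -> R) : Prop :=
  forall f, smooth3 W f -> smooth3 W (D f).

Lemma partial_D1 : partial_op D1. Proof. intros f; apply smooth3_D1. Qed.
Lemma partial_D2 : partial_op D2. Proof. intros f; apply smooth3_D2. Qed.
Lemma partial_D3 : partial_op D3. Proof. intros f; apply smooth3_D3. Qed.

Lemma smooth_dcomp D f (w : R -> R) : partial_op D -> smooth3 W f ->
  smooth2 U (fun s _ => w s) -> smooth2 U (dcomp g c D f w).
Proof.
  intros HD Hf Hw; unfold dcomp.
  pose proof (smooth_along _ smooth_R); pose proof (smooth_along _ (HD _ smooth_R)).
  pose proof (smooth_along _ (HD _ Hf)); smooth2_tac.
Qed.

Lemma smooth_ncomp D : partial_op D -> smooth2 U (ncomp e1 e2 g c D).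
Proof.
  intros HD; unfold ncomp; destruct (smooth2_fAB U HU e1 e2).
  pose proof (smooth_dcomp D _ _ HD smooth_P (smooth2_alpha U HU e1 e2)).
  pose proof (smooth_dcomp D _ _ HD smooth_Q (smooth2_beta U HU e1 e2)).
  smooth2_tac.
Qed.

Let S1 := smooth_ncomp D1 partial_D1.
Let S2 := smooth_ncomp D2 partial_D2.
Let S3 := smooth_ncomp D3 partial_D3.

Lemma smooth_jac : smooth2 U (jac e1 e2 g c).
Proof.
  pose proof (smooth_dcomp _ _ _ partial_D1 smooth_P (smooth2_alpha U HU e1 e2)).
  pose proof (smooth_dcomp _ _ _ partial_D2 smooth_P (smooth2_alpha U HU e1 e2)).
  pose proof (smooth_dcomp _ _ _ partial_D1 smooth_Q (smooth2_beta U HU e1 e2)).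
  pose proof (smooth_dcomp _ _ _ partial_D2 smooth_Q (smooth2_beta U HU e1 e2)).
  unfold jac; smooth2_tac.
Qed.

Lemma smooth_wE : smooth2 U (wE e1 e2 g c). Proof. unfold wE; smooth2_tac. Qed.
Lemma smooth_wF : smooth2 U (wF e1 e2 g c). Proof. unfold wF; smooth2_tac. Qed.
Lemma smooth_wL : smooth2 U (wL e1 e2 g c). Proof. unfold wL; smooth2_tac. Qed.
Lemma smooth_wM : smooth2 U (wM e1 e2 g c). Proof. unfold wM; smooth2_tac. Qed.
Lemma smooth_wN : smooth2 U (wN e1 e2 g c). Proof. unfold wN; smooth2_tac. Qed.
Lemma smooth_wG : smooth2 U (wG c). Proof. unfold wG; smooth2_tac. Qed.

Lemma is_derive_germ (P R : R -> R) x w dP dR : is_derive P x dP -> is_derive R x dR ->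
  is_derive (fun u => P u + R u ^ 2 * w) x (dP + 2 * (R x * dR * w)).
Proof.
  intros H1 H2; auto_derive.
  - split; [now exists dP|split; [now exists dR|exact I]].
  - change (Derive (fun x => P x) x) with (Derive P x).
    change (Derive (fun x => R x) x) with (Derive R x).
    rewrite (is_derive_unique _ _ _ H1), (is_derive_unique _ _ _ H2); ring.
Qed.

Lemma smooth3_is f x y z : smooth3 W f -> W x y z ->
  is_derive (fun u => f u y z) x (D1 f x y z) /\ is_derive (fun u => f x u z) y (D2 f x y z) /\
  is_derive (fun u => f x y u) z (D3 f x y z).
Proof.
  intros Hf H; destruct (proj1 (Hf 1%nat) x y z H) as [X1 [X2 X3]].
  split; [exact (Derive_correct _ _ X1)|split;
    [exact (Derive_correct _ _ X2)|exact (Derive_correct _ _ X3)]].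
Qed.

Lemma grad_Xf th z : U th z -> dX e1 e2 g c th z =
  (X1 th z, X2 th z,
   X3 th z).
Proof.
  intros H; pose proof (smooth3_is _ _ _ _ smooth_P (Hdom _ _ H)) as [P1 [P2 P3]].
  pose proof (smooth3_is _ _ _ _ smooth_R (Hdom _ _ H)) as [R1 [R2 R3]].
  unfold dX, grad_along, Xf; repeat f_equal; apply is_derive_unique.
  - exact (is_derive_germ (fun u => gP g u _ _) (fun u => gR g u _ _) _ _ _ _ P1 R1).
  - exact (is_derive_germ (fun u => gP g _ u _) (fun u => gR g _ u _) _ _ _ _ P2 R2).
  - exact (is_derive_germ (fun u => gP g _ _ u) (fun u => gR g _ _ u) _ _ _ _ P3 R3).
Qed.

Lemma grad_Yf th z : U th z -> dY e1 e2 g c th z =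
  (Y1 th z, Y2 th z,
   Y3 th z).
Proof.
  intros H; pose proof (smooth3_is _ _ _ _ smooth_Q (Hdom _ _ H)) as [P1 [P2 P3]].
  pose proof (smooth3_is _ _ _ _ smooth_R (Hdom _ _ H)) as [R1 [R2 R3]].
  unfold dY, grad_along, Yf; repeat f_equal; apply is_derive_unique.
  - exact (is_derive_germ (fun u => gQ g u _ _) (fun u => gR g u _ _) _ _ _ _ P1 R1).
  - exact (is_derive_germ (fun u => gQ g _ u _) (fun u => gR g _ u _) _ _ _ _ P2 R2).
  - exact (is_derive_germ (fun u => gQ g _ _ u) (fun u => gR g _ _ u) _ _ _ _ P3 R3).
Qed.

Lemma nut_comp th z : U th z -> nut e1 e2 g c th z = (n1 th z, n2 th z, n3 th z).
Proof. intros H; rewrite nut_form, grad_Xf, grad_Yf by exact H; reflexivity. Qed.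

Lemma af_wa th z : U th z -> af e1 e2 g c q th z = wa e1 e2 g c q th z.
Proof. intros H; unfold af; rewrite grad_Xf, grad_Yf by exact H; reflexivity. Qed.

Lemma nlen_eq th z : U th z -> vnorm (nut e1 e2 g c th z) = m_ th z.
Proof.
  intros H; unfold vnorm, nlen; rewrite nut_comp by exact H; f_equal.
  unfold dot, wE, vx, vy, vz; simpl; ring.
Qed.

(** The right-hand sides come from [alpha' = - 4 s0 lam B] and [beta' = 4 s0 lam A]. *)
Lemma implicit_d1 th z : U th z ->
  X1 th z * d1 (px c) th z
  + X2 th z * d1 (py c) th z
  = along c (gR g) th z ^ 2 * (4 * s0 * lam e1 e2 th * B th) /\
  Y1 th z * d1 (px c) th z
  + Y2 th z * d1 (py c) th z
  = - (along c (gR g) th z ^ 2 * (4 * s0 * lam e1 e2 th * A th)).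
Proof.
  intros H.
  assert (K : forall f w dw, smooth3 W f -> is_derive w th dw ->
    (forall s t, U s t -> along c f s t + along c (gR g) s t ^ 2 * w s = 0) ->
    dcomp g c D1 f w th z * d1 (px c) th z + dcomp g c D2 f w th z * d1 (py c) th z
    = - (along c (gR g) th z ^ 2 * dw)).
  { intros f w dw Hf Hw Z.
    pose proof (is_d1_along U W (px c) (py c) HW Hx Hy Hdom f th z Hf H) as Df.
    pose proof (is_d1_along U W (px c) (py c) HW Hx Hy Hdom (gR g) th z smooth_R H) as DR.
    pose proof (is_derive_Rmult _ _ _ _ _ DR DR) as DRR.
    pose proof (is_derive_Rmult _ _ _ _ _ DRR Hw) as DRw.
    pose proof (is_derive_unique _ _ _ (is_derive_plus _ _ _ _ _ Df DRw)) as E.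
    unfold plus in E; simpl in E.
    rewrite (Derive_ext_loc _ (fun _ => 0)) in E.
    - rewrite Derive_const in E; unfold dcomp, along; lra.
    - apply (locally_2d_1d_const_y (fun s t => along c f s t + along c (gR g) s t * along c (gR g) s t * w s = 0)).
      apply locally_2d_mono with U; [|now apply HU].
      intros u v Huv; rewrite <- (Z u v Huv); ring. }
  split.
  - rewrite (K _ _ _ smooth_P (is_derive_alpha e1 e2 th)).
    + unfold sg0; ring.
    + intros s t Hst; exact (proj1 (par_eq _ _ _ _ Hc s t Hst)).
  - rewrite (K _ _ _ smooth_Q (is_derive_beta e1 e2 th)).
    + unfold sg0; ring.
    + intros s t Hst; exact (proj2 (par_eq _ _ _ _ Hc s t Hst)).
Qed.

Lemma implicit_d2 th z : U th z ->
  X1 th z * d2 (px c) th z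
  + X2 th z * d2 (py c) th z
  + X3 th z = 0 /\
  Y1 th z * d2 (px c) th z
  + Y2 th z * d2 (py c) th z
  + Y3 th z = 0.
Proof.
  intros H.
  assert (K : forall f w, smooth3 W f ->
    (forall s t, U s t -> along c f s t + along c (gR g) s t ^ 2 * w s = 0) ->
    dcomp g c D1 f w th z * d2 (px c) th z + dcomp g c D2 f w th z * d2 (py c) th z
    + dcomp g c D3 f w th z = 0).
  { intros f w Hf Z.
    pose proof (is_d2_along U W (px c) (py c) HW Hx Hy Hdom f th z Hf H) as Df.
    pose proof (is_d2_along U W (px c) (py c) HW Hx Hy Hdom (gR g) th z smooth_R H) as DR.
    pose proof (is_derive_Rmult _ _ _ _ _ DR DR) as DRR.
    pose proof (is_derive_Rmult _ _ _ _ _ DRR (is_derive_const (w th) z)) as DRw.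
    pose proof (is_derive_unique _ _ _ (is_derive_plus _ _ _ _ _ Df DRw)) as E.
    unfold plus, zero in E; simpl in E.
    rewrite (Derive_ext_loc _ (fun _ => 0)) in E.
    - rewrite Derive_const in E; unfold dcomp, along; lra.
    - apply (locally_2d_1d_const_x (fun s t => along c f s t + along c (gR g) s t * along c (gR g) s t * w s = 0)).
      apply locally_2d_mono with U; [|now apply HU].
      intros u v Huv; rewrite <- (Z u v Huv); ring. }
  split.
  - apply K; [exact smooth_P|intros s t Hst; exact (proj1 (par_eq _ _ _ _ Hc s t Hst))].
  - apply K; [exact smooth_Q|intros s t Hst; exact (proj2 (par_eq _ _ _ _ Hc s t Hst))].
Qed.

Lemma normal_d2 th z : U th z ->
  n1 th z * d2 (px c) th z + n2 th z * d2 (py c) th z + n3 th z = 0.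
Proof. intros H; destruct (implicit_d2 th z H) as [E1 E2]; unfold ncomp; nra. Qed.

(** The tangent vector [b_theta] is [rho] times the horizontal vector
    orthogonal to the normal. *)
Lemma velocity th z : U th z -> jac e1 e2 g c th z <> 0 ->
  d1 (px c) th z = s0 * r_ th z * n2 th z /\
  d1 (py c) th z = - (s0 * r_ th z * n1 th z).
Proof.
  intros H HJ; destruct (implicit_d1 th z H) as [E1 E2].
  assert (ER : along c (gR g) th z = z * qR q th z) by exact (quo_R _ _ _ _ _ Hq th z H).
  rewrite ER in E1, E2.
  unfold rho, wa, ncomp; unfold jac in *.
  set (a1 := X1 th z) in *; set (a2 := X2 th z) in *.
  set (b1 := Y1 th z) in *; set (b2 := Y2 th z) in *.
  set (x' := d1 (px c) th z) in *; set (y' := d1 (py c) th z) in *.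
  split; apply Rmult_eq_reg_l with (a1 * b2 - a2 * b1); try exact HJ.
  - replace (_ * x') with (b2 * (a1 * x' + a2 * y') - a2 * (b1 * x' + b2 * y')) by ring.
    rewrite E1, E2; field; exact HJ.
  - replace (_ * y') with (a1 * (b1 * x' + b2 * y') - b1 * (a1 * x' + a2 * y')) by ring.
    rewrite E1, E2; field; exact HJ.
Qed.

(** The part of the source on which the explicit formulas are free of division
    by zero; it contains the axis. *)
Definition good (th z : R) : Prop :=
  (U th z /\ qR q th z <> 0) /\ jac e1 e2 g c th z * wE e1 e2 g c th z <> 0.

Lemma good_U th z : good th z -> U th z. Proof. unfold good; tauto. Qed.
Lemma good_qR th z : good th z -> qR q th z <> 0. Proof. unfold good; tauto. Qed.
Lemma good_jac th z : good th z -> jac e1 e2 g c th z <> 0.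
Proof. intros [_ H] E; apply H; rewrite E; ring. Qed.
Lemma good_wE th z : good th z -> 0 < wE e1 e2 g c th z.
Proof.
  intros [_ H]; assert (N : wE e1 e2 g c th z <> 0) by (intros E; apply H; rewrite E; ring).
  unfold wE in *; nra.
Qed.

Lemma open_good : open2 good.
Proof.
  unfold good; apply open2_neq0.
  - apply open2_neq0; [exact HU|]; intros s t; apply smooth2_cont, (quo_smooth _ _ _ _ _ Hq).
  - intros s t [H _]; apply (smooth2_cont U); [|exact H].
    pose proof smooth_jac; pose proof smooth_wE; smooth2_tac.
Qed.

Let HV := open_good.

Lemma smooth_qR : smooth2 U (qR q). Proof. apply (quo_smooth _ _ _ _ _ Hq). Qed.

Lemma good_smooth f : smooth2 U f -> smooth2 good f.
Proof. apply smooth2_restrict, good_U. Qed.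

Lemma smooth_wa : smooth2 good (wa e1 e2 g c q).
Proof.
  pose proof (good_smooth _ smooth_qR); pose proof (good_smooth _ smooth_jac).
  unfold wa; apply smooth2_div; [exact HV|exact good_jac|smooth2_tac|smooth2_tac].
Qed.

Lemma smooth_rho : smooth2 good r_.
Proof.
  pose proof smooth_wa; pose proof (smooth2_lam good HV e1 e2); unfold rho; smooth2_tac.
Qed.

Lemma nlen_pos th z : good th z -> 0 < m_ th z.
Proof. intros H; pose proof (good_wE th z H); apply sqrt_lt_R0; nra. Qed.

Lemma nlen_sq th z : good th z ->
  m_ th z ^ 2 = wE e1 e2 g c th z + n3 th z ^ 2.
Proof. intros H; pose proof (good_wE th z H); apply pow2_sqrt; nra. Qed.

Lemma smooth_nlen : smooth2 good m_.
Proof.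
  pose proof (good_smooth _ smooth_wE); pose proof (good_smooth _ S3).
  unfold nlen; apply smooth2_sqrt; [exact HV| |smooth2_tac].
  intros s t H'; pose proof (good_wE s t H'); nra.
Qed.

Lemma s0_sq : s0 * s0 = 1.
Proof. unfold sg0; pose proof (sgn_sq e1) as H1; pose proof (tau_sq e1 e2) as H2; ring [H1 H2]. Qed.

Lemma form_E th z : good th z -> fE c th z = r_ th z ^ 2 * wE e1 e2 g c th z.
Proof.
  intros H; destruct (velocity th z (good_U _ _ H) (good_jac _ _ H)) as [V1 V2].
  unfold fE, dot, vd1, b, vx, vy, vz, wE; simpl.
  rewrite (d1_snd (fun t => t)).
  change (d1 (fun s t => px c s t) th z) with (d1 (px c) th z).
  change (d1 (fun s t => py c s t) th z) with (d1 (py c) th z).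
  rewrite V1, V2; pose proof s0_sq as K; ring [K].
Qed.

Lemma d2_id th z : d2 (fun _ t => t) th z = 1.
Proof. unfold d2; apply Derive_id. Qed.

Lemma form_F th z : good th z -> fF c th z = r_ th z * wF e1 e2 g c th z.
Proof.
  intros H; destruct (velocity th z (good_U _ _ H) (good_jac _ _ H)) as [V1 V2].
  unfold fF, dot, vd1, vd2, b, vx, vy, vz, wF; simpl.
  rewrite (d1_snd (fun t => t)).
  change (d1 (fun s t => px c s t) th z) with (d1 (px c) th z).
  change (d1 (fun s t => py c s t) th z) with (d1 (py c) th z).
  change (d2 (fun s t => px c s t) th z) with (d2 (px c) th z).
  change (d2 (fun s t => py c s t) th z) with (d2 (py c) th z).
  rewrite V1, V2; ring.
Qed.

Lemma form_G th z : fG c th z = wG c th z.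
Proof.
  unfold fG, dot, vd2, b, vx, vy, vz, wG; simpl.
  change (d2 (fun s t => px c s t) th z) with (d2 (px c) th z).
  change (d2 (fun s t => py c s t) th z) with (d2 (py c) th z).
  rewrite d2_id; ring.
Qed.

Lemma smooth_inv_nlen : smooth2 good (fun s t => / m_ s t).
Proof.
  apply smooth2_inv; [exact HV| |exact smooth_nlen].
  intros s t Hst; apply Rgt_not_eq, nlen_pos, Hst.
Qed.

Lemma nu_comp (co : vec -> R) n s t : (forall a v, co (vscal a v) = a * co v) ->
  (forall s t, U s t -> co (nut e1 e2 g c s t) = n s t) ->
  good s t -> co (nu_ s t) = / m_ s t * n s t.
Proof.
  intros Hco E H; unfold nu; rewrite Hco, nlen_eq, E by (now apply good_U); reflexivity.
Qed.

(** Differentiating the length of the normal only adds a multiple of the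
    normal, which tangent vectors do not see. *)
Lemma dot_vd1_nu v th z : good th z ->
  vx v * n1 th z + vy v * n2 th z + vz v * n3 th z = 0 ->
  m_ th z * dot v (vd1 nu_ th z)
  = vx v * d1 n1 th z + vy v * d1 n2 th z + vz v * d1 n3 th z.
Proof.
  intros H Hv; pose proof smooth_inv_nlen as I; pose proof (nlen_pos th z H) as Hp.
  assert (K : forall (co : vec -> R) n, smooth2 U n -> (forall a v, co (vscal a v) = a * co v) ->
    (forall s t, U s t -> co (nut e1 e2 g c s t) = n s t) ->
    d1 (fun s t => co (nu_ s t)) th z
    = d1 (fun s t => / m_ s t) th z * n th z + / m_ th z * d1 n th z).
  { intros co n Hn Hco E; rewrite <- (d1_mult good); [|exact I|now apply good_smooth|exact H].
    apply (d1_eq_on good HV); [|exact H]; intros s t Hst; now apply nu_comp. }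
  unfold dot.
  change (vx (vd1 nu_ th z)) with (d1 (fun s t => vx (nu_ s t)) th z).
  change (vy (vd1 nu_ th z)) with (d1 (fun s t => vy (nu_ s t)) th z).
  change (vz (vd1 nu_ th z)) with (d1 (fun s t => vz (nu_ s t)) th z).
  rewrite (K vx n1 S1), (K vy n2 S2), (K vz n3 S3);
    try reflexivity; try (intros s t Hst; now rewrite nut_comp).
  set (w := d1 (fun s t => / m_ s t) th z).
  transitivity (m_ th z * w * (vx v * n1 th z + vy v * n2 th z + vz v * n3 th z)
    + (vx v * d1 n1 th z + vy v * d1 n2 th z + vz v * d1 n3 th z)); [field; lra|rewrite Hv; ring].
Qed.

Lemma dot_vd2_nu v th z : good th z ->
  vx v * n1 th z + vy v * n2 th z + vz v * n3 th z = 0 ->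
  m_ th z * dot v (vd2 nu_ th z)
  = vx v * d2 n1 th z + vy v * d2 n2 th z + vz v * d2 n3 th z.
Proof.
  intros H Hv; pose proof smooth_inv_nlen as I; pose proof (nlen_pos th z H) as Hp.
  assert (K : forall (co : vec -> R) n, smooth2 U n -> (forall a v, co (vscal a v) = a * co v) ->
    (forall s t, U s t -> co (nut e1 e2 g c s t) = n s t) ->
    d2 (fun s t => co (nu_ s t)) th z
    = d2 (fun s t => / m_ s t) th z * n th z + / m_ th z * d2 n th z).
  { intros co n Hn Hco E; rewrite <- (d2_mult good); [|exact I|now apply good_smooth|exact H].
    apply (d2_eq_on good HV); [|exact H]; intros s t Hst; now apply nu_comp. }
  unfold dot.
  change (vx (vd2 nu_ th z)) with (d2 (fun s t => vx (nu_ s t)) th z).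
  change (vy (vd2 nu_ th z)) with (d2 (fun s t => vy (nu_ s t)) th z).
  change (vz (vd2 nu_ th z)) with (d2 (fun s t => vz (nu_ s t)) th z).
  rewrite (K vx n1 S1), (K vy n2 S2), (K vz n3 S3);
    try reflexivity; try (intros s t Hst; now rewrite nut_comp).
  set (w := d2 (fun s t => / m_ s t) th z).
  transitivity (m_ th z * w * (vx v * n1 th z + vy v * n2 th z + vz v * n3 th z)
    + (vx v * d2 n1 th z + vy v * d2 n2 th z + vz v * d2 n3 th z)); [field; lra|rewrite Hv; ring].
Qed.

Lemma form_L th z : good th z ->
  m_ th z * fL e1 e2 g c th z = r_ th z * wL e1 e2 g c th z.
Proof.
  intros H; destruct (velocity th z (good_U _ _ H) (good_jac _ _ H)) as [V1 V2].
  unfold fL; rewrite Ropp_mult_distr_r_reverse, dot_vd1_nu; [|exact H|];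
  unfold vd1, b, vx, vy, vz; simpl; rewrite (d1_snd (fun t => t));
  change (d1 (fun s t => px c s t) th z) with (d1 (px c) th z);
  change (d1 (fun s t => py c s t) th z) with (d1 (py c) th z);
  rewrite V1, V2; unfold wL; ring.
Qed.

Lemma form_M th z : good th z ->
  m_ th z * fM e1 e2 g c th z = r_ th z * wM e1 e2 g c th z.
Proof.
  intros H; destruct (velocity th z (good_U _ _ H) (good_jac _ _ H)) as [V1 V2].
  unfold fM; rewrite Ropp_mult_distr_r_reverse, dot_vd2_nu; [|exact H|];
  unfold vd1, b, vx, vy, vz; simpl; rewrite (d1_snd (fun t => t));
  change (d1 (fun s t => px c s t) th z) with (d1 (px c) th z);
  change (d1 (fun s t => py c s t) th z) with (d1 (py c) th z);
  rewrite V1, V2; unfold wM; ring.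
Qed.

Lemma form_N th z : good th z ->
  m_ th z * fN e1 e2 g c th z = wN e1 e2 g c th z.
Proof.
  intros H; pose proof (normal_d2 th z (good_U _ _ H)) as O.
  unfold fN; rewrite Ropp_mult_distr_r_reverse, dot_vd2_nu; [|exact H|];
  unfold vd2, b, vx, vy, vz; simpl; rewrite d2_id;
  change (d2 (fun s t => px c s t) th z) with (d2 (px c) th z);
  change (d2 (fun s t => py c s t) th z) with (d2 (py c) th z);
  [unfold wN; ring|lra].
Qed.

(** Lagrange's identity for the first fundamental form. *)
Lemma gram th z : good th z ->
  wE e1 e2 g c th z * wG c th z - wF e1 e2 g c th z ^ 2 = m_ th z ^ 2.
Proof.
  intros H; rewrite nlen_sq by exact H; pose proof (normal_d2 th z (good_U _ _ H)) as O.
  unfold wE, wG, wF; replace (n3 th z) with (- (n1 th z * d2 (px c) th z + n2 th z * d2 (py c) th z)) by lra.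
  pose proof s0_sq as K; ring [K].
Qed.

Lemma rho_neq0 th z : good th z -> z <> 0 -> lam e1 e2 th <> 0 -> r_ th z <> 0.
Proof.
  intros H Hz Hl; unfold rho, wa; pose proof (good_qR _ _ H); pose proof (good_jac _ _ H).
  unfold Rdiv; repeat apply Rmult_integral_contrapositive_currified; try assumption;
    try (now apply pow_nonzero); try lra; now apply Rinv_neq_0_compat.
Qed.

(** The given quotients are determined where [rho] does not vanish. *)
Lemma quot_unique n f w th z : smooth2 U f -> smooth2 U w ->
  (forall s t, good s t -> r_ s t ^ n * f s t = r_ s t ^ n * w s t) ->
  good th z -> f th z = w th z.
Proof.
  intros Hf Hw E H; apply Rminus_diag_uniq.
  apply (dense_eq e1 e2 good (fun s t => f s t - w s t)); [exact HV| | |exact H].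
  - intros s t Hst; apply good_U in Hst.
    apply continuity_2d_pt_minus; apply (smooth2_cont U); assumption.
  - intros s t Hst Ht Hl; apply Rminus_diag_eq.
    apply Rmult_eq_reg_l with (r_ s t ^ n); [now apply E|].
    now apply pow_nonzero, rho_neq0.
Qed.

Lemma quot_E th z : good th z -> qE q th z = wE e1 e2 g c th z.
Proof.
  apply (quot_unique 2); [apply (quo_smooth _ _ _ _ _ Hq)|exact smooth_wE|].
  intros s t H; rewrite <- form_E, (quo_E _ _ _ _ _ Hq s t), af_wa by (try apply good_U; exact H).
  unfold rho; ring.
Qed.

Lemma quot_L th z : good th z -> qL q th z = wL e1 e2 g c th z.
Proof.
  apply (quot_unique 1); [apply (quo_smooth _ _ _ _ _ Hq)|exact smooth_wL|].
  intros s t H; rewrite pow_1, <- form_L, <- nlen_eq, (quo_L _ _ _ _ _ Hq s t), af_wa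
    by (try apply good_U; exact H).
  unfold rho; ring.
Qed.

Lemma quot_M th z : good th z -> qM q th z = wM e1 e2 g c th z.
Proof.
  apply (quot_unique 1); [apply (quo_smooth _ _ _ _ _ Hq)|exact smooth_wM|].
  intros s t H; rewrite pow_1, <- form_M, <- nlen_eq, (quo_M _ _ _ _ _ Hq s t), af_wa
    by (try apply good_U; exact H).
  unfold rho; ring.
Qed.

Lemma nutN_eq th z : good th z -> nutN e1 e2 g c th z = wN e1 e2 g c th z.
Proof.
  intros H; unfold nutN; rewrite nlen_eq by (now apply good_U); now apply form_N.
Qed.

(** * Taylor coefficients along the axis *)

(** The line [z = 0] is mapped to the origin, so there every function along the
    surface is constant, and [x], [y] vanish to second order by the triangular
    form of the linear parts. *)
Section Axis.
Variable th : R.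

Let Haxis : U th 0 := par_axis _ _ _ _ Hc th.

Lemma along_axis f : along c f th 0 = f 0 0 0.
Proof. unfold along; destruct (par_zero _ _ _ _ Hc th) as [-> ->]; reflexivity. Qed.

Lemma dcomp_axis D f w : dcomp g c D f w th 0 = D f 0 0 0.
Proof.
  unfold dcomp; rewrite !along_axis; destruct (nf_zero _ Hg) as [_ [_ ->]]; ring.
Qed.

Lemma ncomp_axis D : ncomp e1 e2 g c D th 0 = A th * D (gP g) 0 0 0 + B th * D (gQ g) 0 0 0.
Proof. unfold ncomp; now rewrite !dcomp_axis. Qed.

Lemma jac_axis : jac e1 e2 g c th 0 = D1 (gP g) 0 0 0 * D2 (gQ g) 0 0 0.
Proof. unfold jac; rewrite !dcomp_axis; destruct (nf_triangular _ Hg) as [-> _]; ring. Qed.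

Lemma d2_px_axis : d2 (px c) th 0 = 0 /\ d2 (py c) th 0 = 0.
Proof.
  destruct (implicit_d2 th 0 Haxis) as [E1 E2]; rewrite !dcomp_axis in E1, E2.
  destruct (nf_triangular _ Hg) as [T1 [T2 T3]], (nf_positive _ Hg) as [p1 [p2 p3]].
  rewrite T1, T2 in E1; rewrite T3 in E2.
  assert (Z : d2 (px c) th 0 = 0) by (apply Rmult_eq_reg_l with (D1 (gP g) 0 0 0); lra).
  split; [exact Z|]; rewrite Z in E2.
  apply Rmult_eq_reg_l with (D2 (gQ g) 0 0 0); lra.
Qed.

Lemma d2_along f s t : smooth3 W f -> U s t ->
  d2 (along c f) s t = along c (D1 f) s t * d2 (px c) s t + along c (D2 f) s t * d2 (py c) s t
                       + along c (D3 f) s t.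
Proof.
  intros Hf H; apply is_derive_unique.
  exact (is_d2_along U W (px c) (py c) HW Hx Hy Hdom f s t Hf H).
Qed.

Lemma d2_along_axis f : smooth3 W f -> d2 (along c f) th 0 = D3 f 0 0 0.
Proof.
  intros Hf; rewrite d2_along by assumption; destruct d2_px_axis as [-> ->].
  rewrite !along_axis; ring.
Qed.

Lemma d2_d2_along_axis f : smooth3 W f -> d2 (d2 (along c f)) th 0
  = D1 f 0 0 0 * d2 (d2 (px c)) th 0 + D2 f 0 0 0 * d2 (d2 (py c)) th 0 + D3 (D3 f) 0 0 0.
Proof.
  intros Hf; rewrite (d2_eq_on U HU _ _ _ _ (fun s t H => d2_along f s t Hf H) Haxis).
  pose proof (smooth_along _ (smooth3_D1 _ _ Hf)); pose proof (smooth_along _ (smooth3_D2 _ _ Hf)).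
  pose proof (smooth_along _ (smooth3_D3 _ _ Hf)).
  rewrite (d2_plus U), (d2_plus U), !(d2_mult U); try exact Haxis; smooth2_tac.
  destruct d2_px_axis as [-> ->].
  rewrite !along_axis, (d2_along_axis (D3 f)) by (now apply smooth3_D3); ring.
Qed.

Lemma qR_axis : qR q th 0 = D3 (gR g) 0 0 0.
Proof.
  rewrite <- (d2_along_axis _ smooth_R).
  assert (E : forall s t, U s t -> along c (gR g) s t = t * qR q s t) by exact (quo_R _ _ _ _ _ Hq).
  rewrite (d2_eq_on U HU _ _ _ _ E Haxis).
  rewrite (d2_mult U); [|exact (smooth2_snd U HU)|exact smooth_qR|exact Haxis].
  rewrite d2_id; ring.
Qed.

Lemma d2_dcomp D f (w : R -> R) s t : partial_op D -> smooth3 W f -> smooth2 U (fun s _ => w s) ->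
  U s t -> d2 (dcomp g c D f w) s t = d2 (along c (D f)) s t
    + 2 * ((d2 (along c (gR g)) s t * along c (D (gR g)) s t
            + along c (gR g) s t * d2 (along c (D (gR g))) s t) * w s).
Proof.
  intros HD Hf Hw H; unfold dcomp.
  pose proof (smooth_along _ smooth_R); pose proof (smooth_along _ (HD _ smooth_R)).
  pose proof (smooth_along _ (HD _ Hf)).
  rewrite (d2_plus U), (d2_mult U (fun _ _ => 2)), (d2_mult U _ (fun s _ => w s)), (d2_mult U);
    try exact H; smooth2_tac.
  rewrite (d2_fst (fun _ => 2)), (d2_fst w); ring.
Qed.

Lemma d2_dcomp_axis D f (w : R -> R) : partial_op D -> smooth3 W f -> smooth2 U (fun s _ => w s) ->
  d2 (dcomp g c D f w) th 0 = D3 (D f) 0 0 0 + 2 * (D3 (gR g) 0 0 0 * D (gR g) 0 0 0 * w th).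
Proof.
  intros HD Hf Hw; rewrite d2_dcomp by assumption.
  rewrite (d2_along_axis (D f) (HD _ Hf)), (d2_along_axis (gR g) smooth_R), !along_axis.
  destruct (nf_zero _ Hg) as [_ [_ ->]]; ring.
Qed.

Lemma d2_ncomp D s t : partial_op D -> U s t -> d2 (ncomp e1 e2 g c D) s t
  = A s * d2 (dcomp g c D (gP g) (alpha e1 e2)) s t + B s * d2 (dcomp g c D (gQ g) (beta e1 e2)) s t.
Proof.
  intros HD H; unfold ncomp; destruct (smooth2_fAB U HU e1 e2).
  pose proof (smooth_dcomp D _ _ HD smooth_P (smooth2_alpha U HU e1 e2)).
  pose proof (smooth_dcomp D _ _ HD smooth_Q (smooth2_beta U HU e1 e2)).
  rewrite (d2_plus U), !(d2_mult U (fun s _ => _ s)); try exact H; smooth2_tac.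
  rewrite (d2_fst A), (d2_fst B); ring.
Qed.

Lemma d2_ncomp_axis D : partial_op D -> d2 (ncomp e1 e2 g c D) th 0
  = A th * (D3 (D (gP g)) 0 0 0 + 2 * (D3 (gR g) 0 0 0 * D (gR g) 0 0 0 * alpha e1 e2 th))
  + B th * (D3 (D (gQ g)) 0 0 0 + 2 * (D3 (gR g) 0 0 0 * D (gR g) 0 0 0 * beta e1 e2 th)).
Proof.
  intros HD; rewrite d2_ncomp by assumption.
  rewrite !d2_dcomp_axis; try assumption; try exact smooth_P; try exact smooth_Q;
    first [apply smooth2_alpha|apply smooth2_beta|idtac]; try exact HU; reflexivity.
Qed.

Lemma d2_d2_px_axis :
  D1 (gP g) 0 0 0 * d2 (d2 (px c)) th 0
  = - (D3 (D3 (gP g)) 0 0 0 + 2 * (D3 (gR g) 0 0 0 * D3 (gR g) 0 0 0 * alpha e1 e2 th)) /\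
  D1 (gQ g) 0 0 0 * d2 (d2 (px c)) th 0 + D2 (gQ g) 0 0 0 * d2 (d2 (py c)) th 0
  = - (D3 (D3 (gQ g)) 0 0 0 + 2 * (D3 (gR g) 0 0 0 * D3 (gR g) 0 0 0 * beta e1 e2 th)).
Proof.
  assert (K : forall f w, smooth3 W f -> smooth2 U (fun s _ => w s) ->
    (forall s t, U s t -> dcomp g c D1 f w s t * d2 (px c) s t
       + dcomp g c D2 f w s t * d2 (py c) s t + dcomp g c D3 f w s t = 0) ->
    D1 f 0 0 0 * d2 (d2 (px c)) th 0 + D2 f 0 0 0 * d2 (d2 (py c)) th 0
    = - (D3 (D3 f) 0 0 0 + 2 * (D3 (gR g) 0 0 0 * D3 (gR g) 0 0 0 * w th))).
  { intros f w Hf Hw Z.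
    pose proof (d2_eq_on U HU _ (fun _ _ => 0) th 0 Z Haxis) as E.
    rewrite (d2_fst (fun _ => 0)) in E.
    pose proof (smooth_dcomp _ _ _ partial_D1 Hf Hw); pose proof (smooth_dcomp _ _ _ partial_D2 Hf Hw).
    pose proof (smooth_dcomp _ _ _ partial_D3 Hf Hw).
    rewrite (d2_plus U), (d2_plus U), !(d2_mult U) in E; try exact Haxis; smooth2_tac.
    destruct d2_px_axis as [Ex Ey]; rewrite Ex, Ey, !dcomp_axis in E.
    rewrite (d2_dcomp_axis D3 f w partial_D3 Hf Hw) in E; lra. }
  split.
  - rewrite <- (K _ _ smooth_P (smooth2_alpha U HU e1 e2)).
    + destruct (nf_triangular _ Hg) as [-> _]; ring.
    + intros s t H; exact (proj1 (implicit_d2 s t H)).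
  - rewrite <- (K _ _ smooth_Q (smooth2_beta U HU e1 e2)).
    + reflexivity.
    + intros s t H; exact (proj2 (implicit_d2 s t H)).
Qed.

Lemma d2_d2_dcomp3_axis f (w : R -> R) : smooth3 W f -> smooth2 U (fun s _ => w s) ->
  d2 (d2 (dcomp g c D3 f w)) th 0
  = D1 (D3 f) 0 0 0 * d2 (d2 (px c)) th 0 + D2 (D3 f) 0 0 0 * d2 (d2 (py c)) th 0
    + D3 (D3 (D3 f)) 0 0 0
    + 2 * (((D1 (gR g) 0 0 0 * d2 (d2 (px c)) th 0 + D2 (gR g) 0 0 0 * d2 (d2 (py c)) th 0
             + D3 (D3 (gR g)) 0 0 0) * D3 (gR g) 0 0 0
            + 2 * (D3 (gR g) 0 0 0 * D3 (D3 (gR g)) 0 0 0)) * w th).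
Proof.
  intros Hf Hw.
  rewrite (d2_eq_on U HU _ _ _ _ (fun s t H => d2_dcomp D3 f w s t partial_D3 Hf Hw H) Haxis).
  pose proof (smooth_along _ smooth_R); pose proof (smooth_along _ (smooth3_D3 _ _ smooth_R)).
  pose proof (smooth_along _ (smooth3_D3 _ _ Hf)).
  rewrite (d2_plus U), (d2_mult U (fun _ _ => 2)), (d2_mult U _ (fun s _ => w s)), (d2_plus U), !(d2_mult U);
    try exact Haxis; smooth2_tac.
  rewrite (d2_fst (fun _ => 2)), (d2_fst w).
  rewrite !d2_d2_along_axis, !d2_along_axis, !along_axis;
    try (repeat apply smooth3_D3; first [assumption|exact smooth_R]).
  destruct (nf_zero _ Hg) as [_ [_ ->]]; ring.
Qed.

Lemma d2_d2_ncomp3_axis : d2 (d2 n3) th 0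
  = A th * d2 (d2 X3) th 0
  + B th * d2 (d2 Y3) th 0.
Proof.
  rewrite (d2_eq_on U HU _ _ _ _ (fun s t H => d2_ncomp D3 s t partial_D3 H) Haxis).
  destruct (smooth2_fAB U HU e1 e2).
  pose proof (smooth_dcomp _ _ _ partial_D3 smooth_P (smooth2_alpha U HU e1 e2)).
  pose proof (smooth_dcomp _ _ _ partial_D3 smooth_Q (smooth2_beta U HU e1 e2)).
  rewrite (d2_plus U), !(d2_mult U (fun s _ => _ s)); try exact Haxis; smooth2_tac.
  rewrite (d2_fst A), (d2_fst B); ring.
Qed.

Lemma d1_ncomp_axis D : d1 (ncomp e1 e2 g c D) th 0
  = - sgn e1 * B th * D (gP g) 0 0 0 - A th * D (gQ g) 0 0 0.
Proof.
  unfold d1; rewrite (Derive_ext _ (fun s => D (gP g) 0 0 0 * A s + D (gQ g) 0 0 0 * B s)).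
  - apply is_derive_unique.
    replace (_ - _) with (D (gP g) 0 0 0 * (- sgn e1 * B th) + D (gQ g) 0 0 0 * (- A th)) by ring.
    apply (is_derive_plus (fun s => D (gP g) 0 0 0 * A s) (fun s => D (gQ g) 0 0 0 * B s)).
    + apply (is_derive_scal A), is_derive_fA.
    + apply (is_derive_scal B), is_derive_fB.
  - intros s; unfold ncomp, dcomp, along; destruct (par_zero _ _ _ _ Hc s) as [-> ->].
    destruct (nf_zero _ Hg) as [_ [_ ->]]; ring.
Qed.

End Axis.

End Surface.

(** * The coefficient functions as binary forms *)

(** Below, [conicf] takes the constant value [eta] along the curve [(A, B)] and
    [eta ^ 2 = 1], so terms of lower degree are multiplied by powers of [conicf] until
    all terms have the same degree. [cubicf] comes from
    [A * alpha + B * beta = eta * cubicf], which lowers the degree from five to three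
    and is the reason for the small final degrees. The functions ending in [f] are,
    up to factors independent of [theta], the coefficients after which they are named; a leading [d] stands for the derivative in [theta]. *)
Section Forms.
Variables (e1 : pm) (g : germs).

Notation e := (sgn e1).
Notation P_ D := (D (gP g) 0 0 0).
Notation Q_ D := (D (gQ g) 0 0 0).
Notation R_ D := (D (gR g) 0 0 0).

Definition conicf (a b : R) : R := a ^ 2 - e * b ^ 2.
Definition cubicf (a b : R) : R := - / 2 * (a * (a ^ 2 + 3 * e * b ^ 2)).
Definition n0f (D : (R -> R -> R -> R) -> R -> R -> R -> R) (a b : R) : R := a * P_ D + b * Q_ D.
Definition dn0f (D : (R -> R -> R -> R) -> R -> R -> R -> R) (a b : R) : R := - e * b * P_ D - a * Q_ D.
Definition nzf (D : (R -> R -> R -> R) -> R -> R -> R -> R) (a b : R) : R :=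
  (a * D3 (D (gP g)) 0 0 0 + b * D3 (D (gQ g)) 0 0 0) * conicf a b
  + 2 * (R_ D3 * R_ D) * cubicf a b.
Definition dnzf (D : (R -> R -> R -> R) -> R -> R -> R -> R) (a b : R) : R :=
  (- e * b * D3 (D (gP g)) 0 0 0 - a * D3 (D (gQ g)) 0 0 0) * conicf a b
  + 2 * (R_ D3 * R_ D) * (3 / 2 * (b * (3 * e * a ^ 2 + b ^ 2))).
Definition xzzf (a b : R) : R :=
  - / P_ D1 * (D3 (D3 (gP g)) 0 0 0 * conicf a b ^ 2 + 2 * (R_ D3 * R_ D3) * alphaf e1 a b).
Definition yzzf (a b : R) : R :=
  - / Q_ D2 * (D3 (D3 (gQ g)) 0 0 0 * conicf a b ^ 2 + 2 * (R_ D3 * R_ D3) * betaf e1 a b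
               + Q_ D1 * xzzf a b).
Definition zz3f (f : R -> R -> R -> R) (a b : R) : R :=
  D1 (D3 f) 0 0 0 * xzzf a b + D2 (D3 f) 0 0 0 * yzzf a b + D3 (D3 (D3 f)) 0 0 0 * conicf a b ^ 2.
Definition Rzzf (a b : R) : R :=
  (R_ D1 * xzzf a b + R_ D2 * yzzf a b + D3 (D3 (gR g)) 0 0 0 * conicf a b ^ 2) * R_ D3
  + 2 * (R_ D3 * D3 (D3 (gR g)) 0 0 0) * conicf a b ^ 2.
Definition n3zzf (a b : R) : R :=
  (a * zz3f (gP g) a b + b * zz3f (gQ g) a b) * conicf a b + 2 * (Rzzf a b * cubicf a b).
Definition E0f (a b : R) : R := n0f D1 a b ^ 2 + n0f D2 a b ^ 2.
Definition dE0f (a b : R) : R := 2 * (n0f D1 a b * dn0f D1 a b + n0f D2 a b * dn0f D2 a b).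
Definition E1f (a b : R) : R := 2 * (n0f D1 a b * nzf D1 a b + n0f D2 a b * nzf D2 a b).
Definition M0f (a b : R) : R := n0f D2 a b * nzf D1 a b - n0f D1 a b * nzf D2 a b.
Definition N1f (a b : R) : R := xzzf a b * nzf D1 a b + yzzf a b * nzf D2 a b + n3zzf a b.

Definition C1f (a b : R) : R :=
  -6 * (b * (3 * e * a ^ 2 + b ^ 2)) * E0f a b + 3 * lamf e1 a b * dE0f a b.
Definition C2f (a b : R) : R :=
  - (P_ D1 * Q_ D2) * (conicf a b * (E1f a b * nzf D3 a b))
  + dE0f a b * (M0f a b * nzf D3 a b)
  + 2 * (E0f a b * (P_ D1 * Q_ D2 * N1f a b - M0f a b * dnzf D3 a b)).
Definition C3f (a b : R) : R := 2 * (E0f a b * dnzf D3 a b) - dE0f a b * nzf D3 a b.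

Lemma form_mono i j : form (i + j) (fun a b => a ^ i * b ^ j).
Proof.
  apply form_mult.
  - pose proof (form_pow 1 _ i form_a) as X; now rewrite Nat.mul_1_r in X.
  - pose proof (form_pow 1 _ j form_b) as X; now rewrite Nat.mul_1_r in X.
Qed.

Lemma form_conicf : form 2 conicf.
Proof.
  apply form_ext with (2 := form_plus 2 _ _ (form_mono 2 0) (form_scal 2 _ (- e) (form_mono 0 2))).
  intros a b; unfold conicf; ring.
Qed.

Lemma form_lamf : form 3 (lamf e1).
Proof.
  apply form_ext with (2 := form_plus 3 _ _ (form_mono 3 0) (form_scal 3 _ (3 * e) (form_mono 1 2))).
  intros a b; unfold lamf; ring.
Qed.

Lemma form_cubicf : form 3 cubicf.
Proof. exact (form_scal 3 _ _ form_lamf). Qed.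

Lemma form_dcubic : form 3 (fun a b => b * (3 * e * a ^ 2 + b ^ 2)).
Proof.
  apply form_ext with (2 := form_plus 3 _ _ (form_scal 3 _ (3 * e) (form_mono 2 1)) (form_mono 0 3)).
  intros a b; ring.
Qed.

Lemma form_linear k l : form 1 (fun a b => a * k + b * l).
Proof.
  apply form_ext with (2 := form_plus 1 _ _ (form_scal 1 _ k form_a) (form_scal 1 _ l form_b)).
  intros a b; ring.
Qed.

Lemma form_n0f D : form 1 (n0f D). Proof. apply form_linear. Qed.

Lemma form_dn0f D : form 1 (dn0f D).
Proof.
  apply form_ext with (2 := form_linear (- Q_ D) (- e * P_ D)); intros a b; unfold dn0f; ring.
Qed.

Lemma form_nzf D : form 3 (nzf D).
Proof.
  apply form_plus; [exact (form_mult 1 2 _ _ (form_linear _ _) form_conicf)|].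
  apply form_scal, form_cubicf.
Qed.

Lemma form_dnzf D : form 3 (dnzf D).
Proof.
  apply form_plus.
  - apply (form_mult 1 2); [|exact form_conicf].
    apply form_ext with (2 := form_linear (- D3 (D (gQ g)) 0 0 0) (- e * D3 (D (gP g)) 0 0 0)).
    intros a b; ring.
  - apply form_scal, form_scal, form_dcubic.
Qed.

Lemma form_conicf2 k : form 4 (fun a b => k * conicf a b ^ 2).
Proof. apply form_scal; exact (form_pow 2 _ 2 form_conicf). Qed.

Lemma form_alphaf : form 4 (alphaf e1).
Proof.
  apply form_ext with (2 := form_plus 4 _ _ (form_plus 4 _ _ (form_scal 4 _ (- / 2) (form_mono 4 0))
    (form_scal 4 _ (3 * e) (form_mono 2 2))) (form_scal 4 _ (3 / 2) (form_mono 0 4))).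
  intros a b; unfold alphaf; ring.
Qed.

Lemma form_betaf : form 4 (betaf e1).
Proof.
  apply form_ext with (2 := form_scal 4 _ (- (4 * e)) (form_mono 3 1)).
  intros a b; unfold betaf; ring.
Qed.

Lemma form_xzzf : form 4 xzzf.
Proof.
  apply form_scal, form_plus; [apply form_conicf2|apply form_scal, form_alphaf].
Qed.

Lemma form_yzzf : form 4 yzzf.
Proof.
  apply form_scal, form_plus; [apply form_plus|].
  - apply form_conicf2.
  - apply form_scal, form_betaf.
  - apply form_scal, form_xzzf.
Qed.

Lemma form_zz k l m : form 4 (fun a b => k * xzzf a b + l * yzzf a b + m * conicf a b ^ 2).
Proof.
  apply form_plus; [apply form_plus|apply form_conicf2]; apply form_scal;
    [apply form_xzzf|apply form_yzzf].
Qed.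

Lemma form_n3zzf : form 7 n3zzf.
Proof.
  apply form_plus.
  - apply (form_mult 5 2); [apply form_plus|exact form_conicf].
    + exact (form_mult 1 4 _ _ form_a (form_zz _ _ _)).
    + exact (form_mult 1 4 _ _ form_b (form_zz _ _ _)).
  - apply form_scal, (form_mult 4 3); [|exact form_cubicf].
    apply form_plus; [|apply form_conicf2].
    apply form_ext with (2 := form_scal 4 _ (R_ D3) (form_zz (R_ D1) (R_ D2) (D3 (D3 (gR g)) 0 0 0))).
    intros a b; ring.
Qed.

Lemma form_E0f : form 2 E0f.
Proof. apply form_plus; exact (form_pow 1 _ 2 (form_n0f _)). Qed.

Lemma form_dE0f : form 2 dE0f.
Proof.
  apply form_scal, form_plus; exact (form_mult 1 1 _ _ (form_n0f _) (form_dn0f _)).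
Qed.

Lemma form_E1f : form 4 E1f.
Proof. apply form_scal, form_plus; exact (form_mult 1 3 _ _ (form_n0f _) (form_nzf _)). Qed.

Lemma form_M0f : form 4 M0f.
Proof. apply form_minus; exact (form_mult 1 3 _ _ (form_n0f _) (form_nzf _)). Qed.

Lemma form_N1f : form 7 N1f.
Proof.
  apply form_plus; [apply form_plus|exact form_n3zzf].
  - exact (form_mult 4 3 _ _ form_xzzf (form_nzf _)).
  - exact (form_mult 4 3 _ _ form_yzzf (form_nzf _)).
Qed.

Lemma form_C1f : form 5 C1f.
Proof.
  apply form_plus.
  - exact (form_mult 3 2 _ _ (form_scal 3 _ (-6) form_dcubic) form_E0f).
  - exact (form_mult 3 2 _ _ (form_scal 3 _ 3 form_lamf) form_dE0f).
Qed.

Lemma form_C2f : form 9 C2f.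
Proof.
  apply form_plus; [apply form_plus|].
  - apply form_scal, (form_mult 2 7); [exact form_conicf|].
    exact (form_mult 4 3 _ _ form_E1f (form_nzf _)).
  - apply (form_mult 2 7); [exact form_dE0f|].
    exact (form_mult 4 3 _ _ form_M0f (form_nzf _)).
  - apply form_scal, (form_mult 2 7); [exact form_E0f|apply form_minus].
    + apply form_scal, form_N1f.
    + exact (form_mult 4 3 _ _ form_M0f (form_dnzf _)).
Qed.

Lemma form_C3f : form 5 C3f.
Proof.
  apply form_minus; [apply form_scal|].
  - exact (form_mult 2 3 _ _ form_E0f (form_dnzf _)).
  - exact (form_mult 2 3 _ _ form_dE0f (form_nzf _)).
Qed.

End Forms.

Section Coefficients.
Variables (e1 e2 : pm) (g : germs) (c : param) (q : quotients).
Hypotheses (Hg : normal_form g) (Hc : is_param e1 e2 g c) (Hq : is_quotients e1 e2 g c q).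

Notation A := (fA e1 e2).
Notation B := (fB e1 e2).
Notation et := (eta e1 e2).
Notation s0 := (sg0 e1 e2).

Lemma conicf_AB th : conicf e1 (A th) (B th) = et.
Proof. apply fA_conic. Qed.

(** The degree drops because the two factors of [A * alpha + B * beta] that are left
    after division by the conic equation are [A] and [A^2 + 3 e1 B^2]. *)
Lemma alpha_beta_AB th : A th * alpha e1 e2 th + B th * beta e1 e2 th = et * cubicf e1 (A th) (B th).
Proof.
  rewrite alpha_form, beta_form, <- (conicf_AB th); unfold alphaf, betaf, cubicf, conicf.
  pose proof (sgn_sq e1) as H; field [H].
Qed.

Lemma ncomp0_axis D th : ncomp e1 e2 g c D th 0 = n0f g D (A th) (B th).
Proof. now rewrite (ncomp_axis e1 e2 g c Hg Hc). Qed.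

Lemma wE_axis th : wE e1 e2 g c th 0 = E0f g (A th) (B th).
Proof. unfold wE; now rewrite !ncomp0_axis. Qed.

Lemma E0f_pos th : 0 < E0f g (A th) (B th).
Proof.
  destruct (nf_triangular _ Hg) as [T1 _], (nf_positive _ Hg) as [p1 [p2 _]].
  unfold E0f, n0f; rewrite T1.
  set (u := A th * D1 (gP g) 0 0 0 + B th * D1 (gQ g) 0 0 0).
  set (v := A th * 0 + B th * D2 (gQ g) 0 0 0).
  assert (N : u <> 0 \/ v <> 0).
  { destruct (Req_dec (B th) 0) as [Hb|Hb]; [left|right].
    - destruct (fAB_nonzero e1 e2 th) as [Ha|Ha]; [|contradiction].
      unfold u; rewrite Hb, Rmult_0_l, Rplus_0_r; apply Rmult_integral_contrapositive; split; lra.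
    - unfold v; rewrite Rmult_0_r, Rplus_0_l; apply Rmult_integral_contrapositive; split; lra. }
  pose proof (pow2_ge_0 u); pose proof (pow2_ge_0 v).
  destruct N as [N|N]; pose proof (pow2_gt_0 _ N); lra.
Qed.

Lemma good_axis th : good e1 e2 g c q th 0.
Proof.
  destruct (nf_positive _ Hg) as [p1 [p2 p3]].
  split; [split|].
  - apply (par_axis _ _ _ _ Hc).
  - rewrite (qR_axis e1 e2 g c q Hg Hc Hq); lra.
  - rewrite (jac_axis e1 e2 g c Hg Hc), wE_axis; pose proof (E0f_pos th).
    apply Rmult_integral_contrapositive; split; [|lra].
    apply Rmult_integral_contrapositive; split; lra.
Qed.

Lemma nz_axis D th : partial_op g D -> d2 (ncomp e1 e2 g c D) th 0 = et * nzf e1 g D (A th) (B th).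
Proof.
  intros HD; rewrite (d2_ncomp_axis e1 e2 g c Hg Hc) by exact HD.
  unfold nzf; rewrite conicf_AB; pose proof (eta_sq e1 e2) as E.
  replace (et * _) with (et * et * (A th * D3 (D (gP g)) 0 0 0 + B th * D3 (D (gQ g)) 0 0 0)
    + 2 * (D3 (gR g) 0 0 0 * D (gR g) 0 0 0) * (et * cubicf e1 (A th) (B th))) by ring.
  rewrite <- alpha_beta_AB, E; ring.
Qed.

Lemma xzz_axis th : d2 (d2 (px c)) th 0 = xzzf e1 g (A th) (B th) /\
  d2 (d2 (py c)) th 0 = yzzf e1 g (A th) (B th).
Proof.
  destruct (d2_d2_px_axis e1 e2 g c Hg Hc th) as [X1 X2].
  destruct (nf_positive _ Hg) as [p1 [p2 _]]; pose proof (eta_sq e1 e2) as E.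
  assert (F : d2 (d2 (px c)) th 0 = xzzf e1 g (A th) (B th)).
  { apply Rmult_eq_reg_l with (D1 (gP g) 0 0 0); [|lra].
    rewrite X1; unfold xzzf; rewrite conicf_AB, alpha_form; simpl; rewrite Rmult_1_r, E; field; lra. }
  split; [exact F|].
  rewrite F in X2; apply Rmult_eq_reg_l with (D2 (gQ g) 0 0 0); [|lra].
  unfold yzzf; rewrite conicf_AB, <- beta_form; simpl; rewrite Rmult_1_r, E.
  match goal with |- _ = ?r => replace r with (- (D3 (D3 (gQ g)) 0 0 0 +
     2 * (D3 (gR g) 0 0 0 * D3 (gR g) 0 0 0 * beta e1 e2 th))
     - D1 (gQ g) 0 0 0 * xzzf e1 g (A th) (B th)) by (field; lra) end.
  lra.
Qed.

Lemma n3zz_axis th : d2 (d2 (ncomp e1 e2 g c D3)) th 0 = et * n3zzf e1 g (A th) (B th).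
Proof.
  rewrite (d2_d2_ncomp3_axis e1 e2 g c Hg Hc).
  rewrite !(d2_d2_dcomp3_axis e1 e2 g c Hg Hc);
    try (apply smooth2_alpha, (openU e1 e2 g c Hc)); try (apply smooth2_beta, (openU e1 e2 g c Hc));
    try apply (smooth_P g Hg); try apply (smooth_Q g Hg).
  destruct (xzz_axis th) as [-> ->].
  unfold n3zzf, zz3f, Rzzf; rewrite conicf_AB; pose proof (eta_sq e1 e2) as E.
  replace (et ^ 2) with 1 by (rewrite <- E; ring).
  set (X := xzzf e1 g (A th) (B th)); set (Y := yzzf e1 g (A th) (B th)).
  match goal with |- _ = ?r => replace r with
    (et * et * (A th * (D1 (D3 (gP g)) 0 0 0 * X + D2 (D3 (gP g)) 0 0 0 * Y + D3 (D3 (D3 (gP g))) 0 0 0)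
              + B th * (D1 (D3 (gQ g)) 0 0 0 * X + D2 (D3 (gQ g)) 0 0 0 * Y + D3 (D3 (D3 (gQ g))) 0 0 0))
     + 2 * ((D1 (gR g) 0 0 0 * X + D2 (gR g) 0 0 0 * Y + D3 (D3 (gR g)) 0 0 0) * D3 (gR g) 0 0 0
            + 2 * (D3 (gR g) 0 0 0 * D3 (D3 (gR g)) 0 0 0)) * (et * cubicf e1 (A th) (B th))) by ring end.
  rewrite <- alpha_beta_AB, E; ring.
Qed.

Let Haxis th : pU c th 0 := par_axis _ _ _ _ Hc th.
Let HU := openU e1 e2 g c Hc.
Let HV := open_good e1 e2 g c q Hg Hc Hq.

Lemma d2_wE_axis th : d2 (wE e1 e2 g c) th 0 = et * E1f e1 g (A th) (B th).
Proof.
  pose proof (smooth_ncomp e1 e2 g c Hg Hc D1 (partial_D1 g)) as S1.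
  pose proof (smooth_ncomp e1 e2 g c Hg Hc D2 (partial_D2 g)) as S2.
  assert (E : forall s t, pU c s t -> wE e1 e2 g c s t
    = ncomp e1 e2 g c D1 s t * ncomp e1 e2 g c D1 s t
      + ncomp e1 e2 g c D2 s t * ncomp e1 e2 g c D2 s t) by (intros; unfold wE; ring).
  rewrite (d2_eq_on (pU c) HU _ _ th 0 E (Haxis th)).
  rewrite (d2_plus (pU c)), !(d2_mult (pU c)); try apply Haxis; smooth2_tac.
  rewrite !nz_axis, !ncomp0_axis by (apply partial_D1 || apply partial_D2).
  unfold E1f; ring.
Qed.

Lemma wL_axis th : wL e1 e2 g c th 0 = - (s0 * et * (D1 (gP g) 0 0 0 * D2 (gQ g) 0 0 0)).
Proof.
  unfold wL; rewrite !ncomp0_axis, !(d1_ncomp_axis e1 e2 g c Hg Hc), <- (conicf_AB th).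
  destruct (nf_triangular _ Hg) as [T1 _]; unfold n0f, conicf; rewrite T1; ring.
Qed.

Lemma wM_axis th : wM e1 e2 g c th 0 = - (s0 * et * M0f e1 g (A th) (B th)).
Proof.
  unfold wM; rewrite !ncomp0_axis, !nz_axis by (apply partial_D1 || apply partial_D2).
  unfold M0f; ring.
Qed.

Lemma wN_axis th : wN e1 e2 g c th 0 = - (et * nzf e1 g D3 (A th) (B th)).
Proof.
  unfold wN; destruct (d2_px_axis e1 e2 g c Hg Hc th) as [-> ->].
  rewrite (nz_axis D3) by apply partial_D3; ring.
Qed.

Lemma d2_wN_axis th : d2 (wN e1 e2 g c) th 0 = - (et * N1f e1 g (A th) (B th)).
Proof.
  pose proof (smooth_ncomp e1 e2 g c Hg Hc D1 (partial_D1 g)) as S1.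
  pose proof (smooth_ncomp e1 e2 g c Hg Hc D2 (partial_D2 g)) as S2.
  pose proof (smooth_ncomp e1 e2 g c Hg Hc D3 (partial_D3 g)) as S3.
  pose proof (smooth_px e1 e2 g c Hc) as Sx; pose proof (smooth_py e1 e2 g c Hc) as Sy.
  unfold wN.
  rewrite (d2_opp (pU c)), (d2_plus (pU c)), (d2_plus (pU c)), !(d2_mult (pU c));
    try apply Haxis; smooth2_tac.
  destruct (d2_px_axis e1 e2 g c Hg Hc th) as [-> ->], (xzz_axis th) as [-> ->].
  rewrite n3zz_axis, !nz_axis by (apply partial_D1 || apply partial_D2).
  unfold N1f; ring.
Qed.

Lemma is_derive_E0f th : is_derive (fun s => E0f g (A s) (B s)) th (dE0f e1 g (A th) (B th)).
Proof.
  unfold E0f, n0f; auto_derive.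
  - assert (Ea : ex_derive A th) by (eexists; apply is_derive_fA).
    assert (Eb : ex_derive B th) by (eexists; apply is_derive_fB).
    repeat split; assumption.
  - change (Derive (fun x => A x) th) with (Derive A th).
    change (Derive (fun x => B x) th) with (Derive B th).
    rewrite (is_derive_unique _ _ _ (is_derive_fA e1 e2 th)), (is_derive_unique _ _ _ (is_derive_fB e1 e2 th)).
    unfold dE0f, dn0f, n0f; ring.
Qed.

Lemma is_derive_nzf D th : is_derive (fun s => nzf e1 g D (A s) (B s)) th (dnzf e1 g D (A th) (B th)).
Proof.
  unfold nzf, cubicf, conicf; auto_derive.
  - assert (Ea : ex_derive A th) by (eexists; apply is_derive_fA).
    assert (Eb : ex_derive B th) by (eexists; apply is_derive_fB).
    repeat split; assumption.
  - change (Derive (fun x => A x) th) with (Derive A th).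
    change (Derive (fun x => B x) th) with (Derive B th).
    rewrite (is_derive_unique _ _ _ (is_derive_fA e1 e2 th)), (is_derive_unique _ _ _ (is_derive_fB e1 e2 th)).
    unfold dnzf, conicf; pose proof (sgn_sq e1) as H; field [H].
Qed.

Lemma E0_eq th : E0 q th = E0f g (A th) (B th).
Proof. unfold E0; rewrite (quot_E e1 e2 g c q Hg Hc Hq) by apply good_axis; apply wE_axis. Qed.

Lemma N0_eq th : N0 e1 e2 g c th = - (et * nzf e1 g D3 (A th) (B th)).
Proof. unfold N0; rewrite (nutN_eq e1 e2 g c q Hg Hc Hq) by apply good_axis; apply wN_axis. Qed.

Lemma Derive_E0 th : Derive (E0 q) th = dE0f e1 g (A th) (B th).
Proof.
  rewrite (Derive_ext _ (fun s => E0f g (A s) (B s))) by apply E0_eq.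
  apply is_derive_unique, is_derive_E0f.
Qed.

Lemma Derive_N0 th : Derive (N0 e1 e2 g c) th = - (et * dnzf e1 g D3 (A th) (B th)).
Proof.
  rewrite (Derive_ext _ (fun s => - et * nzf e1 g D3 (A s) (B s))) by (intros; rewrite N0_eq; ring).
  apply is_derive_unique.
  replace (- (et * dnzf e1 g D3 (A th) (B th))) with (- et * dnzf e1 g D3 (A th) (B th)) by ring.
  apply (is_derive_scal (fun s => nzf e1 g D3 (A s) (B s))), is_derive_nzf.
Qed.

Lemma wa_axis th : wa e1 e2 g c q th 0 = 4 * D3 (gR g) 0 0 0 ^ 2 / (D1 (gP g) 0 0 0 * D2 (gQ g) 0 0 0).
Proof. unfold wa; now rewrite (qR_axis e1 e2 g c q Hg Hc Hq), (jac_axis e1 e2 g c Hg Hc). Qed.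

Lemma C1_form th : C1 e1 e2 g c q th
  = tau e1 e2 * (4 * D3 (gR g) 0 0 0 ^ 2 / (D1 (gP g) 0 0 0 * D2 (gQ g) 0 0 0)) * C1f e1 g (A th) (B th).
Proof.
  unfold C1.
  assert (Ea : forall s, af e1 e2 g c q s 0
     = 4 * D3 (gR g) 0 0 0 ^ 2 / (D1 (gP g) 0 0 0 * D2 (gQ g) 0 0 0)).
  { intros s; rewrite (af_wa e1 e2 g c q Hg Hc) by apply Haxis; apply wa_axis. }
  rewrite (Derive_ext _ _ th Ea), Derive_const, Ea, Derive_E0, E0_eq.
  rewrite (is_derive_unique _ _ _ (is_derive_lam e1 e2 th)), lam_form.
  unfold C1f, dlam; ring.
Qed.

Lemma C2_form th : C2 e1 e2 g c q th = s0 * C2f e1 g (A th) (B th).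
Proof.
  unfold C2, E1, N1, L0, M0.
  rewrite Derive_E0, Derive_N0, E0_eq, N0_eq.
  rewrite (quot_L e1 e2 g c q Hg Hc Hq), (quot_M e1 e2 g c q Hg Hc Hq), wL_axis, wM_axis by apply good_axis.
  rewrite (d2_eq_on _ HV _ _ _ _ (quot_E e1 e2 g c q Hg Hc Hq) (good_axis th)).
  rewrite (d2_eq_on _ HV _ _ _ _ (nutN_eq e1 e2 g c q Hg Hc Hq) (good_axis th)).
  rewrite d2_wE_axis, d2_wN_axis; unfold C2f; rewrite conicf_AB.
  pose proof (eta_sq e1 e2) as E; ring [E].
Qed.

Lemma C3_form th : C3 e1 e2 g c q th = - et * C3f e1 g (A th) (B th).
Proof. unfold C3; rewrite Derive_E0, Derive_N0, E0_eq, N0_eq; unfold C3f; ring. Qed.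

End Coefficients.

(** * Pairs of symmetric 2x2 matrices *)

(** The two principal curvatures and directions are the generalized eigenpairs
    of the second fundamental form with respect to the first. *)
Section Pencil.
Variables E F G L M N : R.

Definition eigen (k a b : R) : Prop :=
  (L - k * E) * a + (M - k * F) * b = 0 /\ (M - k * F) * a + (N - k * G) * b = 0.

Lemma eigen_trace k1 k2 a1 b1 a2 b2 : eigen k1 a1 b1 -> eigen k2 a2 b2 ->
  a1 * b2 - b1 * a2 <> 0 ->
  E * N - 2 * F * M + G * L = (k1 + k2) * (E * G - F ^ 2).
Proof.
  intros [R11 R12] [R21 R22] HD.
  apply Rmult_eq_reg_l with (a1 * b2 - b1 * a2); [|exact HD].
  assert (EL : (a1 * b2 - b1 * a2) * L = b2 * (k1 * (E * a1 + F * b1)) - b1 * (k2 * (E * a2 + F * b2)))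
    by (apply Rminus_diag_uniq; transitivity (b2 * ((L - k1 * E) * a1 + (M - k1 * F) * b1) - b1 * ((L - k2 * E) * a2 + (M - k2 * F) * b2));
        [ring|rewrite R11, R21; ring]).
  assert (EM : (a1 * b2 - b1 * a2) * M = a1 * (k2 * (E * a2 + F * b2)) - a2 * (k1 * (E * a1 + F * b1)))
    by (apply Rminus_diag_uniq; transitivity (a1 * ((L - k2 * E) * a2 + (M - k2 * F) * b2) - a2 * ((L - k1 * E) * a1 + (M - k1 * F) * b1));
        [ring|rewrite R21, R11; ring]).
  assert (EM' : (a1 * b2 - b1 * a2) * M = b2 * (k1 * (F * a1 + G * b1)) - b1 * (k2 * (F * a2 + G * b2)))
    by (apply Rminus_diag_uniq; transitivity (b2 * ((M - k1 * F) * a1 + (N - k1 * G) * b1) - b1 * ((M - k2 * F) * a2 + (N - k2 * G) * b2));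
        [ring|rewrite R12, R22; ring]).
  assert (EN : (a1 * b2 - b1 * a2) * N = a1 * (k2 * (F * a2 + G * b2)) - a2 * (k1 * (F * a1 + G * b1)))
    by (apply Rminus_diag_uniq; transitivity (a1 * ((M - k2 * F) * a2 + (N - k2 * G) * b2) - a2 * ((M - k1 * F) * a1 + (N - k1 * G) * b1));
        [ring|rewrite R22, R12; ring]).
  replace (_ * (E * N - 2 * F * M + G * L)) with
    (E * ((a1 * b2 - b1 * a2) * N) - F * ((a1 * b2 - b1 * a2) * M) - F * ((a1 * b2 - b1 * a2) * M)
     + G * ((a1 * b2 - b1 * a2) * L)) by ring.
  rewrite EN, EL; rewrite EM at 1; rewrite EM'; ring.
Qed.

Lemma eigen_orthogonal k1 k2 a1 b1 a2 b2 : eigen k1 a1 b1 -> eigen k2 a2 b2 -> k1 <> k2 ->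
  E * a1 * a2 + F * (a1 * b2 + b1 * a2) + G * b1 * b2 = 0.
Proof.
  intros [R11 R12] [R21 R22] Hk.
  apply Rmult_eq_reg_l with (k1 - k2); [|lra].
  match goal with |- ?l = _ => replace l with
    (a1 * ((L - k2 * E) * a2 + (M - k2 * F) * b2) + b1 * ((M - k2 * F) * a2 + (N - k2 * G) * b2)
     - (a2 * ((L - k1 * E) * a1 + (M - k1 * F) * b1) + b2 * ((M - k1 * F) * a1 + (N - k1 * G) * b1)))
    by ring end.
  rewrite R11, R12, R21, R22; ring.
Qed.

Lemma eigen_unique k1 k2 a1 b1 a2 b2 k a b : E * G - F ^ 2 <> 0 ->
  eigen k1 a1 b1 -> eigen k2 a2 b2 -> a1 * b2 - b1 * a2 <> 0 ->
  eigen k a b -> a <> 0 \/ b <> 0 -> k <> k1 -> k = k2 /\ a * b2 - b * a2 = 0.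
Proof.
  intros HG [R11 R12] [R21 R22] HD [R1 R2] Hv Hk.
  set (al := a * b2 - b * a2); set (be := a1 * b - b1 * a); set (D := a1 * b2 - b1 * a2) in *.
  set (u := al * (k1 - k) * a1 + be * (k2 - k) * a2).
  set (v := al * (k1 - k) * b1 + be * (k2 - k) * b2).
  assert (Z1 : E * u + F * v = 0).
  { transitivity (- al * ((L - k1 * E) * a1 + (M - k1 * F) * b1)
      - be * ((L - k2 * E) * a2 + (M - k2 * F) * b2) + D * ((L - k * E) * a + (M - k * F) * b)).
    - unfold u, v, al, be, D; ring.
    - rewrite R11, R21, R1; ring. }
  assert (Z2 : F * u + G * v = 0).
  { transitivity (- al * ((M - k1 * F) * a1 + (N - k1 * G) * b1)
      - be * ((M - k2 * F) * a2 + (N - k2 * G) * b2) + D * ((M - k * F) * a + (N - k * G) * b)).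
    - unfold u, v, al, be, D; ring.
    - rewrite R12, R22, R2; ring. }
  assert (Hu : u = 0).
  { apply Rmult_eq_reg_l with (E * G - F ^ 2); [|exact HG].
    replace (_ * u) with (G * (E * u + F * v) - F * (F * u + G * v)) by ring; rewrite Z1, Z2; ring. }
  assert (Hv0 : v = 0).
  { apply Rmult_eq_reg_l with (E * G - F ^ 2); [|exact HG].
    replace (_ * v) with (E * (F * u + G * v) - F * (E * u + F * v)) by ring; rewrite Z1, Z2; ring. }
  assert (Ea : al = 0).
  { apply Rmult_eq_reg_r with ((k1 - k) * D); [|apply Rmult_integral_contrapositive; split; [lra|exact HD]].
    replace (al * _) with (u * b2 - v * a2) by (unfold u, v, D; ring); rewrite Hu, Hv0; ring. }
  split; [|exact Ea].
  assert (Hb : be <> 0).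
  { intros Eb; destruct Hv as [Hv|Hv]; apply Hv; apply Rmult_eq_reg_l with D; try exact HD.
    - replace (D * a) with (al * a1 + be * a2) by (unfold al, be, D; ring); rewrite Ea, Eb; ring.
    - replace (D * b) with (al * b1 + be * b2) by (unfold al, be, D; ring); rewrite Ea, Eb; ring. }
  assert (K : be * D * (k2 - k) = 0).
  { transitivity (a1 * v - b1 * u); [unfold u, v, D; ring|rewrite Hu, Hv0; ring]. }
  apply Rmult_integral in K; destruct K as [K|K]; [|lra].
  apply Rmult_integral in K; tauto.
Qed.

End Pencil.

(** * Principal curvatures near the axis *)

Definition v1t (k : principal) (th z : R) : R := fst (V1 k th z).
Definition v1z (k : principal) (th z : R) : R := snd (V1 k th z).
Definition v2t (k : principal) (th z : R) : R := fst (V2 k th z).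
Definition v2z (k : principal) (th z : R) : R := snd (V2 k th z).

Section Principal.
Variables (e1 e2 : pm) (g : germs) (c : param) (q : quotients) (k : principal).
Hypotheses (Hg : normal_form g) (Hc : is_param e1 e2 g c) (Hq : is_quotients e1 e2 g c q)
  (Hk : is_principal e1 e2 g c k).

Notation U := (pU c).
Notation Good := (good e1 e2 g c q).
Notation lm := (lam e1 e2).
Notation E_ := (wE e1 e2 g c).
Notation F_ := (wF e1 e2 g c).
Notation G_ := (wG c).
Notation L_ := (wL e1 e2 g c).
Notation M_ := (wM e1 e2 g c).
Notation N_ := (wN e1 e2 g c).
Notation m_ := (nlen e1 e2 g c).
Notation a_ := (wa e1 e2 g c q).
Notation r_ := (rho e1 e2 g c q).

Let HU := openU e1 e2 g c Hc.
Let HV := open_good e1 e2 g c q Hg Hc Hq.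

(** The inner product of [d/dz] with the bounded direction is [vQ], and that of
    [d/dtheta] is [z ^ 2 * lam * vY]; hence orthogonality makes the unbounded direction
    proportional to [(vQ, - z ^ 2 * lam * vY)]. *)
Definition vQ (th z : R) : R := G_ th z * v2z k th z + r_ th z * F_ th z * v2t k th z.
Definition vY (th z : R) : R := a_ th z * (r_ th z * E_ th z * v2t k th z + F_ th z * v2z k th z).
(** [z ^ 2 * lam] times the sum of the principal curvatures, [kh] being the share
    of the unbounded one and [gap] its difference from that of the bounded one. *)
Definition meanH (th z : R) : R :=
  (r_ th z * E_ th z * N_ th z - 2 * (r_ th z * F_ th z * M_ th z) + G_ th z * L_ th z)
  / (a_ th z * m_ th z ^ 3).
Definition kh (th z : R) : R := meanH th z - k2 k th z * (z ^ 2 * lm th).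
Definition gap (th z : R) : R := meanH th z - 2 * (k2 k th z * (z ^ 2 * lm th)).

Lemma wa_neq0 th z : Good th z -> a_ th z <> 0.
Proof.
  intros H; unfold wa, Rdiv; pose proof (good_qR _ _ _ _ _ _ _ H); pose proof (good_jac _ _ _ _ _ _ _ H).
  repeat apply Rmult_integral_contrapositive_currified; try lra; try now apply pow_nonzero.
  now apply Rinv_neq_0_compat.
Qed.

Lemma smooth_v1t : smooth2 U (v1t k). Proof. apply (pri_fields _ _ _ _ _ Hk). Qed.
Lemma smooth_v1z : smooth2 U (v1z k). Proof. apply (pri_fields _ _ _ _ _ Hk). Qed.
Lemma smooth_v2t : smooth2 U (v2t k). Proof. apply (pri_fields _ _ _ _ _ Hk). Qed.
Lemma smooth_v2z : smooth2 U (v2z k). Proof. apply (pri_fields _ _ _ _ _ Hk). Qed.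
Lemma smooth_k2 : smooth2 U (k2 k). Proof. apply (pri_bounded _ _ _ _ _ Hk). Qed.

Let gs f := good_smooth e1 e2 g c q f.
Let g1 := gs _ smooth_v1t.
Let g2 := gs _ smooth_v1z.
Let g3 := gs _ smooth_v2t.
Let g4 := gs _ smooth_v2z.
Let g5 := gs _ smooth_k2.
Let gE := gs _ (smooth_wE e1 e2 g c Hg Hc).
Let gF := gs _ (smooth_wF e1 e2 g c Hg Hc).
Let gG := gs _ (smooth_wG e1 e2 g c Hc).
Let gL := gs _ (smooth_wL e1 e2 g c Hg Hc).
Let gM := gs _ (smooth_wM e1 e2 g c Hg Hc).
Let gN := gs _ (smooth_wN e1 e2 g c Hg Hc).
Let gm := smooth_nlen e1 e2 g c q Hg Hc Hq.
Let ga := smooth_wa e1 e2 g c q Hg Hc Hq.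
Let gr := smooth_rho e1 e2 g c q Hg Hc Hq.
Let gl := smooth2_lam Good HV e1 e2.
Let gz := smooth2_snd Good HV.
Let mpos := nlen_pos e1 e2 g c q.

Lemma smooth_vQ : smooth2 Good vQ. Proof. unfold vQ; smooth2_tac. Qed.
Lemma smooth_vY : smooth2 Good vY. Proof. unfold vY; smooth2_tac. Qed.
Lemma smooth_meanH : smooth2 Good meanH.
Proof.
  unfold meanH; apply smooth2_div; [exact HV| |smooth2_tac|smooth2_tac].
  intros s t H; apply Rmult_integral_contrapositive; split; [now apply wa_neq0|].
  apply pow_nonzero, Rgt_not_eq, mpos, H.
Qed.
Lemma smooth_kh : smooth2 Good kh.
Proof. pose proof smooth_meanH; unfold kh; smooth2_tac. Qed.
Lemma smooth_gap : smooth2 Good gap.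
Proof. pose proof smooth_meanH; unfold gap; smooth2_tac. Qed.

Lemma good_regular th z : Good th z -> z <> 0 -> lm th <> 0 -> regular e1 e2 c th z.
Proof. intros H; split; [exact (good_U _ _ _ _ _ _ _ H)|now split]. Qed.

(** After division by [rho] the equations of the bounded principal direction
    survive on the singular set. *)
Lemma bounded_direction th z : Good th z ->
  (L_ th z - k2 k th z * (r_ th z * E_ th z * m_ th z)) * v2t k th z
  + (M_ th z - k2 k th z * (F_ th z * m_ th z)) * v2z k th z = 0 /\
  r_ th z * ((M_ th z - k2 k th z * (F_ th z * m_ th z)) * v2t k th z)
  + (N_ th z - k2 k th z * (G_ th z * m_ th z)) * v2z k th z = 0.
Proof.
  intros H; split; by_density e1 e2 (good e1 e2 g c q) th z HV H;
    try (apply (smooth2_cont Good); [smooth2_tac|exact H]); intros Hz Hl;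
    destruct (pri_dir _ _ _ _ _ Hk th z (good_regular th z H Hz Hl)) as [_ [K1 K2]];
    pose proof (form_L e1 e2 g c q Hg Hc Hq th z H) as FL;
    pose proof (form_M e1 e2 g c q Hg Hc Hq th z H) as FM;
    pose proof (form_N e1 e2 g c q Hg Hc Hq th z H) as FN;
    rewrite (form_E e1 e2 g c q Hg Hc Hq th z H), (form_F e1 e2 g c q Hg Hc Hq th z H) in K1;
    rewrite (form_G c th z), (form_F e1 e2 g c q Hg Hc Hq th z H) in K2;
    fold (v2t k th z) (v2z k th z) in K1, K2.
  - apply Rmult_eq_reg_l with (r_ th z); [|now apply (rho_neq0 e1 e2 g c q)].
    transitivity (m_ th z * 0); [|ring]; rewrite <- K1.
    match goal with |- ?l = _ => replace l with
      ((r_ th z * L_ th z - k2 k th z * (r_ th z ^ 2 * E_ th z * m_ th z)) * v2t k th z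
       + (r_ th z * M_ th z - k2 k th z * (r_ th z * F_ th z * m_ th z)) * v2z k th z) by ring end.
    rewrite <- FL, <- FM; ring.
  - transitivity (m_ th z * 0); [|ring]; rewrite <- K2.
    match goal with |- ?l = _ => replace l with
      ((r_ th z * M_ th z - k2 k th z * (r_ th z * F_ th z * m_ th z)) * v2t k th z
       + (N_ th z - k2 k th z * (G_ th z * m_ th z)) * v2z k th z) by ring end.
    rewrite <- FM, <- FN; ring.
Qed.

Lemma eigen_principal th z : Good th z -> z <> 0 -> lm th <> 0 ->
  let P := eigen (fE c th z) (fF c th z) (fG c th z)
    (fL e1 e2 g c th z) (fM e1 e2 g c th z) (fN e1 e2 g c th z) in
  P (k1 k th z) (v1t k th z) (v1z k th z) /\ P (k2 k th z) (v2t k th z) (v2z k th z) /\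
  v1t k th z * v2z k th z - v1z k th z * v2t k th z <> 0 /\
  fE c th z * fG c th z - fF c th z ^ 2 = r_ th z ^ 2 * m_ th z ^ 2.
Proof.
  intros H Hz Hl; destruct (pri_dir _ _ _ _ _ Hk th z (good_regular th z H Hz Hl)) as [K1 K2].
  split; [exact K1|split; [exact K2|split]].
  - exact (pri_indep _ _ _ _ _ Hk th z (good_regular th z H Hz Hl)).
  - rewrite (form_E e1 e2 g c q Hg Hc Hq th z H), (form_F e1 e2 g c q Hg Hc Hq th z H), (form_G c th z).
    rewrite <- (gram e1 e2 g c q Hg Hc th z H); ring.
Qed.

(** The unbounded principal curvature is read off from the mean curvature. *)
Lemma k1_kh th z : Good th z -> z <> 0 -> lm th <> 0 ->
  k1 k th z = kh th z / (z ^ 2 * lm th).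
Proof.
  intros H Hz Hl; destruct (eigen_principal th z H Hz Hl) as [K1 [K2 [K3 K4]]].
  pose proof (eigen_trace _ _ _ _ _ _ _ _ _ _ _ _ K1 K2 K3) as T; rewrite K4 in T.
  pose proof (form_L e1 e2 g c q Hg Hc Hq th z H) as FL.
  pose proof (form_M e1 e2 g c q Hg Hc Hq th z H) as FM.
  pose proof (form_N e1 e2 g c q Hg Hc Hq th z H) as FN.
  rewrite (form_E e1 e2 g c q Hg Hc Hq th z H), (form_F e1 e2 g c q Hg Hc Hq th z H), (form_G c th z) in T.
  pose proof (mpos th z H) as Hm; pose proof (wa_neq0 th z H) as Ha.
  pose proof (rho_neq0 e1 e2 g c q th z H Hz Hl) as Hr.
  assert (T' : r_ th z * E_ th z * N_ th z - 2 * (r_ th z * F_ th z * M_ th z) + G_ th z * L_ th z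
               = (k1 k th z + k2 k th z) * (r_ th z * m_ th z ^ 3)).
  { apply Rmult_eq_reg_l with (r_ th z); [|exact Hr].
    transitivity (m_ th z * ((k1 k th z + k2 k th z) * (r_ th z ^ 2 * m_ th z ^ 2))); [|ring].
    rewrite <- T.
    match goal with |- ?l = _ => replace l with
      (r_ th z ^ 2 * E_ th z * N_ th z - 2 * (r_ th z * F_ th z) * (r_ th z * M_ th z)
       + G_ th z * (r_ th z * L_ th z)) by ring end.
    rewrite <- FL, <- FM, <- FN; ring. }
  unfold kh, meanH; rewrite T'; unfold rho; field.
  repeat split; try assumption; lra.
Qed.

Lemma regular_open : open2 (fun s t => Good s t /\ t ^ 2 * lm s <> 0).
Proof. apply open2_neq0; [exact HV|]; intros s t H; apply (smooth2_cont Good); [smooth2_tac|exact H]. Qed.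

Lemma regular_split th z : z ^ 2 * lm th <> 0 -> z <> 0 /\ lm th <> 0.
Proof. intros H; split; intros E; apply H; rewrite E; ring. Qed.

Lemma d1_lam th z : d1 (fun s _ => lm s) th z = dlam e1 e2 th.
Proof. apply is_derive_unique, is_derive_lam. Qed.

Lemma d_k1 th z : Good th z -> z <> 0 -> lm th <> 0 ->
  d1 (k1 k) th z = (d1 kh th z * lm th - kh th z * dlam e1 e2 th) / (z ^ 2 * lm th ^ 2) /\
  d2 (k1 k) th z = (z * d2 kh th z - 2 * kh th z) / (z ^ 3 * lm th).
Proof.
  intros H Hz Hl; pose proof smooth_kh as Sk.
  assert (Hr : z ^ 2 * lm th <> 0).
  { apply Rmult_integral_contrapositive; split; [now apply pow_nonzero|exact Hl]. }
  assert (E : locally_2d (fun s t => k1 k s t = kh s t / (t ^ 2 * lm s)) th z).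
  { apply locally_2d_mono with (2 := regular_open th z (conj H Hr)).
    intros s t [Hst Hn]; destruct (regular_split s t Hn); now apply k1_kh. }
  split.
  - rewrite (d1_ext_loc _ _ _ _ E); apply is_derive_unique.
    match goal with |- is_derive _ _ ?l => replace l with
      ((d1 kh th z * (z ^ 2 * lm th) - kh th z * (z ^ 2 * dlam e1 e2 th)) / (z ^ 2 * lm th) ^ 2)
      by (field; now split) end.
    apply (is_derive_div (fun s => kh s z) (fun s => z ^ 2 * lm s)).
    + now apply smooth2_is_d1 with Good.
    + apply (is_derive_scal lm), is_derive_lam.
    + exact Hr.
  - rewrite (d2_ext_loc _ _ _ _ E); apply is_derive_unique.
    match goal with |- is_derive _ _ ?l => replace l with
      ((d2 kh th z * (z ^ 2 * lm th) - kh th z * (2 * z * lm th)) / (z ^ 2 * lm th) ^ 2)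
      by (field; now split) end.
    apply (is_derive_div (fun t => kh th t) (fun t => t ^ 2 * lm th)).
    + now apply smooth2_is_d2 with Good.
    + auto_derive; [exact I|ring].
    + exact Hr.
Qed.

(** Near the axis the two principal curvatures differ ([gap]) and the bounded
    direction is transverse to it ([vQ]). *)
Definition near_axis (th z : R) : Prop := Good th z /\ vQ th z * gap th z <> 0.

Lemma open_near : open2 near_axis.
Proof.
  apply open2_neq0; [exact HV|]; intros s t H; apply (smooth2_cont Good); [|exact H].
  pose proof smooth_vQ; pose proof smooth_gap; smooth2_tac.
Qed.

Lemma near_good th z : near_axis th z -> Good th z. Proof. intros [H _]; exact H. Qed.
Lemma near_vQ th z : near_axis th z -> vQ th z <> 0.
Proof. intros [_ H] E; apply H; rewrite E; ring. Qed.
Lemma near_gap th z : near_axis th z -> gap th z <> 0.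
Proof. intros [_ H] E; apply H; rewrite E; ring. Qed.

Lemma k1_neq_k2 th z : near_axis th z -> z <> 0 -> lm th <> 0 -> k1 k th z <> k2 k th z.
Proof.
  intros H Hz Hl E; apply (near_gap th z H).
  rewrite (k1_kh th z (near_good _ _ H) Hz Hl) in E.
  assert (E' : kh th z = k2 k th z * (z ^ 2 * lm th)) by (rewrite <- E; field; now split).
  unfold gap, kh in *; lra.
Qed.

Lemma orthogonal th z : near_axis th z ->
  v1z k th z * vQ th z + v1t k th z * (z ^ 2 * lm th * vY th z) = 0.
Proof.
  pose proof smooth_vQ; pose proof smooth_vY.
  intros H'; by_density e1 e2 near_axis th z open_near H'; pose proof (near_good _ _ H') as Hgd.
  - apply (smooth2_cont Good); [smooth2_tac|exact Hgd].
  - intros Hz Hl; destruct (eigen_principal th z Hgd Hz Hl) as [K1 [K2 _]].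
    pose proof (eigen_orthogonal _ _ _ _ _ _ _ _ _ _ _ _ K1 K2 (k1_neq_k2 th z H' Hz Hl)) as O.
    rewrite (form_E e1 e2 g c q Hg Hc Hq th z Hgd), (form_F e1 e2 g c q Hg Hc Hq th z Hgd), (form_G c th z) in O.
    rewrite <- O; unfold vQ, vY, rho; ring.
Qed.

Lemma near_v1t th z : near_axis th z -> v1t k th z <> 0.
Proof.
  intros H E; pose proof (orthogonal th z H) as O; rewrite E, Rmult_0_l, Rplus_0_r in O.
  apply Rmult_integral in O; destruct O as [O|O]; [|exact (near_vQ _ _ H O)].
  apply (proj1 (pri_nonzero _ _ _ _ _ Hk th z (good_U _ _ _ _ _ _ _ (near_good _ _ H)))).
  rewrite (surjective_pairing (V1 k th z)); unfold v1t, v1z in *; now rewrite E, O.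
Qed.

(** Each is a directional derivative of a principal curvature, cleared of
    denominators. The power of the length of the normal removes the square roots
    from the values on the axis, which become constant multiples of [v2z] times
    the coefficients [C1], [C2], [C3]. *)
Definition phi_ridge1 (th z : R) : R :=
  (vQ th z * (d1 kh th z * lm th - kh th z * dlam e1 e2 th)
   - lm th ^ 2 * vY th z * (z ^ 2 * d2 kh th z - 2 * (z * kh th z))) * m_ th z ^ 5.
Definition phi_ridge2 (th z : R) : R :=
  (v2t k th z * d1 (k2 k) th z + v2z k th z * d2 (k2 k) th z) * m_ th z ^ 3.
Definition phi_subpar2 (th z : R) : R :=
  (vQ th z * d1 (k2 k) th z - z ^ 2 * lm th * vY th z * d2 (k2 k) th z) * m_ th z ^ 3.

Lemma smooth_phi_ridge1 : smooth2 Good phi_ridge1.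
Proof.
  pose proof smooth_vQ; pose proof smooth_vY; pose proof smooth_kh.
  assert (smooth2 Good (fun s _ => dlam e1 e2 s)).
  { apply smooth2_ext with (d1 (fun s _ => lm s)); [exact HV| |smooth2_tac].
    intros s t _; apply d1_lam. }
  unfold phi_ridge1; smooth2_tac.
Qed.

Lemma smooth_phi_ridge2 : smooth2 Good phi_ridge2. Proof. unfold phi_ridge2; smooth2_tac. Qed.

Lemma smooth_phi_subpar2 : smooth2 Good phi_subpar2.
Proof. pose proof smooth_vQ; pose proof smooth_vY; unfold phi_subpar2; smooth2_tac. Qed.

Lemma ridge1_zero th z : near_axis th z -> ridge1 e1 e2 c k th z -> phi_ridge1 th z = 0.
Proof.
  intros H [[_ [Hz Hl]] D]; unfold dir_deriv in D; fold (v1t k th z) (v1z k th z) in D.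
  destruct (d_k1 th z (near_good _ _ H) Hz Hl) as [D1 D2]; rewrite D1, D2 in D.
  pose proof (orthogonal th z H) as O.
  unfold phi_ridge1; apply Rmult_eq_0_compat_r.
  apply Rmult_eq_reg_l with (v1t k th z); [|now apply near_v1t].
  rewrite Rmult_0_r; set (T := d1 kh th z * lm th - kh th z * dlam e1 e2 th) in *.
  set (S := z * d2 kh th z - 2 * kh th z) in *.
  assert (D' : v1t k th z * T * z + v1z k th z * (lm th * S) = 0).
  { transitivity (z ^ 3 * lm th ^ 2 * 0); [|ring]; rewrite <- D; field; now split. }
  apply Rmult_eq_reg_l with z; [|exact Hz]; rewrite Rmult_0_r.
  transitivity (vQ th z * (v1t k th z * T * z + v1z k th z * (lm th * S))
    - lm th * S * (v1z k th z * vQ th z + v1t k th z * (z ^ 2 * lm th * vY th z))).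
  - unfold S; ring.
  - rewrite D', O; ring.
Qed.

Lemma ridge2_zero th z : ridge2 c k th z -> phi_ridge2 th z = 0.
Proof.
  intros [_ [_ D]]; unfold dir_deriv in D; unfold phi_ridge2, v2t, v2z; rewrite D; ring.
Qed.

Lemma subpar2_zero th z : near_axis th z -> subparabolic2 c k th z -> phi_subpar2 th z = 0.
Proof.
  intros H [_ [_ D]]; unfold dir_deriv in D; fold (v1t k th z) (v1z k th z) in D.
  pose proof (orthogonal th z H) as O.
  unfold phi_subpar2; apply Rmult_eq_0_compat_r.
  apply Rmult_eq_reg_l with (v1t k th z); [|now apply near_v1t].
  rewrite Rmult_0_r.
  transitivity (vQ th z * (v1t k th z * d1 (k2 k) th z + v1z k th z * d2 (k2 k) th z)
    - d2 (k2 k) th z * (v1z k th z * vQ th z + v1t k th z * (z ^ 2 * lm th * vY th z))); [ring|].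
  rewrite D, O; ring.
Qed.

(** The left factor of [lam] does not vanish on the axis, so [lam] is bounded by a
    multiple of [z] at such points. *)
Lemma subpar1_bound th z : Good th z -> subparabolic1 e1 e2 c k th z ->
  lm th * (2 * (kh th z * v2z k th z))
  = z * (v2t k th z * (d1 kh th z * lm th - kh th z * dlam e1 e2 th) + v2z k th z * lm th * d2 kh th z).
Proof.
  intros H [[_ [Hz Hl]] D]; unfold dir_deriv in D; fold (v2t k th z) (v2z k th z) in D.
  destruct (d_k1 th z H Hz Hl) as [D1 D2]; rewrite D1, D2 in D.
  assert (D' : v2t k th z * (d1 kh th z * lm th - kh th z * dlam e1 e2 th) * z
     + v2z k th z * (lm th * (z * d2 kh th z - 2 * kh th z)) = 0).
  { transitivity (z ^ 3 * lm th ^ 2 * 0); [|ring]; rewrite <- D; field; now split. }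
  lra.
Qed.

(** * Values on the axis *)

Let Haxis th : U th 0 := par_axis _ _ _ _ Hc th.
Let Gaxis th : Good th 0 := good_axis e1 e2 g c q Hg Hc Hq th.

Lemma nlen_axis th : m_ th 0 ^ 2 = E_ th 0.
Proof.
  rewrite (nlen_sq e1 e2 g c q th 0 (Gaxis th)), (ncomp_axis e1 e2 g c Hg Hc).
  destruct (nf_triangular _ Hg) as [_ [-> ->]]; ring.
Qed.

Lemma wF_axis th : F_ th 0 = 0.
Proof. unfold wF; destruct (d2_px_axis e1 e2 g c Hg Hc th) as [-> ->]; ring. Qed.

Lemma wG_axis th : G_ th 0 = 1.
Proof. unfold wG; destruct (d2_px_axis e1 e2 g c Hg Hc th) as [-> ->]; ring. Qed.

Lemma rho_axis th : r_ th 0 = 0.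
Proof. unfold rho; ring. Qed.

Lemma wL_axis_neq0 th : L_ th 0 <> 0.
Proof.
  rewrite (wL_axis e1 e2 g c Hg Hc); destruct (nf_positive _ Hg) as [p1 [p2 _]].
  pose proof (s0_sq e1 e2) as H1; pose proof (eta_sq e1 e2) as H2.
  assert (0 < D1 (gP g) 0 0 0 * D2 (gQ g) 0 0 0) by (apply Rmult_lt_0_compat; lra).
  intros E; assert (Z : sg0 e1 e2 * eta e1 e2 = 0).
  { apply Rmult_eq_reg_r with (D1 (gP g) 0 0 0 * D2 (gQ g) 0 0 0); lra. }
  assert (sg0 e1 e2 * eta e1 e2 * (sg0 e1 e2 * eta e1 e2) = 1) by (ring [H1 H2]).
  rewrite Z in *; lra.
Qed.

(** On the axis the bounded direction is transverse to the axis and the bounded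
    principal curvature is the normal curvature of [d/dz]. *)
Lemma bounded_axis th : L_ th 0 * v2t k th 0 + M_ th 0 * v2z k th 0 = 0 /\
  v2z k th 0 <> 0 /\ k2 k th 0 * m_ th 0 = N_ th 0.
Proof.
  destruct (bounded_direction th 0 (Gaxis th)) as [B1 B2].
  rewrite rho_axis, wF_axis in B1; rewrite rho_axis, wG_axis in B2.
  assert (E : L_ th 0 * v2t k th 0 + M_ th 0 * v2z k th 0 = 0)
    by (match type of B1 with ?l = _ => transitivity l; [ring|exact B1] end).
  assert (Hz : v2z k th 0 <> 0).
  { intros Z; rewrite Z, Rmult_0_r, Rplus_0_r in E.
    apply Rmult_integral in E; destruct E as [E|E]; [exact (wL_axis_neq0 th E)|].
    apply (proj2 (pri_nonzero _ _ _ _ _ Hk th 0 (Haxis th))).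
    rewrite (surjective_pairing (V2 k th 0)); unfold v2t, v2z in *; now rewrite E, Z. }
  split; [exact E|split; [exact Hz|]].
  rewrite Rmult_0_l, Rplus_0_l in B2; apply Rmult_integral in B2; destruct B2 as [B2|B2]; [lra|contradiction].
Qed.

Lemma vQ_axis th : vQ th 0 = v2z k th 0.
Proof. unfold vQ; rewrite rho_axis, wG_axis; ring. Qed.

Lemma meanH_axis th : meanH th 0 * m_ th 0 ^ 3 = L_ th 0 / a_ th 0.
Proof.
  unfold meanH; rewrite rho_axis, wG_axis; pose proof (mpos th 0 (Gaxis th)).
  pose proof (wa_neq0 th 0 (Gaxis th)); field; split; lra.
Qed.

Lemma near_axis_axis th : near_axis th 0.
Proof.
  split; [exact (Gaxis th)|]; apply Rmult_integral_contrapositive; split.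
  - rewrite vQ_axis; apply bounded_axis.
  - unfold gap; intros Z; pose proof (meanH_axis th) as K.
    replace (meanH th 0) with 0 in K by lra.
    apply (wL_axis_neq0 th).
    replace (L_ th 0) with (L_ th 0 / a_ th 0 * a_ th 0) by (field; apply wa_neq0, Gaxis).
    rewrite <- K; ring.
Qed.

Lemma ex_axis f th : smooth2 Good f -> is_derive (fun s => f s 0) th (d1 f th 0).
Proof. intros Hf; now apply smooth2_is_d1 with Good. Qed.

Lemma d1_nlen_axis th : 2 * m_ th 0 * d1 m_ th 0 = d1 E_ th 0.
Proof.
  pose proof (is_derive_unique _ _ _ (is_derive_Rmult _ _ _ _ _ (ex_axis _ th gm) (ex_axis _ th gm))) as K.
  rewrite (Derive_ext _ (fun s => E_ s 0)) in K.
  - change (Derive (fun s => E_ s 0) th) with (d1 E_ th 0) in K; lra.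
  - intros s; rewrite <- nlen_axis; ring.
Qed.

Lemma d2_nlen_axis th : 2 * m_ th 0 * d2 m_ th 0 = d2 E_ th 0.
Proof.
  pose proof (gs _ (smooth_ncomp e1 e2 g c Hg Hc D3 (partial_D3 g))) as g3'.
  assert (K : forall s t, Good s t -> m_ s t * m_ s t
    = E_ s t + ncomp e1 e2 g c D3 s t * ncomp e1 e2 g c D3 s t).
  { intros s t H; pose proof (nlen_sq e1 e2 g c q s t H); lra. }
  pose proof (d2_eq_on Good HV _ _ th 0 K (Gaxis th)) as D.
  rewrite (d2_plus Good), !(d2_mult Good) in D; try exact (Gaxis th); smooth2_tac.
  rewrite !(ncomp_axis e1 e2 g c Hg Hc) in D.
  destruct (nf_triangular _ Hg) as [_ [T2 T3]]; rewrite T2, T3 in D.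
  lra.
Qed.

Lemma d1_k2_axis th :
  2 * (d1 (k2 k) th 0 * m_ th 0 ^ 3) = 2 * E_ th 0 * d1 N_ th 0 - N_ th 0 * d1 E_ th 0.
Proof.
  pose proof (is_derive_unique _ _ _ (is_derive_Rmult _ _ _ _ _ (ex_axis _ th g5) (ex_axis _ th gm))) as K.
  rewrite (Derive_ext _ (fun s => N_ s 0)) in K by (intros s; apply bounded_axis).
  change (Derive (fun s => N_ s 0) th) with (d1 N_ th 0) in K.
  rewrite <- nlen_axis, <- (proj2 (proj2 (bounded_axis th))), <- d1_nlen_axis, K; ring.
Qed.

(** The mixed terms of the second equation of the bounded direction carry the
    factor [rho], hence [z ^ 2], so they do not contribute to the first order in [z]. *)
Lemma d2_k2_axis th :
  2 * (d2 (k2 k) th 0 * m_ th 0 ^ 3) = 2 * E_ th 0 * d2 N_ th 0 - N_ th 0 * d2 E_ th 0.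
Proof.
  destruct (bounded_axis th) as [_ [Hz Hn]].
  set (T := fun s t => lm s * a_ s t * ((M_ s t - k2 k s t * (F_ s t * m_ s t)) * v2t k s t)).
  assert (ST : smooth2 Good T) by (unfold T; smooth2_tac).
  assert (K : forall s t, Good s t -> (N_ s t - k2 k s t * (G_ s t * m_ s t)) * v2z k s t = - (t * (t * T s t))).
  { intros s t H; destruct (bounded_direction s t H) as [_ B2]; unfold T, rho in *; lra. }
  pose proof (d2_eq_on Good HV _ _ th 0 K (Gaxis th)) as D.
  rewrite (d2_opp Good), (d2_mult Good) in D; try exact (Gaxis th);
    [|smooth2_tac|smooth2_tac|smooth2_tac].
  rewrite (d2_mult Good (fun _ t => t)), d2_id in D; [|smooth2_tac|smooth2_tac|exact (Gaxis th)].
  assert (DG : d2 G_ th 0 = 0).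
  { pose proof (smooth_px e1 e2 g c Hc); pose proof (smooth_py e1 e2 g c Hc).
    assert (EG : forall s t, U s t -> G_ s t = d2 (px c) s t * d2 (px c) s t + d2 (py c) s t * d2 (py c) s t + 1)
      by (intros; unfold wG; ring).
    rewrite (d2_eq_on U HU _ _ th 0 EG (Haxis th)).
    rewrite (d2_plus U), (d2_plus U), !(d2_mult U); try apply Haxis; smooth2_tac.
    destruct (d2_px_axis e1 e2 g c Hg Hc th) as [-> ->]; rewrite (d2_fst (fun _ => 1)); ring. }
  assert (DP : d2 (fun s t => N_ s t - k2 k s t * (G_ s t * m_ s t)) th 0
    = d2 N_ th 0 - (d2 (k2 k) th 0 * m_ th 0 + k2 k th 0 * d2 m_ th 0)).
  { unfold Rminus; rewrite (d2_plus Good), (d2_opp Good), !(d2_mult Good); try exact (Gaxis th); smooth2_tac.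
    rewrite DG, wG_axis; ring. }
  rewrite DP, wG_axis in D.
  assert (Z : d2 N_ th 0 = d2 (k2 k) th 0 * m_ th 0 + k2 k th 0 * d2 m_ th 0).
  { apply Rminus_diag_uniq, Rmult_eq_reg_r with (v2z k th 0); [|exact Hz].
    assert (K0 : N_ th 0 - k2 k th 0 * (1 * m_ th 0) = 0) by lra.
    rewrite K0 in D; lra. }
  rewrite <- nlen_axis, <- Hn, <- d2_nlen_axis, Z; ring.
Qed.

Lemma wa_L_const th s : L_ s 0 / a_ s 0 = L_ th 0 / a_ th 0.
Proof.
  rewrite !(wL_axis e1 e2 g c Hg Hc), !(wa_axis e1 e2 g c q Hg Hc Hq); reflexivity.
Qed.

(** On the axis [kh * nlen ^ 3] is the constant [L_ / a_]. *)
Lemma d1_kh_axis th :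
  2 * (d1 kh th 0 * m_ th 0 ^ 5) = - 3 * (L_ th 0 / a_ th 0) * d1 E_ th 0.
Proof.
  pose proof smooth_kh as Sk.
  pose proof (is_derive_Rmult _ _ _ _ _ (ex_axis _ th gm) (ex_axis _ th gm)) as K2'.
  pose proof (is_derive_Rmult _ _ _ _ _ (ex_axis _ th gm) K2') as K3'.
  pose proof (is_derive_unique _ _ _ (is_derive_Rmult _ _ _ _ _ (ex_axis _ th Sk) K3')) as K.
  assert (E : forall s, kh s 0 * (m_ s 0 * (m_ s 0 * m_ s 0)) = L_ th 0 / a_ th 0).
  { intros s; rewrite <- (wa_L_const th s), <- meanH_axis; unfold kh; ring. }
  assert (K0 : Derive (fun s => kh s 0 * (m_ s 0 * (m_ s 0 * m_ s 0))) th = 0)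
    by (rewrite (Derive_ext _ _ th E); apply Derive_const).
  apply (eq_trans (eq_sym K0)) in K.
  rewrite <- d1_nlen_axis, <- (E th).
  assert (Z : d1 kh th 0 * m_ th 0 ^ 3 = - (3 * kh th 0 * m_ th 0 ^ 2 * d1 m_ th 0)) by lra.
  transitivity (2 * m_ th 0 ^ 2 * (d1 kh th 0 * m_ th 0 ^ 3)); [ring|rewrite Z; ring].
Qed.

Lemma E0_d1 th : Derive (E0 q) th = d1 E_ th 0.
Proof.
  apply Derive_ext; intros s; apply (quot_E e1 e2 g c q Hg Hc Hq), Gaxis.
Qed.

Lemma N0_d1 th : Derive (N0 e1 e2 g c) th = d1 N_ th 0.
Proof.
  apply Derive_ext; intros s; apply (nutN_eq e1 e2 g c q Hg Hc Hq), Gaxis.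
Qed.

Lemma phi_ridge1_axis th : phi_ridge1 th 0
  = - (L_ 0 0 / a_ 0 0) / (2 * a_ 0 0) * v2z k th 0 * C1 e1 e2 g c q th.
Proof.
  assert (Ea : forall s, a_ s 0 = a_ 0 0) by (intros; now rewrite !(wa_axis e1 e2 g c q Hg Hc Hq)).
  unfold C1; rewrite E0_d1.
  assert (Eaf : forall s, af e1 e2 g c q s 0 = a_ 0 0).
  { intros s; rewrite (af_wa e1 e2 g c q Hg Hc) by apply Haxis; apply Ea. }
  rewrite (Derive_ext _ _ th Eaf), Derive_const, Eaf.
  rewrite (is_derive_unique _ _ _ (is_derive_lam e1 e2 th)).
  unfold E0; rewrite (quot_E e1 e2 g c q Hg Hc Hq) by apply Gaxis.
  pose proof (wa_neq0 0 0 (Gaxis 0)) as Hn.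
  pose proof (d1_kh_axis th) as K; rewrite (wa_L_const 0 th) in K.
  pose proof (meanH_axis th) as K'; rewrite (wa_L_const 0 th) in K'.
  unfold phi_ridge1; rewrite vQ_axis.
  apply Rmult_eq_reg_l with 2; [|lra].
  transitivity (v2z k th 0 * (2 * (d1 kh th 0 * m_ th 0 ^ 5) * lm th
    - 2 * (meanH th 0 * m_ th 0 ^ 3) * m_ th 0 ^ 2 * dlam e1 e2 th)).
  - unfold kh at 2; ring.
  - rewrite K, K', nlen_axis; field; exact Hn.
Qed.

Lemma phi_ridge2_axis th : phi_ridge2 th 0 = / (2 * L_ 0 0) * v2z k th 0 * C2 e1 e2 g c q th.
Proof.
  destruct (bounded_axis th) as [Hd _].
  unfold C2, E0, E1, N1, L0, M0.
  rewrite E0_d1, N0_d1; unfold N0.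
  rewrite (quot_E e1 e2 g c q Hg Hc Hq), (quot_L e1 e2 g c q Hg Hc Hq), (quot_M e1 e2 g c q Hg Hc Hq),
    (nutN_eq e1 e2 g c q Hg Hc Hq) by apply Gaxis.
  rewrite (d2_eq_on _ HV _ _ _ _ (quot_E e1 e2 g c q Hg Hc Hq) (Gaxis th)).
  rewrite (d2_eq_on _ HV _ _ _ _ (nutN_eq e1 e2 g c q Hg Hc Hq) (Gaxis th)).
  pose proof (d1_k2_axis th) as X1; pose proof (d2_k2_axis th) as X2.
  pose proof (wL_axis_neq0 0) as Hl.
  assert (El : L_ th 0 = L_ 0 0) by now rewrite !(wL_axis e1 e2 g c Hg Hc).
  rewrite El in *.
  apply Rmult_eq_reg_l with (2 * L_ 0 0); [|lra].
  transitivity (L_ 0 0 * v2t k th 0 * (2 * (d1 (k2 k) th 0 * m_ th 0 ^ 3))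
    + L_ 0 0 * v2z k th 0 * (2 * (d2 (k2 k) th 0 * m_ th 0 ^ 3))).
  - unfold phi_ridge2; ring.
  - rewrite X1, X2; replace (L_ 0 0 * v2t k th 0) with (- (M_ th 0 * v2z k th 0)) by lra.
    field; exact Hl.
Qed.

Lemma phi_subpar2_axis th : phi_subpar2 th 0 = / 2 * v2z k th 0 * C3 e1 e2 g c q th.
Proof.
  unfold C3; rewrite E0_d1, N0_d1; unfold E0, N0.
  rewrite (quot_E e1 e2 g c q Hg Hc Hq), (nutN_eq e1 e2 g c q Hg Hc Hq) by apply Gaxis.
  apply Rmult_eq_reg_l with 2; [|lra].
  transitivity (v2z k th 0 * (2 * (d1 (k2 k) th 0 * m_ th 0 ^ 3))).
  - unfold phi_subpar2; rewrite vQ_axis; ring.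
  - rewrite d1_k2_axis; field.
Qed.

Lemma kh_axis_neq0 th : kh th 0 <> 0.
Proof.
  intros Z; pose proof (near_gap _ _ (near_axis_axis th)) as K; apply K; unfold gap, kh in *; lra.
Qed.

End Principal.

(** * Comparison of the parametrizations over one point of the projective line *)

Lemma open2_locally (P : R -> R -> Prop) : open2 (fun s t => locally_2d P s t).
Proof.
  intros s t [d Hd].
  assert (Hh : 0 < d / 2) by (pose proof (cond_pos d); lra).
  exists (mkposreal _ Hh); simpl; intros u v Hu Hv.
  exists (mkposreal _ Hh); simpl; intros u' v' Hu' Hv'.
  apply Rabs_def2 in Hu; apply Rabs_def2 in Hv; apply Rabs_def2 in Hu'; apply Rabs_def2 in Hv'.
  apply Hd; apply Rabs_def1; lra.
Qed.

Lemma locally_2d_shift (P : R -> R -> Prop) s t h :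
  locally_2d P (s + h) t -> locally_2d (fun s t => P (s + h) t) s t.
Proof.
  intros [d Hd]; exists d; intros u v Hu Hv; apply Hd; [|exact Hv].
  replace (u + h - (s + h)) with (u - s) by ring; exact Hu.
Qed.

Lemma continuity_2d_shift f s t h :
  continuity_2d_pt f (s + h) t -> continuity_2d_pt (fun s t => f (s + h) t) s t.
Proof. intros H eps; exact (locally_2d_shift _ s t h (H eps)). Qed.

Lemma d1_shift f h s t : d1 (fun s t => f (s + h) t) s t = d1 f (s + h) t.
Proof.
  unfold d1, Derive; f_equal; apply Lim_ext; intros y.
  replace (s + y + h) with (s + h + y) by ring; reflexivity.
Qed.

Lemma d2_shift f h s t : d2 (fun s t => f (s + h) t) s t = d2 f (s + h) t.
Proof. reflexivity. Qed.

(** Local uniqueness in the implicit function theorem, uniform in bounded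
    values of [alpha] and [beta]: since [R ^ 2] has no linear part, the
    increments of [X] and [Y] are given by a matrix close to the triangular
    matrix of the linear parts of [P] and [Q]. *)
Lemma implicit_unique g K : normal_form g -> 0 < K -> exists d, 0 < d /\
  forall al be x y x' y' z, Rabs al <= K -> Rabs be <= K ->
    Rabs x < d -> Rabs y < d -> Rabs x' < d -> Rabs y' < d -> Rabs z < d ->
    gP g x y z + gR g x y z ^ 2 * al = 0 -> gQ g x y z + gR g x y z ^ 2 * be = 0 ->
    gP g x' y' z + gR g x' y' z ^ 2 * al = 0 -> gQ g x' y' z + gR g x' y' z ^ 2 * be = 0 ->
    x = x' /\ y = y'.
Proof.
  intros Hg HK.
  destruct (nf_triangular _ Hg) as [T1 [T2 T3]], (nf_positive _ Hg) as [p1 [p2 p3]].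
  destruct (nf_zero _ Hg) as [_ [_ R0]].
  set (p := D1 (gP g) 0 0 0) in *; set (q2 := D2 (gQ g) 0 0 0) in *; set (q1 := D1 (gQ g) 0 0 0).
  assert (Hpq : 0 < p * q2 / 2) by (pose proof (Rmult_lt_0_compat _ _ p1 p2); lra).
  destruct (mult_close p q2 _ Hpq) as [r1 [Hr1 M1]].
  destruct (mult_close 0 q1 _ Hpq) as [r2 [Hr2 M2]].
  set (r := Rmin r1 r2); assert (Hr : 0 < r) by now apply Rmin_pos.
  pose proof (Rmin_l r1 r2) as Rl; pose proof (Rmin_r r1 r2) as Rr; fold r in Rl, Rr.
  set (ep := r / 2 / (2 * K)).
  assert (Hep : 0 < ep) by (unfold ep; apply Rdiv_lt_0_compat; lra).
  destruct (mult_close 0 (D1 (gR g) 0 0 0) _ Hep) as [t1 [Ht1 N1]].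
  destruct (mult_close 0 (D2 (gR g) 0 0 0) _ Hep) as [t2 [Ht2 N2]].
  set (t := Rmin t1 t2); assert (Ht : 0 < t) by now apply Rmin_pos.
  pose proof (Rmin_l t1 t2) as Tl; pose proof (Rmin_r t1 t2) as Tr; fold t in Tl, Tr.
  pose proof (openW g Hg) as HW; pose proof (nf_origin _ Hg) as H0.
  assert (Hr' : 0 < r / 2) by lra; assert (Ht' : 0 < t / 2) by lra.
  destruct (increment3 _ _ 0 0 0 HW (smooth_P g Hg) H0 _ Hr') as [dp [Hdp IP]].
  destruct (increment3 _ _ 0 0 0 HW (smooth_Q g Hg) H0 _ Hr') as [dq [Hdq IQ]].
  destruct (increment3 _ _ 0 0 0 HW (smooth_R g Hg) H0 _ Ht) as [dr [Hdr IR]].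
  destruct (cont3_box (gR g) 0 0 0 (smooth_R g Hg O 0 0 0 H0) _ Ht') as [ds [Hds IS]].
  set (d := Rmin (Rmin dp dq) (Rmin dr ds)).
  assert (Hd : 0 < d) by (unfold d; repeat apply Rmin_pos; assumption).
  assert (Md : d <= dp /\ d <= dq /\ d <= dr /\ d <= ds).
  { unfold d; repeat split; below_min. }
  exists d; split; [exact Hd|].
  intros al be x y x' y' z Hal Hbe Hx Hy Hx' Hy' Hz E1 E2 E3 E4.
  assert (S0 : forall u, u - 0 = u) by (intros; ring).
  destruct (IP x y z x' y' z) as [a1 [a2 [a3 [EP [A1 [A2 _]]]]]]; try (rewrite S0; lra).
  destruct (IQ x y z x' y' z) as [b1 [b2 [b3 [EQ [B1 [B2 _]]]]]]; try (rewrite S0; lra).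
  destruct (IR x y z x' y' z) as [c1 [c2 [c3 [ER [C1 [C2 _]]]]]]; try (rewrite S0; lra).
  assert (HS : Rabs (gR g x' y' z + gR g x y z - 0) < t).
  { assert (X1 := IS x y z ltac:(rewrite S0; lra) ltac:(rewrite S0; lra) ltac:(rewrite S0; lra)).
    assert (X2 := IS x' y' z ltac:(rewrite S0; lra) ltac:(rewrite S0; lra) ltac:(rewrite S0; lra)).
    rewrite R0 in X1, X2; apply Rabs_def2 in X1; apply Rabs_def2 in X2; apply Rabs_def1; lra. }
  set (s := gR g x' y' z + gR g x y z) in *.
  assert (W1 := N1 s c1 ltac:(lra) ltac:(lra)); assert (W2 := N2 s c2 ltac:(lra) ltac:(lra)).
  rewrite Rmult_0_l, Rminus_0_r in W1, W2.
  assert (Sm : forall w u, Rabs w <= K -> Rabs u < ep -> Rabs (w * u) < r / 2).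
  { intros w u Hw Hu; rewrite Rabs_mult.
    apply Rle_lt_trans with (K * ep).
    - apply Rmult_le_compat; try apply Rabs_pos; lra.
    - replace (K * ep) with (r / 4) by (unfold ep; field; lra); lra. }
  set (m11 := a1 + al * (s * c1)); set (m12 := a2 + al * (s * c2)).
  set (m21 := b1 + be * (s * c1)); set (m22 := b2 + be * (s * c2)).
  assert (L1 : m11 * (x' - x) + m12 * (y' - y) = 0).
  { transitivity ((gP g x' y' z - gP g x y z) + al * s * (gR g x' y' z - gR g x y z)).
    - rewrite EP, ER; unfold m11, m12; ring.
    - unfold s; lra. }
  assert (L2 : m21 * (x' - x) + m22 * (y' - y) = 0).
  { transitivity ((gQ g x' y' z - gQ g x y z) + be * s * (gR g x' y' z - gR g x y z)).
    - rewrite EQ, ER; unfold m21, m22; ring.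
    - unfold s; lra. }
  fold p in A1; rewrite T1 in A2; fold q1 in B1; fold q2 in B2.
  assert (Q1 := Sm al _ Hal W1); assert (Q2 := Sm al _ Hal W2).
  assert (Q3 := Sm be _ Hbe W1); assert (Q4 := Sm be _ Hbe W2).
  assert (Cl : forall u v w, Rabs (u - w) < r / 2 -> Rabs v < r / 2 -> Rabs (u + v - w) < r).
  { intros u v w Hu Hv; apply Rabs_def2 in Hu; apply Rabs_def2 in Hv; apply Rabs_def1; lra. }
  assert (G1 := Cl _ _ _ A1 Q1); assert (G2 := Cl _ _ _ A2 Q2).
  assert (G3 := Cl _ _ _ B1 Q3); assert (G4 := Cl _ _ _ B2 Q4).
  fold m11 in G1; fold m12 in G2; fold m21 in G3; fold m22 in G4.
  assert (D1' := M1 m11 m22 ltac:(lra) ltac:(lra)); assert (D2' := M2 m12 m21 ltac:(lra) ltac:(lra)).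
  apply Rabs_def2 in D1'; apply Rabs_def2 in D2'.
  assert (HD : m11 * m22 - m12 * m21 <> 0) by lra.
  split.
  - assert (X : (m11 * m22 - m12 * m21) * (x' - x) = 0).
    { transitivity (m22 * (m11 * (x' - x) + m12 * (y' - y)) - m12 * (m21 * (x' - x) + m22 * (y' - y)));
        [ring|rewrite L1, L2; ring]. }
    apply Rmult_integral in X; destruct X as [X|X]; [contradiction|lra].
  - assert (X : (m11 * m22 - m12 * m21) * (y' - y) = 0).
    { transitivity (m11 * (m21 * (x' - x) + m22 * (y' - y)) - m21 * (m11 * (x' - x) + m12 * (y' - y)));
        [ring|rewrite L1, L2; ring]. }
    apply Rmult_integral in X; destruct X as [X|X]; [contradiction|lra].
Qed.

Lemma parallel_annihilate a b a' b' x y :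
  a' <> 0 \/ b' <> 0 -> a' * b - b' * a = 0 -> a' * x + b' * y = 0 -> a * x + b * y = 0.
Proof.
  intros [H|H] Hc H0.
  - apply Rmult_eq_reg_l with a'; [|exact H].
    transitivity (a * (a' * x + b' * y) + y * (a' * b - b' * a)); [ring|rewrite Hc, H0; ring].
  - apply Rmult_eq_reg_l with b'; [|exact H].
    transitivity (b * (a' * x + b' * y) - x * (a' * b - b' * a)); [ring|rewrite Hc, H0; ring].
Qed.

Lemma pair_neq0 (v : R * R) : v <> (0, 0) -> fst v <> 0 \/ snd v <> 0.
Proof.
  intros H; destruct (Req_dec (fst v) 0) as [E|E]; [right|now left].
  intros E'; apply H; rewrite (surjective_pairing v), E, E'; reflexivity.
Qed.

(** Two parametrizations whose frames [(A, B)] agree up to the sign [sg] after the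
    shift [h] of the angle solve the same implicit equations, so they have the same
    image near the axis and opposite or equal normals. Their principal curvatures
    and directions then agree up to [sg] and rescaling, because the equations of
    the principal directions determine which curvature is the bounded one. *)
Section Transport.
Variables (e1 : pm) (g : germs) (e2 e2' : pm) (c c' : param) (q q' : quotients) (k k' : principal).
Hypotheses (Hg : normal_form g)
  (Hc : is_param e1 e2 g c) (Hq : is_quotients e1 e2 g c q) (Hk : is_principal e1 e2 g c k)
  (Hc' : is_param e1 e2' g c') (Hq' : is_quotients e1 e2' g c' q') (Hk' : is_principal e1 e2' g c' k').
Variables (h sg th0 : R).
Hypotheses (Hsg : sg * sg = 1)
  (HA : forall th, fA e1 e2' (th + h) = sg * fA e1 e2 th)
  (HB : forall th, fB e1 e2' (th + h) = sg * fB e1 e2 th).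

Lemma alpha_shift th : alpha e1 e2' (th + h) = alpha e1 e2 th.
Proof. rewrite !alpha_form, HA, HB; unfold alphaf; field [Hsg]. Qed.

Lemma beta_shift th : beta e1 e2' (th + h) = beta e1 e2 th.
Proof. rewrite !beta_form, HA, HB; unfold betaf; ring [Hsg]. Qed.

Lemma lam_shift th : lam e1 e2' (th + h) = sg * tau e1 e2 * tau e1 e2' * lam e1 e2 th.
Proof.
  rewrite !lam_form, HA, HB; unfold lamf; pose proof (tau_sq e1 e2) as K; ring [Hsg K].
Qed.

Lemma lam_shift_neq0 th : lam e1 e2' (th + h) <> 0 <-> lam e1 e2 th <> 0.
Proof.
  assert (K : sg * tau e1 e2 * tau e1 e2' <> 0).
  { assert (sg <> 0) by (intros E; rewrite E in Hsg; lra).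
    repeat apply Rmult_integral_contrapositive_currified; try assumption;
      destruct e1, e2, e2'; unfold tau; lra. }
  rewrite lam_shift; split; intros H E; apply H.
  - rewrite E; ring.
  - apply Rmult_integral in E; tauto.
Qed.

Definition agree (s t : R) : Prop :=
  pU c s t /\ pU c' (s + h) t /\ px c s t = px c' (s + h) t /\ py c s t = py c' (s + h) t.

Lemma cont_bound f s : continuity_pt f s -> locally s (fun u => Rabs (f u) <= Rabs (f s) + 1).
Proof.
  intros H; destruct (proj1 (continuity_pt_locally f s) H (mkposreal 1 Rlt_0_1)) as [d Hd].
  exists d; intros u Hu; specialize (Hd u Hu); simpl in Hd.
  pose proof (Rabs_triang (f u - f s) (f s)); replace (f u - f s + f s) with (f u) in * by ring; lra.
Qed.

Lemma agree_near : locally_2d agree th0 0.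
Proof.
  set (K := Rmax (Rabs (alpha e1 e2 th0) + 1) (Rabs (beta e1 e2 th0) + 1)).
  assert (HK : 0 < K).
  { unfold K; pose proof (Rmax_l (Rabs (alpha e1 e2 th0) + 1) (Rabs (beta e1 e2 th0) + 1)).
    pose proof (Rabs_pos (alpha e1 e2 th0)); lra. }
  destruct (implicit_unique g K Hg HK) as [d [Hd I]].
  assert (Cal : locally th0 (fun u => Rabs (alpha e1 e2 u) <= Rabs (alpha e1 e2 th0) + 1)).
  { apply cont_bound, derivable_continuous_pt, ex_derive_Reals_0; eexists; apply is_derive_alpha. }
  assert (Cbe : locally th0 (fun u => Rabs (beta e1 e2 u) <= Rabs (beta e1 e2 th0) + 1)).
  { apply cont_bound, derivable_continuous_pt, ex_derive_Reals_0; eexists; apply is_derive_beta. }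
  assert (L1 : locally_2d (fun s _ => Rabs (alpha e1 e2 s) <= K /\ Rabs (beta e1 e2 s) <= K) th0 0).
  { destruct (filter_and _ _ Cal Cbe) as [r Hr]; exists r; intros u v Hu _.
    destruct (Hr u Hu) as [X1 X2]; unfold K; split;
      [apply Rle_trans with (1 := X1), Rmax_l|apply Rle_trans with (1 := X2), Rmax_r]. }
  assert (Sm : forall (f : R -> R -> R) s, continuity_2d_pt f s 0 -> f s 0 = 0 ->
            locally_2d (fun s t => Rabs (f s t) < d) s 0).
  { intros f s Hf E; apply locally_2d_mono with (2 := Hf (mkposreal d Hd)); simpl.
    intros u v; rewrite E, Rminus_0_r; auto. }
  pose proof (par_axis _ _ _ _ Hc th0) as A0; pose proof (par_axis _ _ _ _ Hc' (th0 + h)) as A0'.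
  destruct (par_zero _ _ _ _ Hc th0) as [Z1 Z2], (par_zero _ _ _ _ Hc' (th0 + h)) as [Z1' Z2'].
  pose proof (Sm (px c) th0 (smooth2_cont _ _ _ _ (smooth_px _ _ _ _ Hc) A0) Z1) as X1.
  pose proof (Sm (py c) th0 (smooth2_cont _ _ _ _ (smooth_py _ _ _ _ Hc) A0) Z2) as X2.
  pose proof (Sm (fun s t => px c' (s + h) t) th0
    (continuity_2d_shift _ _ _ _ (smooth2_cont _ _ _ _ (smooth_px _ _ _ _ Hc') A0')) Z1') as X3.
  pose proof (Sm (fun s t => py c' (s + h) t) th0
    (continuity_2d_shift _ _ _ _ (smooth2_cont _ _ _ _ (smooth_py _ _ _ _ Hc') A0')) Z2') as X4.
  pose proof (Sm (fun _ t => t) th0 (continuity_2d_pt_id2 th0 0) eq_refl) as X5.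
  pose proof (par_open _ _ _ _ Hc th0 0 A0) as X6.
  pose proof (locally_2d_shift _ _ _ _ (par_open _ _ _ _ Hc' _ _ A0')) as X7.
  apply locally_2d_mono with (2 := locally_2d_and _ _ _ _ L1 (locally_2d_and _ _ _ _ X1
    (locally_2d_and _ _ _ _ X2 (locally_2d_and _ _ _ _ X3 (locally_2d_and _ _ _ _ X4
    (locally_2d_and _ _ _ _ X5 (locally_2d_and _ _ _ _ X6 X7))))))).
  intros s t [[Ba Bb] [B1 [B2 [B3 [B4 [B5 [B6 B7]]]]]]].
  destruct (par_eq _ _ _ _ Hc s t B6) as [E1 E2], (par_eq _ _ _ _ Hc' _ t B7) as [E3 E4].
  unfold Xf, Yf in *; rewrite alpha_shift in E3; rewrite beta_shift in E4.
  split; [exact B6|split; [exact B7|]].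
  exact (I _ _ _ _ _ _ t Ba Bb B1 B2 B3 B4 B5 E1 E2 E3 E4).
Qed.

Lemma agree_d1 f f' s t : locally_2d agree s t ->
  (forall s t, agree s t -> f s t = f' (s + h) t) -> d1 f s t = d1 f' (s + h) t.
Proof.
  intros H E; rewrite <- d1_shift; apply d1_ext_loc, locally_2d_mono with (2 := H); exact E.
Qed.

Lemma agree_d2 f f' s t : locally_2d agree s t ->
  (forall s t, agree s t -> f s t = f' (s + h) t) -> d2 f s t = d2 f' (s + h) t.
Proof.
  intros H E; rewrite <- d2_shift; apply d2_ext_loc, locally_2d_mono with (2 := H); exact E.
Qed.

Lemma agree_b s t : agree s t -> b c s t = b c' (s + h) t.
Proof. intros [_ [_ [E1 E2]]]; unfold b; now rewrite E1, E2. Qed.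

Lemma agree_vd1_b s t : locally_2d agree s t -> vd1 (b c) s t = vd1 (b c') (s + h) t.
Proof.
  intros H; unfold vd1; refine (f_equal2 pair (f_equal2 pair _ _) _); apply agree_d1; try exact H;
    intros u v Huv; now rewrite (agree_b u v Huv).
Qed.

Lemma agree_vd2_b s t : locally_2d agree s t -> vd2 (b c) s t = vd2 (b c') (s + h) t.
Proof.
  intros H; unfold vd2; refine (f_equal2 pair (f_equal2 pair _ _) _); apply agree_d2; try exact H;
    intros u v Huv; now rewrite (agree_b u v Huv).
Qed.

Lemma agree_nut s t : agree s t -> nut e1 e2' g c' (s + h) t = vscal sg (nut e1 e2 g c s t).
Proof.
  intros [_ [_ [E1 E2]]]; rewrite !nut_form; unfold dX, dY, grad_along, Xf, Yf.
  rewrite alpha_shift, beta_shift, HA, HB, <- E1, <- E2.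
  unfold vadd, vscal, vx, vy, vz; simpl; repeat (f_equal; try ring).
Qed.

Lemma agree_nu s t : agree s t -> nu e1 e2' g c' (s + h) t = vscal sg (nu e1 e2 g c s t).
Proof.
  intros H; unfold nu; rewrite (agree_nut s t H).
  assert (E : vnorm (vscal sg (nut e1 e2 g c s t)) = vnorm (nut e1 e2 g c s t)).
  { unfold vnorm; f_equal; unfold dot, vscal, vx, vy, vz; simpl; ring [Hsg]. }
  rewrite E; unfold vscal, vx, vy, vz; simpl; repeat (f_equal; try ring).
Qed.

Lemma agree_vd1_nu s t : locally_2d agree s t ->
  vd1 (nu e1 e2' g c') (s + h) t = vscal sg (vd1 (nu e1 e2 g c) s t).
Proof.
  intros H; unfold vd1 at 1.
  rewrite <- (agree_d1 (fun s t => sg * vx (nu e1 e2 g c s t))),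
    <- (agree_d1 (fun s t => sg * vy (nu e1 e2 g c s t))),
    <- (agree_d1 (fun s t => sg * vz (nu e1 e2 g c s t)));
    try exact H; try (intros u v Huv; rewrite (agree_nu u v Huv); reflexivity).
  unfold vscal, vd1, vx, vy, vz; simpl; unfold d1; rewrite !Derive_scal; reflexivity.
Qed.

Lemma agree_vd2_nu s t : locally_2d agree s t ->
  vd2 (nu e1 e2' g c') (s + h) t = vscal sg (vd2 (nu e1 e2 g c) s t).
Proof.
  intros H; unfold vd2 at 1.
  rewrite <- (agree_d2 (fun s t => sg * vx (nu e1 e2 g c s t))),
    <- (agree_d2 (fun s t => sg * vy (nu e1 e2 g c s t))),
    <- (agree_d2 (fun s t => sg * vz (nu e1 e2 g c s t)));
    try exact H; try (intros u v Huv; rewrite (agree_nu u v Huv); reflexivity).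
  unfold vscal, vd2, vx, vy, vz; simpl; unfold d2; rewrite !Derive_scal; reflexivity.
Qed.

Lemma dot_scal_r a v w : dot v (vscal a w) = a * dot v w.
Proof. unfold dot, vscal, vx, vy, vz; simpl; ring. Qed.

(** Reversing the normal changes the signs of both principal curvatures. *)
Lemma agree_eigen s t kk x y : locally_2d agree s t ->
  eigen (fE c' (s + h) t) (fF c' (s + h) t) (fG c' (s + h) t)
    (fL e1 e2' g c' (s + h) t) (fM e1 e2' g c' (s + h) t) (fN e1 e2' g c' (s + h) t) kk x y ->
  eigen (fE c s t) (fF c s t) (fG c s t) (fL e1 e2 g c s t) (fM e1 e2 g c s t) (fN e1 e2 g c s t)
    (sg * kk) x y.
Proof.
  intros H; unfold fE, fF, fG, fL, fM, fN.
  rewrite (agree_vd1_nu s t H), (agree_vd2_nu s t H), <- (agree_vd1_b s t H), <- (agree_vd2_b s t H).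
  rewrite !dot_scal_r.
  set (E := dot (vd1 (b c) s t) (vd1 (b c) s t)); set (F := dot (vd1 (b c) s t) (vd2 (b c) s t)).
  set (G := dot (vd2 (b c) s t) (vd2 (b c) s t)).
  set (L := dot (vd1 (b c) s t) (vd1 (nu e1 e2 g c) s t)).
  set (M := dot (vd1 (b c) s t) (vd2 (nu e1 e2 g c) s t)).
  set (N := dot (vd2 (b c) s t) (vd2 (nu e1 e2 g c) s t)).
  intros [K1 K2]; split.
  - transitivity (sg * 0); [rewrite <- K1; ring [Hsg]|ring].
  - transitivity (sg * 0); [rewrite <- K2; ring [Hsg]|ring].
Qed.

(** The last condition says that the unbounded curvature of the first surface is not
    the bounded curvature of the second one. *)
Definition comparable (s t : R) : Prop :=
  (locally_2d agree s t /\ near_axis e1 e2 g c q k s t /\ near_axis e1 e2' g c' q' k' (s + h) t) /\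
  kh e1 e2 g c q k s t - sg * k2 k' (s + h) t * (t ^ 2 * lam e1 e2 s) <> 0.

Let HV := open_good e1 e2 g c q Hg Hc Hq.

Lemma comparable_open : open2 comparable.
Proof.
  apply open2_neq0.
  - intros s t [H1 [H2 H3]]; apply locally_2d_and; [now apply open2_locally|apply locally_2d_and].
    + exact (open_near e1 e2 g c q k Hg Hc Hq Hk s t H2).
    + apply locally_2d_shift; exact (open_near e1 e2' g c' q' k' Hg Hc' Hq' Hk' _ t H3).
  - intros s t [H1 [H2 H3]]; apply continuity_2d_pt_minus.
    + apply (smooth2_cont (good e1 e2 g c q)); [now apply smooth_kh|exact (near_good _ _ _ _ _ _ _ _ H2)].
    + apply continuity_2d_pt_mult; [apply continuity_2d_pt_mult; [apply continuity_2d_pt_const|]|].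
      * apply continuity_2d_shift, (smooth2_cont (pU c')); [now apply (smooth_k2 e1 e2' g c' k')|].
        exact (good_U _ _ _ _ _ _ _ (near_good _ _ _ _ _ _ _ _ H3)).
      * pose proof (smooth2_lam _ HV e1 e2); pose proof (smooth2_snd _ HV).
        apply (smooth2_cont (good e1 e2 g c q) (fun s t => t ^ 2 * lam e1 e2 s)); [smooth2_tac|].
        exact (near_good _ _ _ _ _ _ _ _ H2).
Qed.

Lemma comparable_axis : comparable th0 0.
Proof.
  split; [split; [exact agree_near|split; now apply near_axis_axis]|].
  replace (_ - _) with (kh e1 e2 g c q k th0 0) by ring; now apply kh_axis_neq0.
Qed.

Lemma comparable_agree s t : comparable s t -> agree s t.
Proof. intros [[H _] _]; now apply locally_2d_singleton. Qed.

Lemma comparable_regular s t : comparable s t -> t <> 0 -> lam e1 e2 s <> 0 ->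
  sg * k2 k' (s + h) t = k2 k s t /\
  v2t k' (s + h) t * v2z k s t - v2z k' (s + h) t * v2t k s t = 0 /\
  sg * k1 k' (s + h) t = k1 k s t /\
  v1t k' (s + h) t * v1z k s t - v1z k' (s + h) t * v1t k s t = 0.
Proof.
  intros [[H1 [H2 H3]] H4] Ht Hl.
  assert (Hl' : lam e1 e2' (s + h) <> 0) by now apply lam_shift_neq0.
  pose proof (near_good _ _ _ _ _ _ _ _ H2) as G2; pose proof (near_good _ _ _ _ _ _ _ _ H3) as G3.
  destruct (eigen_principal e1 e2 g c q k Hg Hc Hq Hk s t G2 Ht Hl) as [K1 [K2 [K3 K4]]].
  destruct (eigen_principal e1 e2' g c' q' k' Hg Hc' Hq' Hk' _ t G3 Ht Hl') as [J1 [J2 _]].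
  apply (agree_eigen s t _ _ _ H1) in J1; apply (agree_eigen s t _ _ _ H1) in J2.
  assert (HG : fE c s t * fG c s t - fF c s t ^ 2 <> 0).
  { rewrite K4; pose proof (rho_neq0 e1 e2 g c q s t G2 Ht Hl).
    pose proof (nlen_pos e1 e2 g c q s t G2).
    apply Rmult_integral_contrapositive; split; apply pow_nonzero; lra. }
  destruct (pri_nonzero _ _ _ _ _ Hk' _ _ (good_U _ _ _ _ _ _ _ G3)) as [Z1 Z2].
  apply pair_neq0 in Z1; apply pair_neq0 in Z2.
  assert (N1 : sg * k2 k' (s + h) t <> k1 k s t).
  { intros E; apply H4; rewrite E, (k1_kh e1 e2 g c q k Hg Hc Hq Hk s t G2 Ht Hl); field.
    now split. }
  destruct (eigen_unique _ _ _ _ _ _ _ _ _ _ _ _ _ _ _ HG K1 K2 K3 J2 Z2 N1) as [E2 P2].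
  assert (K3' : v2t k s t * v1z k s t - v2z k s t * v1t k s t <> 0) by lra.
  assert (N2 : sg * k1 k' (s + h) t <> k2 k s t).
  { rewrite <- E2; intros E; apply (k1_neq_k2 e1 e2' g c' q' k' Hg Hc' Hq' Hk' _ t H3 Ht Hl').
    transitivity (sg * (sg * k1 k' (s + h) t)); [ring [Hsg]|rewrite E; ring [Hsg]]. }
  destruct (eigen_unique _ _ _ _ _ _ _ _ _ _ _ _ _ _ _ HG K2 K1 K3' J1 Z1 N2) as [E1 P1].
  repeat split; assumption.
Qed.

Lemma comparable_k2 s t : comparable s t -> k2 k s t = sg * k2 k' (s + h) t /\
  v2t k' (s + h) t * v2z k s t - v2z k' (s + h) t * v2t k s t = 0 /\
  v1t k' (s + h) t * v1z k s t - v1z k' (s + h) t * v1t k s t = 0.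
Proof.
  assert (Cu : forall f s t, smooth2 (pU c) f -> comparable s t -> continuity_2d_pt f s t).
  { intros f u v Hf H; apply (smooth2_cont (pU c)); [exact Hf|exact (proj1 (comparable_agree u v H))]. }
  assert (Cu' : forall f s t, smooth2 (pU c') f -> comparable s t -> continuity_2d_pt (fun s t => f (s + h) t) s t).
  { intros f u v Hf H; apply continuity_2d_shift, (smooth2_cont (pU c'));
      [exact Hf|exact (proj1 (proj2 (comparable_agree u v H)))]. }
  intros H; split; [apply Rminus_diag_uniq|split]; by_density e1 e2 comparable s t comparable_open H.
  2, 4, 6 : intros Ht Hl; destruct (comparable_regular s t H Ht Hl) as [E [E' [_ E'']]];
    assumption || lra.
  - apply continuity_2d_pt_minus; [exact (Cu _ s t (smooth_k2 _ _ _ _ _ Hk) H)|].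
    apply continuity_2d_pt_mult; [apply continuity_2d_pt_const|].
    exact (Cu' _ s t (smooth_k2 _ _ _ _ _ Hk') H).
  - apply continuity_2d_pt_minus; apply continuity_2d_pt_mult;
      first [exact (Cu' _ s t (smooth_v2t _ _ _ _ _ Hk') H)|exact (Cu' _ s t (smooth_v2z _ _ _ _ _ Hk') H)
            |exact (Cu _ s t (smooth_v2t _ _ _ _ _ Hk) H)|exact (Cu _ s t (smooth_v2z _ _ _ _ _ Hk) H)].
  - apply continuity_2d_pt_minus; apply continuity_2d_pt_mult;
      first [exact (Cu' _ s t (smooth_v1t _ _ _ _ _ Hk') H)|exact (Cu' _ s t (smooth_v1z _ _ _ _ _ Hk') H)
            |exact (Cu _ s t (smooth_v1t _ _ _ _ _ Hk) H)|exact (Cu _ s t (smooth_v1z _ _ _ _ _ Hk) H)].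
Qed.

Lemma d_scaled_shift f f' s t : locally_2d (fun s t => f s t = sg * f' (s + h) t) s t ->
  d1 f s t = sg * d1 f' (s + h) t /\ d2 f s t = sg * d2 f' (s + h) t.
Proof.
  intros H; rewrite (d1_ext_loc _ _ _ _ H), (d2_ext_loc _ _ _ _ H), <- d1_shift, <- d2_shift.
  unfold d1, d2; now rewrite !Derive_scal.
Qed.

Lemma comparable_d_k2 s t : comparable s t ->
  d1 (k2 k) s t = sg * d1 (k2 k') (s + h) t /\ d2 (k2 k) s t = sg * d2 (k2 k') (s + h) t.
Proof.
  intros H; apply d_scaled_shift, locally_2d_mono with (2 := comparable_open s t H).
  intros u v Huv; apply (comparable_k2 u v Huv).
Qed.

Lemma comparable_nonzero s t : comparable s t ->
  (v1t k' (s + h) t <> 0 \/ v1z k' (s + h) t <> 0) /\ (v2t k' (s + h) t <> 0 \/ v2z k' (s + h) t <> 0).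
Proof.
  intros H; destruct (pri_nonzero _ _ _ _ _ Hk' _ _ (proj1 (proj2 (comparable_agree s t H)))) as [Z1 Z2].
  split; now apply pair_neq0.
Qed.

Lemma transport_ridge2 s t : comparable s t -> ridge2 c' k' (s + h) t -> ridge2 c k s t.
Proof.
  intros H [_ [Ht D]]; split; [exact (proj1 (comparable_agree s t H))|split; [exact Ht|]].
  unfold dir_deriv in *; destruct (comparable_d_k2 s t H) as [-> ->].
  destruct (comparable_k2 s t H) as [_ [P _]].
  transitivity (sg * (v2t k s t * d1 (k2 k') (s + h) t + v2z k s t * d2 (k2 k') (s + h) t));
    [unfold v2t, v2z; ring|].
  rewrite (parallel_annihilate _ _ _ _ _ _ (proj2 (comparable_nonzero s t H)) P D); ring.
Qed.

Lemma transport_subpar2 s t : comparable s t -> subparabolic2 c' k' (s + h) t -> subparabolic2 c k s t.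
Proof.
  intros H [_ [Ht D]]; split; [exact (proj1 (comparable_agree s t H))|split; [exact Ht|]].
  unfold dir_deriv in *; destruct (comparable_d_k2 s t H) as [-> ->].
  destruct (comparable_k2 s t H) as [_ [_ P]].
  transitivity (sg * (v1t k s t * d1 (k2 k') (s + h) t + v1z k s t * d2 (k2 k') (s + h) t));
    [unfold v1t, v1z; ring|].
  rewrite (parallel_annihilate _ _ _ _ _ _ (proj1 (comparable_nonzero s t H)) P D); ring.
Qed.

Lemma transport_ridge1 s t : comparable s t -> ridge1 e1 e2' c' k' (s + h) t -> ridge1 e1 e2 c k s t.
Proof.
  intros H [[_ [Ht Hl']] D]; assert (Hl : lam e1 e2 s <> 0) by now apply lam_shift_neq0.
  split; [split; [exact (proj1 (comparable_agree s t H))|now split]|].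
  assert (E : d1 (k1 k) s t = sg * d1 (k1 k') (s + h) t /\ d2 (k1 k) s t = sg * d2 (k1 k') (s + h) t).
  { apply d_scaled_shift.
    assert (Hn : t ^ 2 * lam e1 e2 s <> 0).
    { apply Rmult_integral_contrapositive; split; [now apply pow_nonzero|exact Hl]. }
    assert (O : open2 (fun s t => comparable s t /\ t ^ 2 * lam e1 e2 s <> 0)).
    { apply open2_neq0; [exact comparable_open|]; intros u v Huv.
      apply (smooth2_cont (good e1 e2 g c q) (fun s t => t ^ 2 * lam e1 e2 s)).
      - pose proof (smooth2_lam _ HV e1 e2); pose proof (smooth2_snd _ HV); smooth2_tac.
      - apply Huv. }
    apply locally_2d_mono with (2 := O s t (conj H Hn)).
    intros u v [Huv Hz]; destruct (regular_split e1 e2 u v Hz).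
    symmetry; now apply comparable_regular. }
  unfold dir_deriv in *; destruct E as [-> ->].
  destruct (comparable_k2 s t H) as [_ [_ P]].
  transitivity (sg * (v1t k s t * d1 (k1 k') (s + h) t + v1z k s t * d2 (k1 k') (s + h) t));
    [unfold v1t, v1z; ring|].
  rewrite (parallel_annihilate _ _ _ _ _ _ (proj1 (comparable_nonzero s t H)) P D); ring.
Qed.

End Transport.

(** * Counting germs of half-branches *)

Lemma locally_2d_box (P : R -> R -> Prop) s : locally_2d P s 0 ->
  exists d, 0 < d /\ forall u v, Rabs (u - s) < d -> Rabs v < d -> P u v.
Proof.
  intros [d Hd]; exists d; split; [apply cond_pos|]; intros u v Hu Hv; apply Hd; [exact Hu|].
  now rewrite Rminus_0_r.
Qed.

(** A simple zero on the axis starts a single curve: nearby, every horizontal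
    line meets the zero set at most once, by Rolle's theorem. *)
Lemma zero_set_graph (V : R -> R -> Prop) f s : open2 V -> smooth2 V f -> V s 0 ->
  d1 f s 0 <> 0 ->
  exists d, 0 < d /\ forall u u' v, Rabs (u - s) < d -> Rabs (u' - s) < d -> Rabs v < d ->
    f u v = 0 -> f u' v = 0 -> u = u'.
Proof.
  intros HV Hf Hs Hd.
  assert (L : locally_2d (fun u v => V u v /\ d1 f u v <> 0) s 0).
  { apply (open2_neq0 V (d1 f) HV); [|now split].
    intros u v Huv; apply (smooth2_cont V); [now apply smooth2_d1|exact Huv]. }
  destruct (locally_2d_box _ _ L) as [d [Hd0 B]].
  exists d; split; [exact Hd0|]; intros u u' v Hu Hu' Hv E E'.
  assert (I : forall w, Rmin u u' <= w <= Rmax u u' -> Rabs (w - s) < d).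
  { intros w Hw; apply Rabs_def2 in Hu; apply Rabs_def2 in Hu'.
    unfold Rmin, Rmax in Hw; destruct (Rle_dec u u'); apply Rabs_def1; lra. }
  destruct (mvt_seg (fun w => f w v) (fun w => d1 f w v) u u') as [w [Hw K]].
  - intros w Hw; apply (smooth2_is_d1 V); [exact Hf|now apply B, Hv; apply I].
  - rewrite E, E' in K; assert (K' : d1 f w v * (u' - u) = 0) by lra.
    apply Rmult_integral in K'; destruct K' as [K'|K']; [|lra].
    now destruct (B w v (I w Hw) Hv).
Qed.

Lemma simple_zero_factor (C v f : R -> R) K s : (forall t, f t = K * v t * C t) ->
  (forall t, K * v t <> 0) -> ex_derive v s -> ex_derive f s -> C s = 0 ->
  Derive C s <> 0 -> Derive f s <> 0.
Proof.
  intros E Hn Hv Hf H0 H1 H2; apply H1.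
  rewrite (Derive_ext C (fun t => f t / (K * v t))).
  - rewrite Derive_div; [|exact Hf|now apply ex_derive_scal|apply Hn].
    assert (F0 : f s = 0) by (rewrite E, H0; ring).
    rewrite H2, F0; field.
    specialize (Hn s); split; intros Z; apply Hn; rewrite Z; ring.
  - intros t; rewrite E; field; specialize (Hn t); split; intros Z; apply Hn; rewrite Z; ring.
Qed.

(** The points of [S] near the axis form at most one curve through each zero of [C],
    a graph over the [z]-axis, and do not accumulate anywhere else. *)
Definition isolated (S : R -> R -> Prop) (C : R -> R) : Prop := forall s,
  (C s <> 0 -> exists d, 0 < d /\ forall u v, Rabs (u - s) < d -> Rabs v < d -> ~ S u v) /\
  (C s = 0 -> exists d, 0 < d /\ forall u u' v, Rabs (u - s) < d -> Rabs (u' - s) < d ->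
     Rabs v < d -> S u v -> S u' v -> u = u').

Lemma isolated_intro (S V : R -> R -> Prop) (w f : R -> R -> R) C K :
  open2 V -> smooth2 V f -> smooth2 V w -> (forall s, V s 0) ->
  (forall s t, V s t -> S s t -> f s t = 0) ->
  (forall s, f s 0 = K * w s 0 * C s) -> (forall s, K * w s 0 <> 0) ->
  simple_zeros C -> isolated S C.
Proof.
  intros HV Hf Hw Hax HS E Hn HC s.
  destruct (locally_2d_box _ _ (HV s 0 (Hax s))) as [d0 [Hd0 B0]]; split.
  - intros H.
    assert (N : f s 0 <> 0) by (rewrite E; apply Rmult_integral_contrapositive; split; [apply Hn|exact H]).
    destruct (locally_2d_box _ _ (open2_neq0 V f HV (fun s t H => smooth2_cont V f s t Hf H) s 0
      (conj (Hax s) N))) as [d [Hd B]].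
    exists d; split; [exact Hd|]; intros u v Hu Hv HSu; destruct (B u v Hu Hv) as [B1 B2].
    now apply B2, HS.
  - intros H.
    assert (N : d1 f s 0 <> 0).
    { apply (simple_zero_factor C (fun u => w u 0) (fun u => f u 0) K s E Hn); [| |exact H|exact (HC s H)].
      - eexists; now apply (smooth2_is_d1 V).
      - eexists; now apply (smooth2_is_d1 V). }
    destruct (zero_set_graph V f s HV Hf (Hax s) N) as [d [Hd B]].
    exists (Rmin d0 d); split; [now apply Rmin_pos|].
    intros u u' v Hu Hu' Hv HSu HSu'; apply Rmin_Rgt in Hu; apply Rmin_Rgt in Hu'; apply Rmin_Rgt in Hv.
    apply (B u u' v); try tauto; apply HS; try assumption; apply B0; tauto.
Qed.

Definition arc (c : pm -> param) (S : pm -> R -> R -> Prop) (H : vec -> Prop)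
    (e2 : pm) (th z : R -> R) : Prop :=
  (forall t, continuous th t) /\ (forall t, continuous z t) /\ z 0 = 0 /\
  (forall t, 0 < t <= 1 -> z t <> 0 /\ S e2 (th t) (z t)) /\
  (forall v, H v <-> exists t, 0 < t <= 1 /\ v = b (c e2) (th t) (z t)).

Lemma continuous_near (f : R -> R) t d : continuous f t -> 0 < d ->
  exists r, 0 < r /\ forall s, Rabs (s - t) < r -> Rabs (f s - f t) < d.
Proof.
  intros H Hd; destruct (proj1 (filterlim_locally _ _) H (mkposreal d Hd)) as [r Hr].
  exists r; split; [apply cond_pos|exact Hr].
Qed.

Lemma arc_near (th z : R -> R) d : (forall t, continuous th t) -> (forall t, continuous z t) ->
  z 0 = 0 -> 0 < d ->
  exists r, 0 < r <= 1 /\ forall t, 0 <= t <= r -> Rabs (th t - th 0) < d /\ Rabs (z t) < d.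
Proof.
  intros Hth Hz Z0 Hd.
  destruct (continuous_near th 0 d (Hth 0) Hd) as [r1 [R1 B1]].
  destruct (continuous_near z 0 d (Hz 0) Hd) as [r2 [R2 B2]].
  set (r := Rmin (Rmin r1 r2 / 2) 1).
  assert (Hr : 0 < r <= 1 /\ r < r1 /\ r < r2).
  { assert (0 < Rmin r1 r2) by now apply Rmin_pos.
    pose proof (Rmin_l r1 r2); pose proof (Rmin_r r1 r2).
    pose proof (Rmin_l (Rmin r1 r2 / 2) 1); pose proof (Rmin_r (Rmin r1 r2 / 2) 1).
    assert (0 < r) by (unfold r; apply Rmin_pos; lra); unfold r in *; lra. }
  exists r; split; [lra|]; intros t Ht.
  assert (Ha : Rabs (t - 0) = t) by (rewrite Rminus_0_r; apply Rabs_pos_eq; lra).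
  split; [apply B1; lra|].
  specialize (B2 t ltac:(lra)); now rewrite Z0, Rminus_0_r in B2.
Qed.

Lemma vnorm_vz v : Rabs (vz v) <= vnorm v.
Proof.
  unfold vnorm; rewrite <- sqrt_Rsqr_abs; apply sqrt_le_1_alt; unfold dot, Rsqr; nra.
Qed.

(** An arc that has left the axis stays on one side of it. *)
Lemma arc_sign c S H e2 th z : arc c S H e2 th z -> forall t, 0 < t <= 1 -> 0 < z t * z 1.
Proof.
  intros [_ [Hz [_ [HS _]]]] t Ht.
  destruct (HS t Ht) as [N1 _]; destruct (HS 1 ltac:(lra)) as [N2 _].
  destruct (Rlt_dec 0 (z t * z 1)) as [|Hn]; [assumption|exfalso].
  assert (Cz : continuity z) by (intros s; apply continuity_pt_filterlim, Hz).
  destruct (IVT_gen z t 1 0 Cz) as [x [Hx Ex]].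
  - unfold Rmin, Rmax; destruct (Rle_dec (z t) (z 1)); nra.
  - rewrite Rmin_left, Rmax_right in Hx by lra.
    now destruct (HS x ltac:(lra)).
Qed.

Section Germs.
Variables (e1 : pm) (c : pm -> param) (S : pm -> R -> R -> Prop) (C : pm -> R -> R).
Hypotheses (Hiso : forall e2, isolated (S e2) (C e2))
  (Htr : forall e2 e2' th0 th0',
     fA e1 e2 th0 * fB e1 e2' th0' - fB e1 e2 th0 * fA e1 e2' th0' = 0 ->
     exists d, 0 < d /\ forall u v, Rabs (u - th0) < d -> Rabs v < d ->
       S e2' (u + (th0' - th0)) v ->
       S e2 u v /\ b (c e2) u v = b (c e2') (u + (th0' - th0)) v).

Lemma arc_start H e2 th z : arc c S H e2 th z -> C e2 (th 0) = 0.
Proof.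
  intros [Hth [Hz [Z0 [HS _]]]]; apply NNPP; intros N.
  destruct (proj1 (Hiso e2 (th 0)) N) as [d [Hd B]].
  destruct (arc_near th z d Hth Hz Z0 Hd) as [r [Hr Br]]; destruct (Br r ltac:(lra)) as [B1 B2].
  apply (B (th r) (z r)); [exact B1|exact B2|apply HS; lra].
Qed.

(** Two arcs over the same point of the projective line, on the same side of
    the axis, run along the same curve: at equal heights [z] they are at the same
    point, and both pass through all small heights. *)
Lemma arc_germ_incl H H' e2 e2' th z th' z' :
  arc c S H e2 th z -> arc c S H' e2' th' z' ->
  fA e1 e2 (th 0) * fB e1 e2' (th' 0) - fB e1 e2 (th 0) * fA e1 e2' (th' 0) = 0 ->
  0 < z 1 * z' 1 ->
  exists d, 0 < d /\ forall v, vnorm v < d -> H v -> H' v.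
Proof.
  intros HA HA' Hcl Hsg.
  pose proof (arc_start _ _ _ _ HA) as HC.
  pose proof (arc_sign _ _ _ _ _ _ HA) as Sg; pose proof (arc_sign _ _ _ _ _ _ HA') as Sg'.
  destruct HA as [Hth [Hz [Z0 [HS HH]]]], HA' as [Hth' [Hz' [Z0' [HS' HH']]]].
  destruct (proj2 (Hiso e2 (th 0)) HC) as [da [Hda U]].
  destruct (Htr e2 e2' (th 0) (th' 0) Hcl) as [db [Hdb T]].
  set (d := Rmin da db).
  assert (Hd : 0 < d) by now apply Rmin_pos.
  pose proof (Rmin_l da db) as Dl; pose proof (Rmin_r da db) as Dr; fold d in Dl, Dr.
  destruct (arc_near th z d Hth Hz Z0 Hd) as [r [Hr Br]].
  destruct (arc_near th' z' d Hth' Hz' Z0' Hd) as [r' [Hr' Br']].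
  destruct (continuity_ab_min (fun t => Rabs (z t)) r 1) as [tm [Hm Htm]]; [lra| |].
  { intros t _; apply (continuity_pt_comp z Rabs);
      [apply continuity_pt_filterlim, Hz|apply Rcontinuity_abs]. }
  assert (Pm : 0 < Rabs (z tm)) by (apply Rabs_pos_lt, HS; lra).
  assert (Pm' : 0 < Rabs (z' r')) by (apply Rabs_pos_lt, HS'; lra).
  exists (Rmin (Rabs (z tm)) (Rabs (z' r'))); split; [now apply Rmin_pos|].
  intros v Hv Hin; apply Rmin_Rgt in Hv; destruct Hv as [Hv1 Hv2].
  apply HH in Hin; destruct Hin as [t [Ht Ev]].
  assert (Hzt : Rabs (z t) <= vnorm v) by (rewrite Ev; apply (vnorm_vz (b (c e2) (th t) (z t)))).
  assert (Htr0 : t < r).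
  { destruct (Rlt_dec t r); [assumption|exfalso]; specialize (Hm t ltac:(lra)); simpl in Hm; lra. }
  destruct (HS t Ht) as [Nz HSt].
  assert (Cz : continuity z') by (intros s; apply continuity_pt_filterlim, Hz').
  destruct (IVT_gen z' 0 r' (z t) Cz) as [t' [Ht' Et']].
  { rewrite Z0'; specialize (Sg t Ht); specialize (Sg' r' ltac:(lra)).
    assert (P : 0 < z t * z' r').
    { assert (0 < (z t * z 1) * (z' r' * z' 1)) by now apply Rmult_lt_0_compat.
      assert ((z t * z 1) * (z' r' * z' 1) = (z t * z' r') * (z 1 * z' 1)) by ring.
      nra. }
    assert (Rabs (z t) < Rabs (z' r')) by lra.
    unfold Rabs, Rmin, Rmax in *; destruct (Rcase_abs (z t)), (Rcase_abs (z' r')), (Rle_dec 0 (z' r')); nra. }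
  rewrite Rmin_left, Rmax_right in Ht' by lra.
  assert (Nt' : t' <> 0) by (intros E; apply Nz; rewrite <- Et', E; exact Z0').
  destruct (HS' t' ltac:(lra)) as [_ HSt'].
  destruct (Br' t' ltac:(lra)) as [B1 B2]; destruct (Br t ltac:(lra)) as [B3 B4].
  set (u := th' t' - (th' 0 - th 0)).
  assert (Eu : u + (th' 0 - th 0) = th' t') by (unfold u; ring).
  assert (Hu : Rabs (u - th 0) < d) by (replace (u - th 0) with (th' t' - th' 0) by (unfold u; ring); exact B1).
  destruct (T u (z t)) as [T1 T2]; [lra|lra|rewrite Eu, <- Et'; exact HSt'|].
  assert (Eth : th t = u) by (apply (U (th t) u (z t)); try assumption; lra).
  apply HH'; exists t'; split; [lra|].
  rewrite Ev, Eth, T2, Eu, Et'; reflexivity.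
Qed.

(** The classes are labelled by a zero on the projective line and a side of the axis. *)
Definition class_of (p : R * R) (up : bool) (H : vec -> Prop) : Prop :=
  exists e2 th z, arc c S H e2 th z /\
    fA e1 e2 (th 0) * snd p - fB e1 e2 (th 0) * fst p = 0 /\
    (if up then 0 < z 1 else z 1 < 0).

Lemma class_same_germ p up H H' : fst p <> 0 \/ snd p <> 0 ->
  class_of p up H -> class_of p up H' -> same_germ_at_0 H H'.
Proof.
  intros Hp [e2 [th [z [HA [Hcl Hs]]]]] [e2' [th' [z' [HA' [Hcl' Hs']]]]].
  assert (X : fA e1 e2 (th 0) * fB e1 e2' (th' 0) - fB e1 e2 (th 0) * fA e1 e2' (th' 0) = 0).
  { set (a := fA e1 e2 (th 0)) in *; set (b := fB e1 e2 (th 0)) in *.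
    set (a' := fA e1 e2' (th' 0)) in *; set (b' := fB e1 e2' (th' 0)) in *.
    destruct Hp as [Hp|Hp].
    - apply Rmult_eq_reg_l with (fst p); [|exact Hp].
      transitivity (a' * (a * snd p - b * fst p) - a * (a' * snd p - b' * fst p)); [ring|].
      rewrite Hcl, Hcl'; ring.
    - apply Rmult_eq_reg_l with (snd p); [|exact Hp].
      transitivity (b' * (a * snd p - b * fst p) - b * (a' * snd p - b' * fst p)); [ring|].
      rewrite Hcl, Hcl'; ring. }
  assert (Y : 0 < z 1 * z' 1) by (destruct up; nra).
  destruct (arc_germ_incl _ _ _ _ _ _ _ _ HA HA' X Y) as [d [Hd B]].
  destruct (arc_germ_incl _ _ _ _ _ _ _ _ HA' HA ltac:(lra) ltac:(lra)) as [d' [Hd' B']].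
  exists (Rmin d d'); split; [now apply Rmin_pos|]; intros v Hv; apply Rmin_Rgt in Hv.
  split; [now apply B|now apply B'].
Qed.

End Germs.

(** One representative is chosen for each inhabited label. *)
Lemma choose_germs {T} (L : list T) (Rel : T -> (vec -> Prop) -> Prop) :
  (forall l H H', In l L -> Rel l H -> Rel l H' -> same_germ_at_0 H H') ->
  exists gl : list (vec -> Prop), (length gl <= length L)%nat /\
    forall l H, In l L -> Rel l H -> exists H', In H' gl /\ same_germ_at_0 H H'.
Proof.
  induction L as [|l0 L IH]; intros HR.
  - exists nil; split; [auto|intros l H []].
  - destruct IH as [gl [G1 G2]]; [intros l H H' Hl; apply HR; now right|].
    destruct (classic (exists H, Rel l0 H)) as [[H0 R0]|N].
    + exists (H0 :: gl); split; [simpl; lia|]; intros l H [<-|Hl] HRel.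
      * exists H0; split; [now left|]; apply (HR l0); [now left|exact HRel|exact R0].
      * destruct (G2 l H Hl HRel) as [H' [I1 I2]]; exists H'; split; [now right|exact I2].
    + exists gl; split; [simpl; lia|]; intros l H [<-|Hl] HRel; [exfalso; apply N; now exists H|].
      exact (G2 l H Hl HRel).
Qed.

(** A form of degree [n] has at most [n] projective zeros, and each of them starts
    at most one half-branch on either side of the axis. *)
Lemma count_germs e1 g c S C n F kap :
  (forall e2, isolated (S e2) (C e2)) ->
  (forall e2 e2' th0 th0',
     fA e1 e2 th0 * fB e1 e2' th0' - fB e1 e2 th0 * fA e1 e2' th0' = 0 ->
     exists d, 0 < d /\ forall u v, Rabs (u - th0) < d -> Rabs v < d ->
       S e2' (u + (th0' - th0)) v ->
       S e2 u v /\ b (c e2) u v = b (c e2') (u + (th0' - th0)) v) ->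
  form n F -> (forall e2, kap e2 <> 0) ->
  (forall e2 th, C e2 th = kap e2 * F (fA e1 e2 th) (fB e1 e2 th)) ->
  (forall e2, simple_zeros (C e2)) ->
  at_most_curves (2 * n) e1 g c S.
Proof.
  intros Hiso Htr HF Hkap HC Hsz.
  assert (NF : ~ (forall x y, F x y = 0)).
  { intros Z; assert (Z' : forall th, C Pos th = 0) by (intros; rewrite HC, Z; ring).
    apply (Hsz Pos 0 (Z' 0)); rewrite (Derive_ext _ (fun _ => 0) 0 Z'); apply Derive_const. }
  destruct (form_root_classes n F HF NF) as [l [L1 [L2 L3]]].
  destruct (choose_germs (list_prod l (true :: false :: nil))
    (fun pu => class_of e1 c S (fst pu) (snd pu))) as [gl [G1 G2]].
  { intros [p up] H H' Hin; apply (class_same_germ e1 c S C Hiso Htr).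
    apply L2; apply in_prod_iff in Hin; apply Hin. }
  exists gl; split.
  - rewrite length_prod in G1; simpl in G1; lia.
  - intros H [e2 [th [z [Hth [Hz [Z0 [HS HH]]]]]]].
    assert (HA : arc c S H e2 th z).
    { split; [exact Hth|split; [exact Hz|split; [exact Z0|split; [|exact HH]]]].
      intros t Ht; destruct (HS t Ht) as [X1 [X2 _]]; now split. }
    pose proof (arc_start c S C Hiso _ _ _ _ HA) as C0.
    rewrite HC in C0; apply Rmult_integral in C0; destruct C0 as [C0|C0]; [now apply Hkap in C0|].
    destruct (L3 _ _ (fAB_nonzero e1 e2 (th 0)) C0) as [p [Hp Ep]].
    destruct (HS 1 ltac:(lra)) as [N1 _].
    apply (G2 (p, if Rlt_dec 0 (z 1) then true else false)).
    + apply in_prod; [exact Hp|destruct (Rlt_dec 0 (z 1)); simpl; tauto].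
    + exists e2, th, z; split; [exact HA|split; [exact Ep|]]; simpl.
      destruct (Rlt_dec 0 (z 1)); [assumption|lra].
Qed.

Lemma at_most_curves_mono n m e1 g c S : (n <= m)%nat ->
  at_most_curves n e1 g c S -> at_most_curves m e1 g c S.
Proof. intros H [l [L1 L2]]; exists l; split; [lia|exact L2]. Qed.

(** One parameter [d] serves for the size of the box and for the constant in the
    bound, so a Lebesgue number of the covering settles both. *)
Lemma axis_compactness (P : R -> R -> R -> Prop) T :
  (forall d d' u v, 0 < d <= d' -> P d' u v -> P d u v) ->
  (forall s, exists d, 0 < d /\ forall u v, Rabs (u - s) < d -> 0 < Rabs v < d -> P d u v) ->
  exists d, 0 < d /\ forall u v, Rabs u <= T -> 0 < Rabs v < d -> P d u v.
Proof.
  intros Mono H.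
  assert (H' : forall s, exists d : posreal, forall u v, Rabs (u - s) < d -> 0 < Rabs v < d -> P d u v).
  { intros s; destruct (H s) as [d [Hd B]]; now exists (mkposreal d Hd). }
  set (del := fun s => proj1_sig (constructive_indefinite_description _ (H' s))).
  assert (Hdel : forall s u v, Rabs (u - s) < del s -> 0 < Rabs v < del s -> P (del s) u v)
    by (intros s; exact (proj2_sig (constructive_indefinite_description _ (H' s)))).
  destruct (compactness_value_1d (- T) T del) as [d Hd].
  exists d; split; [apply cond_pos|]; intros u v Hu Hv.
  assert (Hu' : - T <= u <= T) by (unfold Rabs in Hu; destruct (Rcase_abs u); lra).
  apply NNPP; intros N; apply (Hd u Hu'); intros [s [_ [Hs Hle]]]; apply N.
  apply (Mono d (del s)); [split; [apply cond_pos|exact Hle]|].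
  apply (Hdel s); [exact Hs|lra].
Qed.

(** * Ridge and subparabolic curves *)

Section Final.
Variables (e1 : pm) (g : germs) (c : pm -> param) (q : pm -> quotients) (k : pm -> principal).
Hypotheses (Hg : normal_form g) (Hc : forall e2, is_param e1 e2 g (c e2))
  (Hq : forall e2, is_quotients e1 e2 g (c e2) (q e2))
  (Hk : forall e2, is_principal e1 e2 g (c e2) (k e2)).

Lemma transport_box (S : pm -> R -> R -> Prop) :
  (forall e2 e2' h sg s t, sg * sg = 1 ->
     (forall th, fA e1 e2' (th + h) = sg * fA e1 e2 th) ->
     (forall th, fB e1 e2' (th + h) = sg * fB e1 e2 th) ->
     comparable e1 g e2 e2' (c e2) (c e2') (q e2) (q e2') (k e2) (k e2') h sg s t ->
     S e2' (s + h) t -> S e2 s t) ->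
  forall e2 e2' th0 th0',
     fA e1 e2 th0 * fB e1 e2' th0' - fB e1 e2 th0 * fA e1 e2' th0' = 0 ->
     exists d, 0 < d /\ forall u v, Rabs (u - th0) < d -> Rabs v < d ->
       S e2' (u + (th0' - th0)) v ->
       S e2 u v /\ b (c e2) u v = b (c e2') (u + (th0' - th0)) v.
Proof.
  intros HS e2 e2' th0 th0' H.
  destruct (fAB_same_class e1 e2 e2' th0 th0' H) as [sg [Hsg Hfr]].
  set (h := th0' - th0) in *.
  assert (HA : forall th, fA e1 e2' (th + h) = sg * fA e1 e2 th) by apply Hfr.
  assert (HB : forall th, fB e1 e2' (th + h) = sg * fB e1 e2 th) by apply Hfr.
  pose proof (comparable_open e1 g e2 e2' _ _ _ _ _ _ Hg (Hc e2) (Hq e2) (Hk e2) (Hc e2') (Hq e2') (Hk e2')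
    h sg) as O.
  pose proof (comparable_axis e1 g e2 e2' _ _ _ _ _ _ Hg (Hc e2) (Hq e2) (Hk e2) (Hc e2') (Hq e2') (Hk e2')
    h sg th0 Hsg HA HB) as A0.
  destruct (locally_2d_box _ _ (O th0 0 A0)) as [d [Hd B]].
  exists d; split; [exact Hd|]; intros u v Hu Hv HSu; pose proof (B u v Hu Hv) as K; split.
  - exact (HS e2 e2' h sg u v Hsg HA HB K HSu).
  - eapply agree_b, comparable_agree, K.
Qed.

Lemma subparabolic1_free : none_near_singular_point e1 (fun e2 => subparabolic1 e1 e2 (c e2) (k e2)).
Proof.
  intros e2 T.
  destruct (axis_compactness (fun d u v => subparabolic1 e1 e2 (c e2) (k e2) u v ->
    d * Rabs (lam e1 e2 u) <= Rabs v) T) as [d [Hd B]].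
  - intros d d' u v Hd HP HS; specialize (HP HS).
    apply Rle_trans with (2 := HP); apply Rmult_le_compat_r; [apply Rabs_pos|lra].
  - intros s.
    pose proof (open_good e1 e2 g _ _ Hg (Hc e2) (Hq e2)) as HV.
    pose proof (smooth_kh e1 e2 g _ _ _ Hg (Hc e2) (Hq e2) (Hk e2)) as Skh.
    pose proof (good_smooth e1 e2 g (c e2) (q e2) _ (smooth_v2t e1 e2 g _ _ (Hk e2))) as S1.
    pose proof (good_smooth e1 e2 g (c e2) (q e2) _ (smooth_v2z e1 e2 g _ _ (Hk e2))) as S2.
    pose proof (smooth2_lam _ HV e1 e2) as Sl.
    set (Gd := good e1 e2 g (c e2) (q e2)) in *.
    set (h := kh e1 e2 g (c e2) (q e2) (k e2)) in *.
    assert (Sl' : smooth2 Gd (fun u _ => dlam e1 e2 u)).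
    { apply smooth2_ext with (d1 (fun u _ => lam e1 e2 u)); [exact HV| |now apply smooth2_d1].
      intros u v _; apply d1_lam. }
    set (N := fun u v => 2 * (h u v * v2z (k e2) u v)).
    set (D := fun u v => v2t (k e2) u v * (d1 h u v * lam e1 e2 u - h u v * dlam e1 e2 u)
                         + v2z (k e2) u v * lam e1 e2 u * d2 h u v).
    assert (SN : smooth2 Gd N) by (unfold N; smooth2_tac).
    assert (SD : smooth2 Gd D) by (unfold D; smooth2_tac).
    assert (G0 : Gd s 0) by exact (good_axis e1 e2 g _ _ Hg (Hc e2) (Hq e2) s).
    assert (N0 : N s 0 <> 0).
    { unfold N; destruct (bounded_axis e1 e2 g _ _ _ Hg (Hc e2) (Hq e2) (Hk e2) s) as [_ [X _]].
      pose proof (kh_axis_neq0 e1 e2 g _ _ _ Hg (Hc e2) (Hq e2) (Hk e2) s).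
      repeat apply Rmult_integral_contrapositive_currified; [lra|assumption|assumption]. }
    assert (Pn : 0 < Rabs (N s 0) / 2) by (pose proof (Rabs_pos_lt _ N0); lra).
    pose proof (smooth2_cont _ _ _ _ SN G0 (mkposreal _ Pn)) as L1.
    pose proof (smooth2_cont _ _ _ _ SD G0 (mkposreal _ Rlt_0_1)) as L2.
    destruct (locally_2d_box _ _ (locally_2d_and _ _ _ _ (HV s 0 G0) (locally_2d_and _ _ _ _ L1 L2)))
      as [d [Hd B]]; simpl in B.
    set (m := Rabs (N s 0) / 2) in *; set (K := Rabs (D s 0) + 1).
    assert (HK : 0 < K) by (unfold K; pose proof (Rabs_pos (D s 0)); lra).
    assert (HmK : 0 < m / K) by now apply Rdiv_lt_0_compat.
    exists (Rmin d (m / K)); split; [now apply Rmin_pos|].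
    intros u v Hu Hv HS.
    pose proof (Rmin_l d (m / K)) as Ml; pose proof (Rmin_r d (m / K)) as Mr.
    destruct (B u v ltac:(lra) ltac:(lra)) as [B0 [B1 B2]].
    pose proof (subpar1_bound e1 e2 g _ _ _ Hg (Hc e2) (Hq e2) (Hk e2) u v B0 HS) as E.
    fold h in E; change (lam e1 e2 u * N u v = v * D u v) in E.
    assert (XN : m <= Rabs (N u v)).
    { pose proof (Rabs_triang_inv (N s 0) (N s 0 - N u v)) as X.
      replace (N s 0 - (N s 0 - N u v)) with (N u v) in X by ring.
      rewrite (Rabs_minus_sym (N s 0) (N u v)) in X; unfold m in *; lra. }
    assert (XD : Rabs (D u v) <= K).
    { pose proof (Rabs_triang (D u v - D s 0) (D s 0)) as X.
      replace (D u v - D s 0 + D s 0) with (D u v) in X by ring; unfold K; lra. }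
    apply (f_equal Rabs) in E; rewrite !Rabs_mult in E.
    apply Rle_trans with (m / K * Rabs (lam e1 e2 u)).
    + apply Rmult_le_compat_r; [apply Rabs_pos|exact Mr].
    + apply Rmult_le_reg_l with K; [exact HK|].
      replace (K * (m / K * Rabs (lam e1 e2 u))) with (Rabs (lam e1 e2 u) * m) by (field; lra).
      apply Rle_trans with (Rabs (lam e1 e2 u) * Rabs (N u v)).
      * apply Rmult_le_compat_l; [apply Rabs_pos|exact XN].
      * rewrite E, Rmult_comm; apply Rmult_le_compat_r; [apply Rabs_pos|exact XD].
  - exists (/ d), d; split; [now apply Rinv_0_lt_compat|split; [exact Hd|]].
    intros th z Hth Hz Hl HS; specialize (B th z Hth Hz HS).
    apply (Rmult_lt_compat_l d) in Hl; [|exact Hd].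
    replace (d * (/ d * Rabs z)) with (Rabs z) in Hl by (field; lra); lra.
Qed.

Let near e2 := near_axis e1 e2 g (c e2) (q e2) (k e2).

Lemma isolated_near e2 (S : R -> R -> Prop) f C K :
  smooth2 (good e1 e2 g (c e2) (q e2)) f -> K <> 0 ->
  (forall s t, near e2 s t -> S s t -> f s t = 0) ->
  (forall s, f s 0 = K * v2z (k e2) s 0 * C s) -> simple_zeros C -> isolated S C.
Proof.
  intros Hf HK HS E HC.
  assert (R : forall f, smooth2 (good e1 e2 g (c e2) (q e2)) f -> smooth2 (near e2) f).
  { intros f'; apply smooth2_restrict; apply near_good. }
  apply (isolated_intro S (near e2) (v2z (k e2)) f C K); try assumption.
  - exact (open_near e1 e2 g _ _ _ Hg (Hc e2) (Hq e2) (Hk e2)).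
  - now apply R.
  - exact (R _ (good_smooth e1 e2 g _ _ _ (smooth_v2z e1 e2 g _ _ (Hk e2)))).
  - intros s; exact (near_axis_axis e1 e2 g _ _ _ Hg (Hc e2) (Hq e2) (Hk e2) s).
  - intros s; apply Rmult_integral_contrapositive; split; [exact HK|].
    exact (proj1 (proj2 (bounded_axis e1 e2 g _ _ _ Hg (Hc e2) (Hq e2) (Hk e2) s))).
Qed.

Lemma sign_neq0 x : x * x = 1 -> x <> 0.
Proof. intros H E; rewrite E in H; lra. Qed.

Lemma wa_pos_const : 0 < 4 * D3 (gR g) 0 0 0 ^ 2 / (D1 (gP g) 0 0 0 * D2 (gQ g) 0 0 0).
Proof.
  destruct (nf_positive _ Hg) as [p1 [p2 p3]].
  apply Rdiv_lt_0_compat; [pose proof (pow_lt _ 2 p3); lra|now apply Rmult_lt_0_compat].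
Qed.

Lemma ridge1_count : (forall e2, simple_zeros (C1 e1 e2 g (c e2) (q e2))) ->
  at_most_curves 10 e1 g c (fun e2 => ridge1 e1 e2 (c e2) (k e2)).
Proof.
  intros HC.
  apply (count_germs e1 g c _ (fun e2 => C1 e1 e2 g (c e2) (q e2)) 5 (C1f e1 g)
    (fun e2 => tau e1 e2 * (4 * D3 (gR g) 0 0 0 ^ 2 / (D1 (gP g) 0 0 0 * D2 (gQ g) 0 0 0)))).
  - intros e2.
    apply (isolated_near e2 _ (phi_ridge1 e1 e2 g (c e2) (q e2) (k e2)) _
      (- (wL e1 e2 g (c e2) 0 0 / wa e1 e2 g (c e2) (q e2) 0 0) / (2 * wa e1 e2 g (c e2) (q e2) 0 0))).
    + now apply smooth_phi_ridge1.
    + pose proof (wL_axis_neq0 e1 e2 g _ Hg (Hc e2) 0) as X1.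
      pose proof (wa_neq0 e1 e2 g (c e2) (q e2) 0 0 (good_axis e1 e2 g _ _ Hg (Hc e2) (Hq e2) 0)) as X2.
      unfold Rdiv; rewrite Ropp_mult_distr_l_reverse; apply Ropp_neq_0_compat.
      repeat apply Rmult_integral_contrapositive_currified; try assumption;
        apply Rinv_neq_0_compat; [assumption|lra].
    + intros s t H; exact (ridge1_zero e1 e2 g _ _ _ Hg (Hc e2) (Hq e2) (Hk e2) s t H).
    + intros s; exact (phi_ridge1_axis e1 e2 g _ _ _ Hg (Hc e2) (Hq e2) (Hk e2) s).
    + apply HC.
  - apply (transport_box (fun e2 => ridge1 e1 e2 (c e2) (k e2))); intros e2 e2' h sg s t Hsg HA HB.
    exact (transport_ridge1 e1 g e2 e2' _ _ _ _ _ _ Hg (Hc e2) (Hq e2) (Hk e2) (Hc e2') (Hq e2') (Hk e2')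
      h sg Hsg HA HB s t).
  - apply form_C1f.
  - intros e2; apply Rmult_integral_contrapositive; split; [apply sign_neq0, tau_sq|].
    apply Rgt_not_eq, wa_pos_const.
  - intros e2 th; exact (C1_form e1 e2 g _ _ Hg (Hc e2) (Hq e2) th).
  - exact HC.
Qed.

Lemma ridge2_count : (forall e2, simple_zeros (C2 e1 e2 g (c e2) (q e2))) ->
  at_most_curves 18 e1 g c (fun e2 => ridge2 (c e2) (k e2)).
Proof.
  intros HC.
  apply (count_germs e1 g c _ (fun e2 => C2 e1 e2 g (c e2) (q e2)) 9 (C2f e1 g) (fun e2 => sg0 e1 e2)).
  - intros e2.
    apply (isolated_near e2 _ (phi_ridge2 e1 e2 g (c e2) (k e2)) _ (/ (2 * wL e1 e2 g (c e2) 0 0))).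
    + now apply smooth_phi_ridge2.
    + pose proof (wL_axis_neq0 e1 e2 g _ Hg (Hc e2) 0); apply Rinv_neq_0_compat; lra.
    + intros s t _; apply ridge2_zero.
    + intros s; exact (phi_ridge2_axis e1 e2 g _ _ _ Hg (Hc e2) (Hq e2) (Hk e2) s).
    + apply HC.
  - apply (transport_box (fun e2 => ridge2 (c e2) (k e2))); intros e2 e2' h sg s t Hsg HA HB.
    exact (transport_ridge2 e1 g e2 e2' _ _ _ _ _ _ Hg (Hc e2) (Hq e2) (Hk e2) (Hc e2') (Hq e2') (Hk e2')
      h sg Hsg HA HB s t).
  - apply form_C2f.
  - intros e2; apply sign_neq0, s0_sq.
  - intros e2 th; exact (C2_form e1 e2 g _ _ Hg (Hc e2) (Hq e2) th).
  - exact HC.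
Qed.

Lemma subparabolic2_count : (forall e2, simple_zeros (C3 e1 e2 g (c e2) (q e2))) ->
  at_most_curves 10 e1 g c (fun e2 => subparabolic2 (c e2) (k e2)).
Proof.
  intros HC.
  apply (count_germs e1 g c _ (fun e2 => C3 e1 e2 g (c e2) (q e2)) 5 (C3f e1 g) (fun e2 => - eta e1 e2)).
  - intros e2.
    apply (isolated_near e2 _ (phi_subpar2 e1 e2 g (c e2) (q e2) (k e2)) _ (/ 2)).
    + now apply smooth_phi_subpar2.
    + lra.
    + intros s t H; exact (subpar2_zero e1 e2 g _ _ _ Hg (Hc e2) (Hq e2) (Hk e2) s t H).
    + intros s; exact (phi_subpar2_axis e1 e2 g _ _ _ Hg (Hc e2) (Hq e2) (Hk e2) s).
    + apply HC.
  - apply (transport_box (fun e2 => subparabolic2 (c e2) (k e2))); intros e2 e2' h sg s t Hsg HA HB.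
    exact (transport_subpar2 e1 g e2 e2' _ _ _ _ _ _ Hg (Hc e2) (Hq e2) (Hk e2) (Hc e2') (Hq e2') (Hk e2')
      h sg Hsg HA HB s t).
  - apply form_C3f.
  - intros e2; apply Ropp_neq_0_compat, sign_neq0, eta_sq.
  - intros e2 th; exact (C3_form e1 e2 g _ _ Hg (Hc e2) (Hq e2) th).
  - exact HC.
Qed.

End Final.

Theorem theorem2 (e1 : pm) (g : germs)
    (c : pm -> param) (q : pm -> quotients) (k : pm -> principal)
    (Hg : normal_form g)
    (Hc : forall e2, is_param e1 e2 g (c e2))
    (Hq : forall e2, is_quotients e1 e2 g (c e2) (q e2))
    (Hk : forall e2, is_principal e1 e2 g (c e2) (k e2))
    (HC : forall e2, simple_zeros (C1 e1 e2 g (c e2) (q e2)) /\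
                     simple_zeros (C2 e1 e2 g (c e2) (q e2)) /\
                     simple_zeros (C3 e1 e2 g (c e2) (q e2))) :
  at_most_curves 18 e1 g c (fun e2 => ridge1 e1 e2 (c e2) (k e2)) /\
  at_most_curves 18 e1 g c (fun e2 => ridge2 (c e2) (k e2)) /\
  none_near_singular_point e1 (fun e2 => subparabolic1 e1 e2 (c e2) (k e2)) /\
  at_most_curves 10 e1 g c (fun e2 => subparabolic2 (c e2) (k e2)).
Proof.
  split; [|split; [|split]].
  - apply at_most_curves_mono with 10%nat; [lia|].
    apply (ridge1_count e1 g c q k Hg Hc Hq Hk); intros e2; apply HC.
  - apply (ridge2_count e1 g c q k Hg Hc Hq Hk); intros e2; apply HC.
  - exact (subparabolic1_free e1 g c q k Hg Hc Hq Hk).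
  - apply (subparabolic2_count e1 g c q k Hg Hc Hq Hk); intros e2; apply HC.
Qed.
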